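(* Let $(p,p')\in\mathbb{Z}_{\ge 2}\times\mathbb{Z}_{\ge 1}$ be coprime, $a=p'/p$, $c=c_{p,p'}=3(1-2a)$, and let $r$ be an integer with $1\le r\le p-1$. Set $\mathcal{M}(r):=\mathcal{M}_{(p-r)p'+aj_{r,0},\,2aj_{r,0},\,c}$. Then $$\dim\operatorname{Hom}_{\mathfrak{ns}_2}\big(\mathcal{M}(r),\mathcal{V}(r)\big)=1,$$ that is, there exists a singular vector $\mathcal{N}_{p,p'}(r)\in\mathcal{V}(r)^{\bar0}$ with $(L_0,J_0)$-eigenvalue $\big((p-r)p'+aj_{r,0},\,2aj_{r,0}\big)$, unique up to non-zero scalar multiple. In addition, the maximum proper submodule of $\mathcal{V}(r)$ is generated by $\mathcal{N}_{p,p'}(r)$.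
   Context: $\mathfrak{ns}_2$ is the complex Lie superalgebra with even basis $L_n,J_n$ ($n\in\mathbb{Z}$), $C$ and odd basis $G^{\pm}_r$ ($r\in\mathbb{Z}+\frac12$), $C$ central, and $[L_n,L_m]=(n-m)L_{n+m}+\frac{1}{12}(n^3-n)C\delta_{n+m,0}$, $[L_n,J_m]=-mJ_{n+m}$, $[L_n,G^\pm_r]=(\frac n2-r)G^\pm_{n+r}$, $[J_n,J_m]=\frac n3 C\delta_{n+m,0}$, $[J_n,G^\pm_r]=\pm G^\pm_{n+r}$, $[G^+_r,G^-_s]=2L_{r+s}+(r-s)J_{r+s}+\frac13(r^2-\frac14)C\delta_{r+s,0}$, $[G^+_r,G^+_s]=[G^-_r,G^-_s]=0$. $(\mathfrak{ns}_2)_+$ is spanned by the $L_n,J_n$ with $n>0$ and $G^\pm_r$ with $r>0$. The Verma module $\mathcal{M}_{h,q,c}$ is the $\mathbb{Z}_2$-graded $\mathfrak{ns}_2$-module freely generated by an even vector $v$ with $(\mathfrak{ns}_2)_+v=0$, $L_0v=hv$, $J_0v=qv$, $Cv=cv$. A singular vector is a nonzero $L_0,J_0$-eigenvector annihilated by $(\mathfrak{ns}_2)_+$. $j_{m,0}=\frac{m-1}{2}$. For $m\in\mathbb{Z}_{>0}$, $\mathcal{V}(m)$ is the $\mathfrak{ns}_2$-module freely generated by an (even) vector $|m\rangle^{\mathsf{sc}}$ subject to $(\mathfrak{ns}_2)_+|m\rangle^{\mathsf{sc}}=0$, $G^+_{-1/2}|m\rangle^{\mathsf{sc}}=0$, $G^-_{-\frac{2m-1}{2}}\cdots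 G^-_{-\frac32}G^-_{-\frac12}|m\rangle^{\mathsf{sc}}=0$, $L_0|m\rangle^{\mathsf{sc}}=aj_{m,0}|m\rangle^{\mathsf{sc}}$, $J_0|m\rangle^{\mathsf{sc}}=2aj_{m,0}|m\rangle^{\mathsf{sc}}$, $C|m\rangle^{\mathsf{sc}}=3(1-2a)|m\rangle^{\mathsf{sc}}$. (It is the module corresponding to the generalized Verma module of $\widehat{\mathfrak{sl}}_2$ of level $-2+a^{-1}$ with $m$-dimensional top space.) $\mathcal{V}(r)^{\bar0}$ is its even part. *)

(* Defs.v *)
From HB Require Import structures.
From mathcomp Require Import all_boot all_order all_algebra.
From mathcomp Require Import generic_quotient boolp reals complex.

Set Implicit Arguments.
Unset Strict Implicit.
Unset Printing Implicit Defensive.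

Import GRing.Theory Num.Theory.
Local Open Scope ring_scope.
Local Open Scope quotient_scope.

(* The half-integral modes are indexed by integers: [Gp k] is G^+_r and [Gm k] *)
(* is G^-_r with r = k + 1/2.  In particular G^{+-}_{-1/2} has index -1, and   *)
(* r > 0 iff 0 <= k.                                                           *)
Inductive ns2_gen :=
  Ln of int | Jn of int | Cc | Gp of int | Gm of int.

(* false = even, true = odd *)
Definition ns2_parity (x : ns2_gen) : bool :=
  match x with Gp _ | Gm _ => true | _ => false end.

Definition ns2_pos (x : ns2_gen) : bool :=
  match x with
  | Ln n | Jn n => 0 < n
  | Gp k | Gm k => 0 <= k
  | Cc => false
  end.

Section Ns2.
Variable K : numFieldType.

Definition halfmode (k : int) : K := k%:~R + 2%:R^-1.

(* [G^+_r, G^-_s] with r = k + 1/2, s = l + 1/2, so that r + s = k + l + 1 *)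
Definition ns2_GpGm (k l : int) : seq (K * ns2_gen) :=
  let r := halfmode k in
  let s := halfmode l in
  [:: (2%:R, Ln (k + l + 1)); (r - s, Jn (k + l + 1));
      (3%:R^-1 * (r ^+ 2 - 4%:R^-1) * (k + l + 1 == 0)%:R, Cc)].

(* The superbracket of two basis elements, a list of (coefficient, basis       *)
(* element) pairs standing for the corresponding linear combination.           *)
Definition ns2_bracket (x y : ns2_gen) : seq (K * ns2_gen) :=
  match x, y with
  | Ln n, Ln m =>
      [:: ((n - m)%:~R, Ln (n + m));
          (12%:R^-1 * (n ^+ 3 - n)%:~R * (n + m == 0)%:R, Cc)]
  | Ln n, Jn m => [:: (- m%:~R, Jn (n + m))]
  | Jn m, Ln n => [:: (m%:~R, Jn (n + m))]
  | Ln n, Gp k => [:: (n%:~R / 2%:R - halfmode k, Gp (n + k))]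
  | Gp k, Ln n => [:: (- (n%:~R / 2%:R - halfmode k), Gp (n + k))]
  | Ln n, Gm k => [:: (n%:~R / 2%:R - halfmode k, Gm (n + k))]
  | Gm k, Ln n => [:: (- (n%:~R / 2%:R - halfmode k), Gm (n + k))]
  | Jn n, Jn m => [:: (n%:~R / 3%:R * (n + m == 0)%:R, Cc)]
  | Jn n, Gp k => [:: (1, Gp (n + k))]
  | Gp k, Jn n => [:: (-1, Gp (n + k))]
  | Jn n, Gm k => [:: (-1, Gm (n + k))]
  | Gm k, Jn n => [:: (1, Gm (n + k))]
  | Gp k, Gm l => ns2_GpGm k l
  | Gm l, Gp k => ns2_GpGm k l
  | Gp _, Gp _ => [::]
  | Gm _, Gm _ => [::]
  | Cc, _ => [::]
  | _, Cc => [::]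
  end.

(* Z_2-graded ns_2-modules: [ns2_homog b] is the homogeneous component of      *)
(* parity b, and the action is given on the basis of ns_2.                     *)
Record ns2_module := Ns2Module {
  ns2_space :> lmodType K;
  ns2_homog : bool -> ns2_space -> Prop;
  ns2_act : ns2_gen -> {linear ns2_space -> ns2_space};
  ns2_homog0 : forall b, ns2_homog b 0;
  ns2_homogZD : forall b (k : K) u v,
    ns2_homog b u -> ns2_homog b v -> ns2_homog b (k *: u + v);
  ns2_homog_sum : forall u, exists u0 u1,
    [/\ ns2_homog false u0, ns2_homog true u1 & u = u0 + u1];
  ns2_homog_cap : forall u, ns2_homog false u -> ns2_homog true u -> u = 0;
  ns2_homog_act : forall b x u,
    ns2_homog b u -> ns2_homog (b (+) ns2_parity x) (ns2_act x u);
  ns2_act_bracket : forall x y u,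
    ns2_act x (ns2_act y u)
      - (-1) ^+ (ns2_parity x && ns2_parity y) *: ns2_act y (ns2_act x u)
    = \sum_(t <- ns2_bracket x y) t.1 *: ns2_act t.2 u
}.

Arguments ns2_act {_} x.

(* The last clause says that submodules are graded. *)
Definition ns2_submodule (M : ns2_module) (S : M -> Prop) : Prop :=
  [/\ S 0,
      forall (k : K) u v, S u -> S v -> S (k *: u + v),
      forall x u, S u -> S (ns2_act x u) &
      forall u0 u1, ns2_homog false u0 -> ns2_homog true u1 ->
        S (u0 + u1) -> S u0 /\ S u1].

Definition ns2_generated (M : ns2_module) (v : M) : M -> Prop :=
  fun u => forall S : M -> Prop, ns2_submodule S -> S v -> S u.

Definition ns2_proper (M : ns2_module) (S : M -> Prop) : Prop :=
  exists u, ~ S u.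

Definition ns2_maximum_proper_submodule (M : ns2_module) (S : M -> Prop) :
    Prop :=
  [/\ ns2_submodule S, ns2_proper S &
      forall T : M -> Prop, ns2_submodule T -> ns2_proper T ->
        forall u, T u -> S u].

(* Hom is taken in the category of Z_2-graded modules, so morphisms preserve  *)
(* parity.                                                                     *)
Definition ns2_hom (M N : ns2_module) (f : {linear M -> N}) : Prop :=
  (forall b u, ns2_homog b u -> ns2_homog b (f u)) /\
  (forall x u, f (ns2_act x u) = ns2_act x (f u)).

Definition ns2_hom_dim (M N : ns2_module) (n : nat) : Prop :=
  exists b : 'I_n -> {linear M -> N},
    (forall i, ns2_hom (b i)) /\
    (forall f : {linear M -> N}, ns2_hom f ->
       exists! c : 'rV[K]_n, forall u, f u = \sum_(i < n) c 0 i *: b i u).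

(* The ns_2-module freely generated by an even vector v subject to the         *)
(* relations P; by generation, the morphism in the last clause is unique.      *)
Definition ns2_free_on (P : forall M : ns2_module, M -> Prop)
    (M : ns2_module) (v : M) : Prop :=
  [/\ ns2_homog false v, P M v, (forall u, ns2_generated v u) &
      forall (N : ns2_module) (w : N), ns2_homog false w -> P N w ->
        exists f : {linear M -> N}, ns2_hom f /\ f v = w].

Definition ns2_killed_by_pos (M : ns2_module) (v : M) : Prop :=
  forall x, ns2_pos x -> ns2_act x v = 0.

Definition verma_rel (h q c : K) (M : ns2_module) (v : M) : Prop :=
  [/\ ns2_killed_by_pos v, ns2_act (Ln 0) v = h *: v,
      ns2_act (Jn 0) v = q *: v & ns2_act Cc v = c *: v].

Definition is_verma (h q c : K) (M : ns2_module) (v : M) : Prop :=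
  ns2_free_on (verma_rel h q c) v.

(* G^-_{-(2m-1)/2} ... G^-_{-3/2} G^-_{-1/2} v *)
Fixpoint Gm_string (M : ns2_module) (m : nat) (v : M) : M :=
  match m with
  | 0 => v
  | m'.+1 => ns2_act (Gm (- (m'.+1)%:Z)) (Gm_string m' v)
  end.

Definition jm0 (m : nat) : K := (m%:R - 1) / 2%:R.

Definition sc_rel (a : K) (m : nat) (M : ns2_module) (v : M) : Prop :=
  [/\ ns2_killed_by_pos v,
      ns2_act (Gp (-1)) v = 0,
      Gm_string m v = 0 &
      [/\ ns2_act (Ln 0) v = (a * jm0 m) *: v,
          ns2_act (Jn 0) v = (2%:R * a * jm0 m) *: v &
          ns2_act Cc v = (3%:R * (1 - 2%:R * a)) *: v]].

Definition is_sc_verma (a : K) (m : nat) (M : ns2_module) (v : M) : Prop :=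
  ns2_free_on (sc_rel a m) v.

Definition ns2_singular (h q : K) (M : ns2_module) (u : M) : Prop :=
  [/\ u <> 0, ns2_act (Ln 0) u = h *: u, ns2_act (Jn 0) u = q *: u &
      ns2_killed_by_pos u].

End Ns2.

Arguments ns2_act {K _} x.

(* Existence of the modules above: formal terms in a generator, identified     *)
(* when they agree under every evaluation at an even vector satisfying P.      *)
Section Presentation.
Variable K : numFieldType.
Variable P : forall M : ns2_module K, M -> Prop.

Inductive pterm :=
  PGen | PZero | PAdd of pterm & pterm | PScale of K & pterm
| PAct of ns2_gen & pterm.

HB.instance Definition _ := gen_eqMixin pterm.
HB.instance Definition _ := gen_choiceMixin pterm.

Fixpoint peval (M : ns2_module K) (w : M) (t : pterm) : M :=
  match t with
  | PGen => w
  | PZero => 0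
  | PAdd t1 t2 => peval w t1 + peval w t2
  | PScale k t1 => k *: peval w t1
  | PAct x t1 => ns2_act x (peval w t1)
  end.

Definition peq (t1 t2 : pterm) : bool :=
  `[< forall (M : ns2_module K) (w : M), ns2_homog false w -> P w ->
        peval w t1 = peval w t2 >].

Lemma peq_refl : reflexive peq.
Proof. by move=> t; apply/asboolP. Qed.
Lemma peq_sym : symmetric peq.
Proof.
by move=> s t; apply/asboolP/asboolP => H M w h p; rewrite (H M w h p).
Qed.
Lemma peq_trans : transitive peq.
Proof.
move=> s t u /asboolP H1 /asboolP H2; apply/asboolP => M w h p.
by rewrite (H1 M w h p) (H2 M w h p).
Qed.

Canonical peq_equiv := EquivRel peq peq_refl peq_sym peq_trans.

Definition pmod := {eq_quot peq}%qT.
HB.instance Definition _ := Choice.on pmod.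

Definition pcls (t : pterm) : pmod := \pi_pmod t.
Definition prep (u : pmod) : pterm := repr u.

Lemma prepK u : pcls (prep u) = u.
Proof. exact: reprK. Qed.

Lemma pclsP t1 t2 : pcls t1 = pcls t2 <->
  forall (M : ns2_module K) (w : M), ns2_homog false w -> P w ->
    peval w t1 = peval w t2.
Proof.
split; first by move/eqP; rewrite eqmodE => /asboolP.
by move=> H; apply/eqP; rewrite eqmodE; apply/asboolP.
Qed.

Lemma pevalK t (M : ns2_module K) (w : M) : ns2_homog false w -> P w ->
  peval w (prep (pcls t)) = peval w t.
Proof. by move: M w; apply/pclsP; exact: prepK. Qed.

Definition padd u v := pcls (PAdd (prep u) (prep v)).
Definition pscale k u := pcls (PScale k (prep u)).
Definition popp u := pscale (-1) u.
Definition pact x u := pcls (PAct x (prep u)).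

Lemma pmodP (u v : pmod) :
  (forall (M : ns2_module K) (w : M), ns2_homog false w -> P w ->
     peval w (prep u) = peval w (prep v)) -> u = v.
Proof. by move=> H; rewrite -(prepK u) -(prepK v); apply/pclsP. Qed.

Fact paddA : associative padd.
Proof. by move=> u v t; apply: pmodP => M w h p; rewrite !pevalK //= !pevalK //= addrA. Qed.
Fact paddC : commutative padd.
Proof. by move=> u v; apply: pmodP => M w h p; rewrite !pevalK //= addrC. Qed.
Fact padd0 : left_id (pcls PZero) padd.
Proof. by move=> u; apply: pmodP => M w h p; rewrite !pevalK //= !pevalK //= add0r. Qed.
Fact paddN : left_inverse (pcls PZero) popp padd.
Proof.
by move=> u; apply: pmodP => M w h p; rewrite !pevalK //= !pevalK //= scaleN1r addNr.
Qed.

HB.instance Definition _ := GRing.isZmodule.Build pmod paddA paddC padd0 paddN.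

Fact pscaleA (a b : K) (u : pmod) : pscale a (pscale b u) = pscale (a * b) u.
Proof. by apply: pmodP => M w h p; rewrite !pevalK //= !pevalK //= scalerA. Qed.
Fact pscale1 : left_id 1 pscale.
Proof. by move=> u; apply: pmodP => M w h p; rewrite !pevalK //= scale1r. Qed.
Fact pscaleDr : right_distributive pscale +%R.
Proof.
by move=> a u v; apply: pmodP => M w h p; rewrite !pevalK //= !pevalK //= scalerDr.
Qed.
Fact pscaleDl (u : pmod) : {morph pscale^~ u : a b / a + b}.
Proof.
by move=> a b; apply: pmodP => M w h p; rewrite !pevalK //= !pevalK //= scalerDl.
Qed.

HB.instance Definition _ :=
  GRing.Zmodule_isLmodule.Build K pmod pscaleA pscale1 pscaleDr pscaleDl.

Section Eval.
Variables (M : ns2_module K) (w : M) (hw : ns2_homog false w) (Pw : P w).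
Definition pev (u : pmod) : M := peval w (prep u).
Fact pev_linear : linear pev.
Proof. by move=> k u v; rewrite /pev !pevalK //= pevalK. Qed.
Definition pev_lin : {linear pmod -> M} :=
  HB.pack pev (GRing.isLinear.Build K pmod M _ pev pev_linear).
Lemma pev_act x u : pev (pact x u) = ns2_act x (pev u).
Proof. by rewrite /pev pevalK. Qed.
End Eval.

Lemma pmod_ext (u v : pmod) :
  (forall (M : ns2_module K) (w : M) (hw : ns2_homog false w) (Pw : P w),
     pev w u = pev w v) -> u = v.
Proof. exact: pmodP. Qed.

Fact pact_linear x : linear (pact x).
Proof.
move=> k u v; apply: pmod_ext => M w hw Pw.
have E := pev_act hw Pw; have L := pev_linear hw Pw.
by rewrite E !L !E linearP.
Qed.
HB.instance Definition _ x :=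
  GRing.isLinear.Build K pmod pmod _ (pact x) (pact_linear x).

Fixpoint pproj (b : bool) (t : pterm) : pterm :=
  match t with
  | PGen => if b then PZero else PGen
  | PZero => PZero
  | PAdd t1 t2 => PAdd (pproj b t1) (pproj b t2)
  | PScale k t1 => PScale k (pproj b t1)
  | PAct x t1 => PAct x (pproj (b (+) ns2_parity x) t1)
  end.

Lemma homogD (M : ns2_module K) b (u v : M) :
  ns2_homog b u -> ns2_homog b v -> ns2_homog b (u + v).
Proof. by move=> hu hv; rewrite -[u]scale1r; exact: ns2_homogZD. Qed.

Lemma homogZ (M : ns2_module K) b k (u : M) :
  ns2_homog b u -> ns2_homog b (k *: u).
Proof.
by move=> hu; rewrite -[_ *: _]addr0; apply: ns2_homogZD => //; exact: ns2_homog0.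
Qed.

Lemma pproj_homog (M : ns2_module K) (w : M) : ns2_homog false w ->
  forall t b, ns2_homog b (peval w (pproj b t)).
Proof.
move=> hw; elim=> [||t1 I1 t2 I2|k t I|x t I] b /=.
- by case: b => //=; exact: ns2_homog0.
- exact: ns2_homog0.
- exact: homogD.
- exact: homogZ.
- by have := ns2_homog_act x (I (b (+) ns2_parity x)); rewrite -addbA addbb addbF.
Qed.

Lemma pproj_sum (M : ns2_module K) (w : M) t :
  peval w t = peval w (pproj false t) + peval w (pproj true t).
Proof.
elim: t => [||t1 I1 t2 I2|k t I|x t I] /=; rewrite ?addr0 //.
- by rewrite {1}I1 {1}I2 addrACA.
- by rewrite {1}I scalerDr.
- by rewrite {1}I linearD /=; case: (ns2_parity x) => //=; rewrite addrC.
Qed.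

Definition phomog (b : bool) (u : pmod) : Prop :=
  forall (M : ns2_module K) (w : M), ns2_homog false w -> P w ->
    ns2_homog b (pev w u).

Fact phomog0 b : phomog b 0.
Proof. by move=> M w hw Pw; rewrite /pev pevalK //=; exact: ns2_homog0. Qed.
Fact phomogZD b (k : K) (u v : pmod) :
  phomog b u -> phomog b v -> phomog b (k *: u + v).
Proof.
move=> hu hv M w hw Pw; rewrite (pev_linear hw Pw).
by apply: ns2_homogZD; [exact: hu | exact: hv].
Qed.
Fact phomog_sum u : exists u0 u1,
  [/\ phomog false u0, phomog true u1 & u = u0 + u1].
Proof.
exists (pcls (pproj false (prep u))), (pcls (pproj true (prep u))); split.
- by move=> M w hw Pw; rewrite /pev pevalK //; exact: pproj_homog.
- by move=> M w hw Pw; rewrite /pev pevalK //; exact: pproj_homog.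
- apply: pmod_ext => M w hw Pw; rewrite [in RHS]/pev pevalK //= !pevalK //.
  exact: pproj_sum.
Qed.
Fact phomog_cap u : phomog false u -> phomog true u -> u = 0.
Proof.
move=> h0 h1; apply: pmod_ext => M w hw Pw; rewrite [in RHS]/pev pevalK //=.
by apply: ns2_homog_cap; [exact: h0 | exact: h1].
Qed.
Fact phomog_act b x u :
  phomog b u -> phomog (b (+) ns2_parity x) (pact x u).
Proof.
move=> hu M w hw Pw; rewrite (pev_act hw Pw).
by apply: ns2_homog_act; exact: hu.
Qed.
Fact pact_bracket x y (u : pmod) :
  pact x (pact y u)
    - (-1) ^+ (ns2_parity x && ns2_parity y) *: pact y (pact x u)
  = \sum_(t <- ns2_bracket K x y) t.1 *: pact t.2 u.
Proof.
apply: pmod_ext => M w hw Pw.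
have E := pev_act hw Pw.
rewrite -[LHS]/(pev_lin hw Pw _) -[RHS]/(pev_lin hw Pw _) linearB linearZ.
rewrite linear_sum /= !E.
rewrite ns2_act_bracket; apply: eq_bigr => t _.
by rewrite -[RHS]/(pev_lin hw Pw _) linearZ /= E.
Qed.

Definition ns2_presented : ns2_module K :=
  @Ns2Module K pmod phomog (fun x => pact x : {linear pmod -> pmod})
    phomog0 phomogZD phomog_sum phomog_cap phomog_act pact_bracket.

Definition ns2_presented_gen : ns2_presented := pcls PGen.

Lemma ns2_presented_act x t :
  ns2_act x (pcls t : ns2_presented) = pcls (PAct x t).
Proof. by apply/pclsP => M w hw Pw /=; rewrite pevalK. Qed.

Lemma ns2_presented_scale k t :
  k *: (pcls t : ns2_presented) = pcls (PScale k t).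
Proof. by apply/pclsP => M w hw Pw /=; rewrite pevalK. Qed.

Lemma ns2_presented_free :
  P ns2_presented_gen -> ns2_free_on P ns2_presented_gen.
Proof.
move=> Pg; split=> //.
- by move=> M w hw Pw; rewrite /= /pev pevalK.
- move=> u S [S0 SZD Sact _] Sg; rewrite -(prepK u).
  elim: (prep u) => [||t1 I1 t2 I2|k t I|x t I] //.
  + have -> : pcls (PAdd t1 t2) = 1 *: (pcls t1 : ns2_presented) + pcls t2.
      by rewrite scale1r; apply/pclsP => M w hw Pw /=; rewrite !pevalK.
    exact: SZD.
  + have -> : pcls (PScale k t) = k *: (pcls t : ns2_presented) + 0.
      by rewrite addr0 ns2_presented_scale.
    exact: SZD.
  + by rewrite -ns2_presented_act; exact: Sact.
- move=> N w hw Pw.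
  exists (pev_lin hw Pw : {linear ns2_presented -> N}); split; last by rewrite /= /pev pevalK.
  split; first by move=> b u hu; exact: hu.
  by move=> x u; exact: pev_act.
Qed.

End Presentation.

Lemma verma_exists (K : numFieldType) (h q c : K) :
  exists (M : ns2_module K) (v : M), is_verma h q c v.
Proof.
exists (ns2_presented (verma_rel h q c)), (ns2_presented_gen _).
apply: ns2_presented_free; rewrite /ns2_presented_gen; split.
- by move=> x hx; rewrite ns2_presented_act; apply/pclsP => M w _ [killed] *; exact: killed.
- by rewrite ns2_presented_act ns2_presented_scale; apply/pclsP => M w _ [] _ /= ->.
- by rewrite ns2_presented_act ns2_presented_scale; apply/pclsP => M w _ [] _ _ /= ->.
- by rewrite ns2_presented_act ns2_presented_scale; apply/pclsP => M w _ [] _ _ _ /= ->.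
Qed.

Lemma sc_verma_exists (K : numFieldType) (a : K) (m : nat) :
  exists (M : ns2_module K) (v : M), is_sc_verma a m v.
Proof.
exists (ns2_presented (sc_rel a m)), (ns2_presented_gen _).
apply: ns2_presented_free; rewrite /ns2_presented_gen; split.
- by move=> x hx; rewrite ns2_presented_act; apply/pclsP => M w _ [killed] *; exact: killed.
- by rewrite ns2_presented_act; apply/pclsP => M w _ [] _ /= ->.
- pose fix str n := if n is n'.+1 then PAct (Gm (- (n'.+1)%:Z)) (str n')
                    else PGen K.
  have E n : Gm_string n (pcls (sc_rel a m) (PGen K) : ns2_presented _) =
             pcls _ (str n).
    by elim: n => //= n ->; rewrite ns2_presented_act.
  rewrite E; apply/pclsP => M w _ [] _ _ H _ /=.
  rewrite -[RHS]H; elim: (m) => //= n ->.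
  by [].
- split; rewrite ns2_presented_act ns2_presented_scale; apply/pclsP => M w _.
  + by case=> _ _ _ [] /= ->.
  + by case=> _ _ _ [] _ /= ->.
  + by case=> _ _ _ [] _ _ /= ->.
Qed.

(* Main.v *)
Require Import Defs.
From HB Require Import structures.
From mathcomp Require Import all_boot all_order all_algebra.
From mathcomp Require Import generic_quotient boolp reals complex.
From mathcomp Require Import ring zify.

(* Put t = 1/a = p/p'. A vector killed by the positive part and by            *)
(* G^+_{-1/2}, with the weights of |rho>^sc (rho any scalar), generates a     *)
(* module of type rho. In the frame of the spectral flow by k >> 0 it          *)
(* coincides, up to any given level, with a quotient of the Verma module of    *)
(* parameter kappa = k by iterated singular vectors, provided rho is not an    *)
(* integer. The weights of that Verma module are polynomial in kappa, hence    *)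
(* so are the linear systems defining the singular vectors, whose number is    *)
(* therefore the same for almost all kappa. Type - rho at k' is type rho at    *)
(* kappa = rho + k': so modules of types rho and - rho built by dividing out   *)
(* corresponding singular vectors have the same singular vectors, of charge    *)
(* and level (k, n) and (- k, n) respectively.                                 *)
(* Composed with an automorphism carrying type rho to type t - rho, this       *)
(* reflection carries rho to rho + t and (k, n) to (k, n - k). After applying  *)
(* it p' - 1 times to V(r), which becomes of type t - r, one reaches the type  *)
(* p - r, where the singular vector looked for is the extremal vector          *)
(* G^-_{-(2m-1)/2} ... G^-_{-1/2} w with m = p - r, which PBW controls.        *)
(* Comparing in the same way the quotient of V(r) by this vector at both ends  *)
(* of the chain, where it is integrable, leaves no singular vector but the     *)
(* generator: the quotient is simple.                                          *)

Set Implicit Arguments.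
Unset Strict Implicit.
Unset Printing Implicit Defensive.

Import GRing.Theory Num.Theory.
Local Open Scope ring_scope.

(** * Linear combinations and the bracket *)

(** Let t = 1/a = p/p'. A module of type rho ([topmod]) is generated by a vector having the weights
    of the generator of V(rho), for rho any scalar, and killed by the positive part and by
    G^+_{-1/2}. [Sk] describes the vectors of charge - k and level n that are singular for the
    positive part moved by the spectral flow k; [Topk] asks in addition that the next G^+ kills
    them. One G^- and one G^+ relate [Sk] at k and at k + 1, and their product is the scalar [cc].
    For fixed n the values of k with [cc rho (k - 1) n = 0] are the roots of a quadratic polynomial
    and add up to rho ([cc_roots]). Hence, for rho not an integer, a [Topk] vector starts a string
    that never breaks and is seen in every frame further up ([Topk_stable]).

    In a far frame k the module agrees, up to any given level, with a Verma module divided by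
    iterated singular vectors ([adm], [universal_adm], [adm_cons]). The weights of this Verma module
    are polynomial in k, so the singular vectors are counted by ranks of polynomial matrices, which
    are constant outside finitely many parameters ([generic_codim], [generic_sing]). Type - rho at k
    and type rho at rho + k give the same Verma module; therefore types rho and - rho have the same
    singular vectors up to the sign of the charge ([adm_reflect], [tow_Topk_reflect]). Composed with
    the automorphism [tau], which exchanges rho and t - rho, this moves rho to rho + t and (k, n) to
    (k, n - k) ([tow_step]).

    V(r) is the universal module of type r divided by its extremal vector at (r, 0) ([V_tow]). After
    [tau] its type is t - r, and p' - 1 steps lead to p - r; coprimality keeps all types before the
    last one non-integral ([rho1_nonint]). At that end the extremal vector at (p - r, 0) is non-zero
    and spans its weight space ([extremal]). Carried back, it yields a unique line of singular
    vectors of charge 0 and level (p - r)p' ([tauV_line], [sing_line0]).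

    In the quotient by this line the extremal string breaks off at both ends of the chain.
    [integrable_Topk] then bounds k from both sides, and the equation [cc = 0] leaves only (k, n) =
    (0, 0) ([topsing_trivial]). Since a non-zero submodule contains a [Topk] vector ([sub_Topk]), a
    submodule not contained in the one generated by the singular vector contains the generator
    ([sub_contains_top]). *)

Section LinearExpressions.
Variables (K : pzRingType) (V : lmodType K).

(** Reified linear combinations of atoms: an equation in a module reduces to equations between
    coefficients, within reach of [ring] and [field]. *)
Inductive lexp :=
  LVar of nat | LZero | LAdd of lexp & lexp | LOpp of lexp | LScale of K & lexp.

Fixpoint leval (vs : seq V) (e : lexp) : V :=
  match e with
  | LVar i => nth 0 vs i
  | LZero => 0
  | LAdd e1 e2 => leval vs e1 + leval vs e2
  | LOpp e1 => - leval vs e1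
  | LScale k e1 => k *: leval vs e1
  end.

Fixpoint lcoef (e : lexp) (i : nat) : K :=
  match e with
  | LVar j => (i == j)%:R
  | LZero => 0
  | LAdd e1 e2 => lcoef e1 i + lcoef e2 i
  | LOpp e1 => - lcoef e1 i
  | LScale k e1 => k * lcoef e1 i
  end.

Fixpoint lcoefs_eq (e1 e2 : lexp) (n : nat) : Prop :=
  if n is n'.+1 then lcoef e1 n' = lcoef e2 n' /\ lcoefs_eq e1 e2 n' else True.

Lemma leval_coef vs e : leval vs e = \sum_(i < size vs) lcoef e i *: vs`_i.
Proof.
elim: e => [j||e1 I1 e2 I2|e1 I1|k e1 I1] /=; rewrite ?I1 ?I2.
- have [lt_j|le_j] := ltnP j (size vs).
    rewrite (bigD1 (Ordinal lt_j)) //= eqxx scale1r big1 ?addr0 // => i.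
    by rewrite -val_eqE /= => /negbTE ->; rewrite scale0r.
  rewrite nth_default // big1 // => i _.
  by rewrite ltn_eqF ?scale0r // (leq_trans (ltn_ord i)).
- by rewrite big1 // => i _; rewrite scale0r.
- by rewrite -big_split; apply: eq_bigr => i _; rewrite scalerDl.
- by rewrite -sumrN; apply: eq_bigr => i _; rewrite scaleNr.
- by rewrite scaler_sumr; apply: eq_bigr => i _; rewrite scalerA.
Qed.

Lemma lexpP vs e1 e2 : lcoefs_eq e1 e2 (size vs) -> leval vs e1 = leval vs e2.
Proof.
rewrite !leval_coef; elim: (size vs) => [|n IHn] /=; first by rewrite !big_ord0.
by case=> H /IHn; rewrite !big_ord_recr /= H => ->.
Qed.
End LinearExpressions.

Ltac lmod_mem v l :=
  lazymatch l with
  | nil => constr:(false)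
  | ?w :: ?l' => lazymatch constr:((v, w)) with
     | (?x, ?x) => constr:(true) | _ => lmod_mem v l' end
  end.
Ltac lmod_atoms t l :=
  lazymatch t with
  | GRing.zero => l
  | Algebra.zero => l
  | ?a + ?b => let l1 := lmod_atoms a l in lmod_atoms b l1
  | - ?a => lmod_atoms a l
  | _ *: ?a => lmod_atoms a l
  | _ => let b := lmod_mem t l in
         lazymatch b with true => l | _ => constr:(t :: l) end
  end.
Ltac lmod_index v l :=
  lazymatch l with
  | ?w :: ?l' => lazymatch constr:((v, w)) with
     | (?x, ?x) => constr:(0%N)
     | _ => let i := lmod_index v l' in constr:(S i) end
  end.
Ltac lmod_reify K t l :=
  lazymatch t with
  | Algebra.zero => constr:(@LZero K)
  | ?a + ?b => let a' := lmod_reify K a l in let b' := lmod_reify K b l in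
               constr:(LAdd a' b')
  | - ?a => let a' := lmod_reify K a l in constr:(LOpp a')
  | ?k *: ?a => let a' := lmod_reify K a l in constr:(@LScale K k a')
  | _ => let i := lmod_index t l in constr:(@LVar K i)
  end.
Ltac lmod_ring t :=
  match t with context [@GRing.scale ?K _ _ _] => K end.
(* Reduces an equation between linear combinations to the equality of the      *)
(* coefficients of its atoms.                                                  *)
Ltac lmod_coefs :=
  match goal with
  | |- ?u = ?v :> ?T =>
    let K := lmod_ring constr:((u, v)) in
    let l := lmod_atoms u (@nil T) in
    let l := lmod_atoms v l in
    let e1 := lmod_reify K u l in
    let e2 := lmod_reify K v l in
    apply: (@lexpP K _ l e1 e2); rewrite /= ?mulr0 ?mulr1 ?addr0 ?add0r ?oppr0
  end.
Ltac lmod := lmod_coefs; repeat (split; first by ring); try exact: I.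

Ltac lmod_field := lmod_coefs; repeat (split; first by field); try exact: I.

(** Makes [ns2_gen] countable, so that words can be numbered by [pickle] and serve as exponents of
    monomials. *)
Definition ns2_code (x : ns2_gen) : nat * int :=
  match x with
  | Ln n => (0%N, n) | Jn n => (1%N, n) | Cc => (2%N, 0)
  | Gp i => (3%N, i) | Gm i => (4%N, i)
  end.
Definition ns2_decode (c : nat * int) : ns2_gen :=
  match c.1 with
  | 0%N => Ln c.2 | 1%N => Jn c.2 | 2%N => Cc | 3%N => Gp c.2 | _ => Gm c.2
  end.
Lemma ns2_codeK : cancel ns2_code ns2_decode.
Proof. by case. Qed.
HB.instance Definition _ := Countable.copy ns2_gen (can_type ns2_codeK).

Section Bracket.
Variable K : numFieldType.

Definition lcomb (V : lmodType K) (f : ns2_gen -> V) (s : seq (K * ns2_gen)) : V :=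
  \sum_(t <- s) t.1 *: f t.2.

Definition ssign (x y : ns2_gen) : K := (-1) ^+ (ns2_parity x && ns2_parity y).

Ltac reindex N :=
  repeat match goal with
  | |- context [Ln ?i] => tryif constr_eq i N then fail else rewrite (_ : i = N); last by ring
  | |- context [Jn ?i] => tryif constr_eq i N then fail else rewrite (_ : i = N); last by ring
  | |- context [Gp ?i] => tryif constr_eq i N then fail else rewrite (_ : i = N); last by ring
  | |- context [Gm ?i] => tryif constr_eq i N then fail else rewrite (_ : i = N); last by ring
  | |- context [@eq_op _ ?i ?z] => tryif constr_eq i N then fail else rewrite (_ : i = N); last by ring
  end.
(** Brackets are formal lists, so identities between them are stated after evaluation by an
    arbitrary [f]. *)
Lemma bracket_jacobi (V : lmodType K) (f : ns2_gen -> V) x y z :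
  lcomb (fun u => lcomb f (ns2_bracket K x u)) (ns2_bracket K y z)
  + ssign y z *: lcomb (fun u => lcomb f (ns2_bracket K u y)) (ns2_bracket K x z)
  = lcomb (fun u => lcomb f (ns2_bracket K u z)) (ns2_bracket K x y).
Proof.
rewrite /lcomb /ssign.
case: x => [n|n||n|n]; case: y => [m|m||m|m]; case: z => [k|k||k|k] /=;
rewrite ?big_cons ?big_nil /= ?big_cons ?big_nil /= ?expr0 ?expr1 ?addr0
  ?scaler0 ?addr0 ?scaler0 ?scale1r ?addr0 //; rewrite /halfmode.
(* All indices are brought to their common sum. Where a Kronecker delta is 1, one index is
   eliminated, and the coefficients are compared as polynomials in the others. *)
all: try match goal with n : int, m : int, k : int |- _ =>
  reindex (n + m + k); reindex (n + m + k + 1);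
  try match goal with
  | |- context [@eq_op _ (n + m + k) ?z] =>
    have [E|_] := eqVneq (n + m + k) z;
    [have -> : k = - n - m by lia | ]
  | |- context [@eq_op _ (n + m + k + 1) ?z] =>
    have [E|_] := eqVneq (n + m + k + 1) z;
    [have -> : k = - n - m - 1 by lia | ] end end.
all: rewrite ?add0r; by [|lmod_field].
Qed.

Lemma bracket_antisym (V : lmodType K) (f : ns2_gen -> V) x y :
  lcomb f (ns2_bracket K y x) = - ssign x y *: lcomb f (ns2_bracket K x y).
Proof.
rewrite /lcomb /ssign.
case: x => [n|n||n|n]; case: y => [m|m||m|m] /=;
  rewrite ?big_cons ?big_nil /= ?expr0 ?expr1 ?addr0 ?scaler0 ?opprK ?scale1r //.
all: match goal with n : int, m : int |- _ =>
  reindex (n + m); reindex (n + m + 1);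
  try match goal with
  | |- context [@eq_op _ (n + m) ?z] =>
    have [E|_] := eqVneq (n + m) z;
    [have -> : m = - n by lia | ] end end.
all: by [|lmod_field].
Qed.

Lemma bracket_parity x y t : t \in ns2_bracket K x y ->
  ns2_parity t.2 = ns2_parity x (+) ns2_parity y.
Proof.
by case: x => [n|n||n|n]; case: y => [m|m||m|m] //=; rewrite !inE => *;
  repeat match goal with H : is_true (_ || _) |- _ => case/orP: H => H end;
  match goal with H : is_true (_ == _) |- _ => move/eqP: H => -> end.
Qed.

(** The spectral flow by k units: opposite shifts of the modes of G^+ and G^-, with central
    corrections to L_0 and J_0. *)
Definition flow_gen (k : int) (x : ns2_gen) : seq (K * ns2_gen) :=
  match x with
  | Ln n => [:: (1, Ln n); (k%:~R, Jn n); (k%:~R ^+ 2 / 6%:R * (n == 0)%:R, Cc)]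
  | Jn n => [:: (1, Jn n); (k%:~R / 3%:R * (n == 0)%:R, Cc)]
  | Cc => [:: (1, Cc)]
  | Gp i => [:: (1, Gp (i + k))]
  | Gm i => [:: (1, Gm (i - k))]
  end.

Definition mirror_gen (x : ns2_gen) : seq (K * ns2_gen) :=
  match x with
  | Ln n => [:: (1, Ln n)]
  | Jn n => [:: (-1, Jn n)]
  | Cc => [:: (1, Cc)]
  | Gp i => [:: (1, Gm i)]
  | Gm i => [:: (1, Gp i)]
  end.

(** Parity is preserved, and brackets are respected after evaluation by every [f]. *)
Definition ns2_automorphism (al : ns2_gen -> seq (K * ns2_gen)) : Prop :=
  (forall x t, t \in al x -> ns2_parity t.2 = ns2_parity x) /\
  forall (V : lmodType K) (f : ns2_gen -> V) x y,
    lcomb (fun u => lcomb (fun v => lcomb f (ns2_bracket K u v)) (al y)) (al x)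
    = lcomb (fun u => lcomb f (al u)) (ns2_bracket K x y).

Lemma mirror_automorphism : ns2_automorphism mirror_gen.
Proof.
split=> [|V f x y].
  by case=> [n|n||n|n] t; rewrite inE => /eqP ->.
rewrite /lcomb; case: x => [n|n||n|n]; case: y => [m|m||m|m] /=;
  rewrite ?big_cons ?big_nil /= ?big_cons ?big_nil /= ?addr0 ?scaler0 ?big_cons
    ?big_nil /= ?addr0 ?scaler0 //.
all: try match goal with n : int, m : int |- _ =>
  reindex (n + m); reindex (n + m + 1);
  try match goal with
  | |- context [@eq_op _ (n + m + 1) ?z] =>
    have [E|_] := eqVneq (n + m + 1) z;
    [have -> : m = - n - 1 by lia | ] end end.
all: rewrite /halfmode; by lmod_field.
Qed.

Lemma flow_automorphism k : ns2_automorphism (flow_gen k).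
Proof.
split=> [|V f x y].
  by case=> [n|n||n|n] t; rewrite !inE => *;
  repeat match goal with H : is_true (_ || _) |- _ => case/orP: H => H end;
  match goal with H : is_true (_ == _) |- _ => move/eqP: H => -> end.
rewrite /lcomb; case: x => [n|n||n|n]; case: y => [m|m||m|m] /=;
  rewrite ?big_cons ?big_nil /= ?big_cons ?big_nil /= ?addr0 ?scaler0 ?big_cons
    ?big_nil /= ?addr0 ?scaler0 ?addr0 //.
all: match goal with n : int, m : int |- _ =>
  reindex (n + m); reindex (n + m + 1); reindex (n + m + k); reindex (n + m - k);
  try match goal with
  | |- context [@eq_op _ (n + m + 1) ?z] =>
    have [E|_] := eqVneq (n + m + 1) z;
    [have -> : m = - n - 1 by lia | ]
  | |- context [@eq_op _ (n + m) ?z] =>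
    have [E|_] := eqVneq (n + m) z;
    [have -> : m = - n by lia | ] end end.
all: rewrite /halfmode; by lmod_field.
Qed.
End Bracket.

(** * Representations, quotients and twists *)

Lemma addrr_eq0 (K : numFieldType) (V : lmodType K) (x : V) : x + x = 0 -> x = 0.
Proof. by move/eqP; rewrite -mulr2n -scaler_nat scaler_eq0 pnatr_eq0 => /eqP. Qed.

Lemma lcomb_nil (K : numFieldType) (V : lmodType K) (f : ns2_gen -> V) :
  lcomb f [::] = 0.
Proof. exact: big_nil. Qed.

Lemma lcomb_cons (K : numFieldType) (V : lmodType K) (f : ns2_gen -> V) t s :
  lcomb f (t :: s) = t.1 *: f t.2 + lcomb f s.
Proof. exact: big_cons. Qed.

Lemma lcombD (K : numFieldType) (V : lmodType K) (f g : ns2_gen -> V) s :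
  lcomb (fun x => f x + g x) s = lcomb f s + lcomb g s.
Proof. by rewrite /lcomb -big_split; apply: eq_bigr => t _; rewrite scalerDr. Qed.

Lemma lcombZ (K : numFieldType) (V : lmodType K) k (f : ns2_gen -> V) s :
  lcomb (fun x => k *: f x) s = k *: lcomb f s.
Proof.
by rewrite /lcomb scaler_sumr; apply: eq_bigr => t _; rewrite !scalerA mulrC.
Qed.

Lemma lcomb_linear (K : numFieldType) (V W : lmodType K) (h : {linear V -> W})
  (f : ns2_gen -> V) s : h (lcomb f s) = lcomb (fun x => h (f x)) s.
Proof. by rewrite /lcomb linear_sum; apply: eq_bigr => t _; rewrite linearZ. Qed.

Lemma eq_lcomb (K : numFieldType) (V : lmodType K) (f g : ns2_gen -> V)
  (s : seq (K * ns2_gen)) :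
  {in s, forall t, f t.2 = g t.2} -> lcomb f s = lcomb g s.
Proof. by move=> H; apply: eq_big_seq => t /H ->. Qed.

(* The grading of modules is dropped: it plays no role in the arguments. *)
Record rep (K : numFieldType) := Rep {
  rsp :> lmodType K;
  ract : ns2_gen -> {linear rsp -> rsp};
  ractB : forall x y u,
    ract x (ract y u) - ssign K x y *: ract y (ract x u)
    = lcomb (fun z => ract z u) (ns2_bracket K x y) }.
Arguments ract {K _} x.

Section Reps.
Variable K : numFieldType.
Implicit Types N : rep K.

Lemma ract_comm N x y (u : N) :
  ract x (ract y u)
  = ssign K x y *: ract y (ract x u) + lcomb (ract^~ u) (ns2_bracket K x y).
Proof. by rewrite -ractB addrC subrK. Qed.

Lemma ract_odd_square N x (u : N) : ns2_parity x -> ract x (ract x u) = 0.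
Proof.
move=> px; apply: addrr_eq0; have := ractB x x u; rewrite /ssign px /= expr1 scaleN1r opprK => ->.
by case: x px => // i _; exact: lcomb_nil.
Qed.

Definition rep_of (M : ns2_module K) : rep K :=
  @Rep K M (fun x => ns2_act x) (@ns2_act_bracket K M).

Definition is_sub N (S : N -> Prop) : Prop :=
  [/\ S 0, forall (k : K) u v, S u -> S v -> S (k *: u + v)
    & forall x u, S u -> S (ract x u)].

Section Sub.
Variables (N : rep K) (S : N -> Prop) (HS : is_sub S).
Lemma sub0 : S 0. Proof. by case: HS. Qed.
Lemma subZD k u v : S u -> S v -> S (k *: u + v).
Proof. by case: HS => _ H _; apply: H. Qed.
Lemma subZ k u : S u -> S (k *: u).
Proof. by move=> Su; rewrite -[_ *: _]addr0; apply: subZD => //; exact: sub0. Qed.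
Lemma subD u v : S u -> S v -> S (u + v).
Proof. by move=> Su Sv; rewrite -[u]scale1r; apply: subZD. Qed.
Lemma subN u : S u -> S (- u).
Proof. by rewrite -scaleN1r; exact: subZ. Qed.
Lemma subB u v : S u -> S v -> S (u - v).
Proof. by move=> Su /subN; exact: subD. Qed.
Lemma sub_act x u : S u -> S (ract x u).
Proof. by case: HS => _ _; apply. Qed.
Lemma sub_sum (I : Type) (r : seq I) (P : pred I) (F : I -> N) :
  (forall i, P i -> S (F i)) -> S (\sum_(i <- r | P i) F i).
Proof. by move=> H; elim/big_ind: _ => //; [exact: sub0 | exact: subD]. Qed.
Lemma sub_lcomb (f : ns2_gen -> N) s : (forall x, S (f x)) -> S (lcomb f s).
Proof. by move=> H; apply: sub_sum => t _; apply: subZ. Qed.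
End Sub.

Definition gen N (A : N -> Prop) : N -> Prop :=
  fun u => forall S, is_sub S -> (forall v, A v -> S v) -> S u.

Lemma gen_sub N (A : N -> Prop) : is_sub (gen A).
Proof.
split=> [S HS _|k u v Hu Hv S HS HA|x u Hu S HS HA].
- exact: sub0.
- by apply: subZD => //; [exact: Hu | exact: Hv].
- by apply: sub_act => //; exact: Hu.
Qed.

Lemma gen_in N (A : N -> Prop) u : A u -> gen A u.
Proof. by move=> Au S _; apply. Qed.

Lemma gen_min N (A S : N -> Prop) :
  is_sub S -> (forall v, A v -> S v) -> forall u, gen A u -> S u.
Proof. by move=> HS HA u; apply. Qed.

Definition hom N1 N2 (f : {linear N1 -> N2}) : Prop :=
  forall x u, f (ract x u) = ract x (f u).

Lemma hom_preim N1 N2 (f : {linear N1 -> N2}) (S : N2 -> Prop) :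
  hom f -> is_sub S -> is_sub (fun u => S (f u)).
Proof.
move=> hf HS; split=> [|k u v|x u].
- by rewrite linear0; exact: sub0.
- by rewrite linearP; exact: subZD.
- by rewrite hf; exact: sub_act.
Qed.

Lemma sub_zero N : is_sub (fun u : N => u = 0).
Proof.
by split=> // [k u v -> ->|x u ->]; rewrite ?scaler0 ?addr0 ?linear0.
Qed.

Lemma hom_ker N1 N2 (f : {linear N1 -> N2}) :
  hom f -> is_sub (fun u => f u = 0).
Proof. by move=> hf; exact: (hom_preim (S := fun u => u = 0) hf (@sub_zero N2)). Qed.

Lemma hom_img N1 N2 (f : {linear N1 -> N2}) (S : N1 -> Prop) :
  hom f -> is_sub S -> is_sub (fun u => exists2 v, S v & f v = u).
Proof.
move=> hf HS; split=> [|k u v [u' Su <-] [v' Sv <-]|x u [u' Su <-]].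
- by exists 0; [exact: sub0 | rewrite linear0].
- by exists (k *: u' + v'); [exact: subZD | rewrite linearP].
- by exists (ract x u'); [exact: sub_act | rewrite hf].
Qed.

Lemma hom_ext N1 N2 (f g : {linear N1 -> N2}) w :
  hom f -> hom g -> (forall u, gen (eq w) u) -> f w = g w -> forall u, f u = g u.
Proof.
move=> hf hg Hw E u; suff: f u - g u = 0 by move/eqP; rewrite subr_eq0 => /eqP.
apply: (Hw u (fun u => f u - g u = 0)); last by move=> _ <-; rewrite E subrr.
split=> [|k v1 v2 H1 H2|x v H]; first by rewrite (linear0 f) (linear0 g) subrr.
- by rewrite (linearP f) (linearP g) opprD addrACA H2 addr0 -scalerBr H1 scaler0.
- by rewrite hf hg -linearB H linear0.
Qed.

Section Quotient.
Variables (N : rep K) (S : N -> Prop) (HS : is_sub S).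

Definition qrel (u v : N) : bool := `[< S (u - v) >].
Lemma qrel_refl : reflexive qrel.
Proof. by move=> u; apply/asboolP; rewrite subrr; exact: sub0. Qed.
Lemma qrel_sym : symmetric qrel.
Proof.
by move=> u v; apply/asboolP/asboolP => /(subN HS); rewrite opprB.
Qed.
Lemma qrel_trans : transitive qrel.
Proof.
move=> v u w /asboolP Huv /asboolP Hvw; apply/asboolP.
by have := subD HS Huv Hvw; rewrite addrA subrK.
Qed.
Canonical qrel_equiv := EquivRel qrel qrel_refl qrel_sym qrel_trans.
Definition qsp := {eq_quot qrel}%qT.
HB.instance Definition _ := Choice.on qsp.
Definition qcls (u : N) : qsp := (\pi_qsp u)%qT.
Definition qrep (u : qsp) : N := repr u.

Lemma qrepK u : qcls (qrep u) = u. Proof. exact: reprK. Qed.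
Lemma qclsP u v : qcls u = qcls v <-> S (u - v).
Proof.
split; first by move/eqP; rewrite eqmodE => /asboolP.
by move=> H; apply/eqP; rewrite eqmodE; apply/asboolP.
Qed.
Lemma qclsK u : S (qrep (qcls u) - u).
Proof. by apply/qclsP; rewrite qrepK. Qed.

Definition qadd u v := qcls (qrep u + qrep v).
Definition qscale k u := qcls (k *: qrep u).
Definition qopp u := qcls (- qrep u).

Lemma qaddE u v : qadd (qcls u) (qcls v) = qcls (u + v).
Proof.
apply/qclsP; have := subD HS (qclsK u) (qclsK v).
by rewrite addrACA -opprD.
Qed.
Lemma qscaleE k u : qscale k (qcls u) = qcls (k *: u).
Proof. by apply/qclsP; rewrite -scalerBr; apply: subZ => //; exact: qclsK. Qed.
Lemma qoppE u : qopp (qcls u) = qcls (- u).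
Proof. by apply/qclsP; rewrite -opprD; apply: subN => //; exact: qclsK. Qed.

Lemma q_ind (P : qsp -> Prop) : (forall u, P (qcls u)) -> forall u, P u.
Proof. by move=> H u; rewrite -(qrepK u). Qed.

Fact qaddA : associative qadd.
Proof. by do 3!elim/q_ind=> ?; rewrite !qaddE addrA. Qed.
Fact qaddC : commutative qadd.
Proof. by do 2!elim/q_ind=> ?; rewrite !qaddE addrC. Qed.
Fact qadd0 : left_id (qcls 0) qadd.
Proof. by elim/q_ind=> ?; rewrite !qaddE add0r. Qed.
Fact qaddN : left_inverse (qcls 0) qopp qadd.
Proof. by elim/q_ind=> ?; rewrite qoppE !qaddE addNr. Qed.
HB.instance Definition _ := GRing.isZmodule.Build qsp qaddA qaddC qadd0 qaddN.

Fact qscaleA (a b : K) u : qscale a (qscale b u) = qscale (a * b) u.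
Proof. by elim/q_ind: u => ?; rewrite !qscaleE scalerA. Qed.
Fact qscale1 : left_id 1 qscale.
Proof. by elim/q_ind=> ?; rewrite qscaleE scale1r. Qed.
Fact qscaleDr : right_distributive qscale +%R.
Proof.
by move=> a; do 2!elim/q_ind=> ?; rewrite [_ + _]qaddE !qscaleE [RHS]qaddE scalerDr.
Qed.
Fact qscaleDl u : {morph qscale^~ u : a b / a + b}.
Proof.
by elim/q_ind: u => ? a b; rewrite !qscaleE [RHS]qaddE scalerDl.
Qed.
HB.instance Definition _ :=
  GRing.Zmodule_isLmodule.Build K qsp qscaleA qscale1 qscaleDr qscaleDl.

Fact qcls_linear : linear qcls.
Proof. by move=> k u v; rewrite -[RHS]/(qadd (qscale k _) _) qscaleE qaddE. Qed.
HB.instance Definition _ := GRing.isLinear.Build K N qsp _ qcls qcls_linear.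

Definition qact x (u : qsp) : qsp := qcls (ract x (qrep u)).
Lemma qactE x u : qact x (qcls u) = qcls (ract x u).
Proof. by apply/qclsP; rewrite -linearB; apply: sub_act => //; exact: qclsK. Qed.
Fact qact_linear x : linear (qact x).
Proof.
move=> k; elim/q_ind=> u; elim/q_ind=> v.
by rewrite -qcls_linear !qactE -qcls_linear linearP.
Qed.
HB.instance Definition _ x := GRing.isLinear.Build K qsp qsp _ (qact x) (qact_linear x).

Fact qactB x y u :
    qact x (qact y u) - ssign K x y *: qact y (qact x u)
    = lcomb (fun z => qact z u) (ns2_bracket K x y).
Proof.
elim/q_ind: u => u; rewrite !qactE -linearZ -linearB ractB lcomb_linear.
by apply: eq_lcomb => t _; rewrite qactE.
Qed.

Definition quotient : rep K :=
  @Rep K qsp (fun x => qact x : {linear qsp -> qsp}) qactB.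

Section Lift.
Variables (N' : rep K) (f : {linear N -> N'}).
Hypothesis Hf : hom f.
Hypothesis Sf : forall u, S u -> f u = 0.

Definition qlift (u : qsp) : N' := f (qrep u).
Lemma qliftE u : qlift (qcls u) = f u.
Proof. by apply/eqP; rewrite -subr_eq0 -linearB Sf //; exact: qclsK. Qed.
Fact qlift_linear : linear qlift.
Proof.
move=> k; elim/q_ind=> u; elim/q_ind=> v.
by rewrite -qcls_linear !qliftE linearP.
Qed.
End Lift.

(** The properties through which quotients are used below: surjective morphism, prescribed kernel,
    factorisation. *)
Lemma quotient_lift : exists (Q : rep K) (g : {linear N -> Q}),
  [/\ hom g, forall u, exists v, g v = u, forall u, g u = 0 <-> S u &
   forall (N' : rep K) (f : {linear N -> N'}), hom f -> (forall u, S u -> f u = 0) ->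
     exists f' : {linear Q -> N'}, hom f' /\ forall u, f' (g u) = f u].
Proof.
exists quotient, (qcls : {linear N -> qsp}); split.
- by move=> x u; rewrite /= qactE.
- by move=> u; exists (qrep u); exact: qrepK.
- move=> u; rewrite -{2}(subr0 u) -qclsP.
  by rewrite linear0.
- move=> N' f Hf Sf.
  pose f' : {linear qsp -> N'} := HB.pack (qlift f)
    (GRing.isLinear.Build K qsp N' _ (qlift f) (qlift_linear Sf)).
  exists f'; split=> [x|u]; last exact: qliftE.
  by elim/q_ind=> u; rewrite /= qactE !qliftE.
Qed.
End Quotient.

Section Twist.
Variables (al : ns2_gen -> seq (K * ns2_gen)) (Hal : ns2_automorphism al).
Variable N : rep K.

Definition tact x (u : N) : N := lcomb (ract^~ u) (al x).
Fact tact_linear x : linear (tact x).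
Proof.
move=> k u v; rewrite /tact -lcombZ -lcombD; apply: eq_lcomb => t _.
by rewrite linearP.
Qed.
HB.instance Definition _ x := GRing.isLinear.Build K N N _ (tact x) (tact_linear x).
Fact tactB x y u :
    tact x (tact y u) - ssign K x y *: tact y (tact x u)
    = lcomb (fun z => tact z u) (ns2_bracket K x y).
Proof.
have [Hp <-] := Hal.
have E z1 z2 : tact z1 (tact z2 u)
    = lcomb (fun u1 => lcomb (fun v => ract u1 (ract v u)) (al z2)) (al z1).
  by apply: eq_lcomb => t _; rewrite lcomb_linear.
have -> : tact y (tact x u)
    = lcomb (fun u1 => lcomb (fun v => ract v (ract u1 u)) (al y)) (al x).
  rewrite E /lcomb [RHS](eq_bigr (fun t => \sum_(s <- al y)
    s.1 *: (t.1 *: ract s.2 (ract t.2 u)))) => [|t _]; last first.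
    by rewrite scaler_sumr; apply: eq_bigr => s _; rewrite !scalerA mulrC.
  by rewrite exchange_big; apply: eq_bigr => t _; rewrite scaler_sumr.
rewrite E -scaleNr -lcombZ -lcombD; apply: eq_lcomb => t Ht.
rewrite -lcombZ -lcombD; apply: eq_lcomb => s Hs.
by rewrite -ractB /ssign (Hp _ _ Ht) (Hp _ _ Hs) scaleNr.
Qed.
Definition twist : rep K := @Rep K N (fun x => tact x : {linear N -> N}) tactB.
End Twist.

Definition flow (k : int) N : rep K := twist (flow_automorphism K k) N.
Definition mirror N : rep K := twist (mirror_automorphism K) N.

(* The ungraded module N made graded by doubling, odd elements exchanging the *)
(* two copies; (u, v) |-> u + v maps it back onto N.                           *)
Section Doubling.
Variable N : rep K.
Definition dhomog (b : bool) (u : (N * N)%type) : Prop := (if b then u.1 else u.2) = 0.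
Definition dact x (u : (N * N)%type) : (N * N)%type :=
  if ns2_parity x then (ract x u.2, ract x u.1) else (ract x u.1, ract x u.2).
Fact dact_linear x : linear (dact x).
Proof.
by move=> k u v; rewrite /dact; case: ifP => _ /=; rewrite !linearP.
Qed.
HB.instance Definition _ x :=
  GRing.isLinear.Build K (N * N)%type (N * N)%type _ (dact x) (dact_linear x).
Fact dhomog_sum u : exists u0 u1,
  [/\ dhomog false u0, dhomog true u1 & u = u0 + u1].
Proof.
exists (u.1, 0), (0, u.2); split=> //.
by case: u => u v; congr pair; rewrite /= ?addr0 ?add0r.
Qed.
Fact dhomog_act b x u : dhomog b u -> dhomog (b (+) ns2_parity x) (dact x u).
Proof.
by rewrite /dhomog /dact; case: (ns2_parity x); case: b => /= ->; rewrite linear0.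
Qed.
Fact dactB x y u :
   dact x (dact y u)
      - (-1) ^+ (ns2_parity x && ns2_parity y) *: dact y (dact x u)
    = \sum_(t <- ns2_bracket K x y) t.1 *: dact t.2 u.
Proof.
have -> : \sum_(t <- ns2_bracket K x y) t.1 *: dact t.2 u =
   (lcomb (fun z => (dact z u).1) (ns2_bracket K x y),
    lcomb (fun z => (dact z u).2) (ns2_bracket K x y)).
  rewrite /lcomb; elim: (ns2_bracket K x y) => [|t s IH]; rewrite ?big_nil // !big_cons IH.
  by rewrite [LHS]surjective_pairing; apply: (f_equal2 pair).
have E b : lcomb (fun z => if b (+) ns2_parity z then ract z u.2 else ract z u.1)
      (ns2_bracket K x y) =
   lcomb (fun z => ract z (if b (+) ns2_parity x (+) ns2_parity y then u.2 else u.1))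
      (ns2_bracket K x y).
  by apply: eq_lcomb => t' /bracket_parity ->; rewrite addbA; case: ifP.
rewrite [LHS]surjective_pairing; apply: (f_equal2 pair); rewrite /= -/(ssign K x y).
- transitivity (lcomb (fun z => if false (+) ns2_parity z then ract z u.2 else ract z u.1)
      (ns2_bracket K x y)); last by apply: eq_lcomb => t _; rewrite /dact /=; case: (ns2_parity t.2).
  rewrite E -ractB /dact /=.
  by case: (ns2_parity x); case: (ns2_parity y).
- transitivity (lcomb (fun z => if true (+) ns2_parity z then ract z u.2 else ract z u.1)
      (ns2_bracket K x y)); last by apply: eq_lcomb => t _; rewrite /dact /=; case: (ns2_parity t.2).
  rewrite E -ractB /dact /=.
  by case: (ns2_parity x); case: (ns2_parity y).
Qed.
Definition doubled : ns2_module K.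
Proof.
refine (@Ns2Module K (N * N)%type dhomog (fun x => dact x : {linear (N * N)%type -> (N * N)%type})
  _ _ dhomog_sum _ dhomog_act dactB).
- by case.
- by move=> [] k u v; rewrite /dhomog /= => -> ->; rewrite scaler0 addr0.
- by case=> u v; rewrite /dhomog /= => -> ->.
Defined.
End Doubling.
End Reps.

(** * A PBW model of the Verma modules *)

Notation word := (seq ns2_gen).

Definition lower (x : ns2_gen) : bool :=
  match x with Ln n | Jn n => n < 0 | Cc => false | Gp k | Gm k => k < 0 end.

(* Normal words are decreasing for this key, so that [Gp (-1)] can only be     *)
(* their last letter.                                                          *)
Definition key (x : ns2_gen) : nat := if x == Gp (-1) then 0 else (pickle x).+1.

Definition consable (x : ns2_gen) (w : word) : bool :=
  lower x &&
  (if w is y :: _ then (key y < key x)%N || ((x == y) && ~~ ns2_parity x) else true).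

Fixpoint normal (w : word) : bool :=
  if w is x :: w' then consable x w' && normal w' else true.

Lemma key_inj : injective key.
Proof.
move=> x y; rewrite /key.
case: (x =P Gp (-1)) => [->|_]; case: (y =P Gp (-1)) => [->|_] // [].
exact: (pcan_inj pickleK).
Qed.

Lemma normal_head x w z : normal (x :: w) -> z \in w ->
  (key z < key x)%N || ((x == z) && ~~ ns2_parity x).
Proof.
elim: w x => [|y w IH] x //= /andP[/andP[_ Hxy] Hw].
rewrite inE => /orP[/eqP -> //|zw].
have := IH _ Hw zw.
case/orP: Hxy => [lt_yx|/andP[/eqP -> //]].
case/orP=> [lt_zy|/andP[/eqP <- _]]; last by rewrite lt_yx.
by rewrite (ltn_trans lt_zy lt_yx).
Qed.

Lemma normal_lower w : normal w -> all lower w.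
Proof. by elim: w => //= x w IH /andP[/andP[-> _] /IH]. Qed.

Section FreeModule.
Variable K : numFieldType.

(* The free module on words, with basis ['X^(pickle w)]. *)
Definition ew (w : word) : {poly K} := 'X^(pickle w).

(** Linear extension of a map on words. Exponents that are not the code of a word are sent to 0. *)
Definition ext (V : lmodType K) (f : word -> V) (m : {poly K}) : V :=
  \sum_(i < size m) m`_i *: (if pickle_inv i is Some w then f w else 0).

Lemma ext_widen (V : lmodType K) (f : word -> V) n (m : {poly K}) :
  (size m <= n)%N ->
  ext f m = \sum_(i < n) m`_i *: (if pickle_inv i is Some w then f w else 0).
Proof.
move=> le_n; rewrite /ext (big_ord_widen n
  (fun i => m`_i *: (if pickle_inv i is Some w then f w else 0))) //.
rewrite big_mkcond; apply: eq_bigr => i _; case: ltnP => // le_i.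
by rewrite nth_default // scale0r.
Qed.

Fact ext_linear (V : lmodType K) (f : word -> V) : linear (ext f).
Proof.
move=> k u v; pose n := maxn (size (k *: u + v)) (maxn (size u) (size v)).
rewrite !(@ext_widen V f n) ?leq_max ?leqnn ?orbT //.
rewrite scaler_sumr -big_split; apply: eq_bigr => i _.
by rewrite coefD coefZ scalerDl scalerA.
Qed.
HB.instance Definition _ (V : lmodType K) (f : word -> V) :=
  GRing.isLinear.Build K {poly K} V _ (ext f) (ext_linear f).

Lemma ext_ew (V : lmodType K) (f : word -> V) w : ext f (ew w) = f w.
Proof.
rewrite /ext size_polyXn big_ord_recr /= coefXn eqxx scale1r pickleK_inv.
by rewrite big1 ?add0r // => i _; rewrite coefXn ltn_eqF // scale0r.
Qed.

(** Being impredicative, the definition is at once the induction principle for the span. *)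
Definition inspan (P : word -> Prop) (m : {poly K}) : Prop :=
  forall S : {poly K} -> Prop, S 0 -> (forall (k : K) u v, S u -> S v -> S (k *: u + v)) ->
    (forall w, P w -> S (ew w)) -> S m.

Lemma inspan0 P : inspan P 0. Proof. by move=> S. Qed.
Lemma inspanZD P k u v : inspan P u -> inspan P v -> inspan P (k *: u + v).
Proof. by move=> Hu Hv S S0 SZ SP; apply: (SZ); [exact: Hu | exact: Hv]. Qed.
Lemma inspan_ew (P : word -> Prop) w : P w -> inspan P (ew w).
Proof. by move=> Pw S _ _; apply. Qed.
Lemma inspanZ P k u : inspan P u -> inspan P (k *: u).
Proof. by move=> H; rewrite -[_ *: _]addr0; apply: inspanZD. Qed.
Lemma inspanD P u v : inspan P u -> inspan P v -> inspan P (u + v).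
Proof. by move=> Hu Hv; rewrite -[u]scale1r; apply: inspanZD. Qed.
Lemma inspan_lcomb P (f : ns2_gen -> {poly K}) s :
  (forall t, t \in s -> inspan P (f t.2)) -> inspan P (lcomb f s).
Proof.
move=> H; rewrite /lcomb big_seq; apply: big_ind => [|u v|t /H].
- exact: inspan0.
- exact: inspanD.
- exact: inspanZ.
Qed.
Lemma inspan_sub P Q m : (forall w, P w -> Q w) -> inspan P m -> inspan Q m.
Proof. by move=> H Pm S S0 SZ SQ; apply: (Pm S) => // w /H; exact: SQ. Qed.
Lemma inspan_ext P Q (f : word -> {poly K}) m : inspan P m ->
  (forall w, P w -> inspan Q (f w)) -> inspan Q (ext f m).
Proof.
move=> Pm H; apply: (Pm (fun m => inspan Q (ext f m))).
- by rewrite linear0; exact: inspan0.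
- by move=> k u v Hu Hv; rewrite linearP; exact: inspanZD.
- by move=> w /H; rewrite ext_ew.
Qed.
Lemma inspan_eq_ext P (V : lmodType K) (f g : word -> V) m :
  inspan P m -> (forall w, P w -> f w = g w) -> ext f m = ext g m.
Proof.
move=> Pm H; apply: (Pm (fun m => ext f m = ext g m)).
- by rewrite !linear0.
- by move=> k u v Hu Hv; rewrite !ext_linear Hu Hv.
- by move=> w /H; rewrite !ext_ew.
Qed.
End FreeModule.

Section VermaModel.
Variables (K : numFieldType) (chi : ns2_gen -> K).
Notation ew := (@ew K).

(** The PBW straightening rule, with fuel n bounding the length of w. A letter that fits in front is
    prepended; an odd letter meeting itself gives 0; otherwise x is moved past y by the bracket. In
    the exchanged term y is put back on words that either accept it in front or are short enough for
    the remaining fuel. *)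
Fixpoint wact (n : nat) (x : ns2_gen) (w : word) : {poly K} :=
  match n, w with
  | _, [::] => if lower x then ew [:: x] else chi x *: ew [::]
  | 0, _ => 0
  | n'.+1, y :: w' =>
    if (size w <= n')%N then wact n' x w
    else if ~~ normal w then 0
    else if consable x w then ew (x :: w)
    else if x == y then 0
    else ssign K x y *: ext (fun u => if normal u && consable y u then ew (y :: u) else wact n' y u)
                            (wact n' x w')
         + lcomb (fun z => wact n' z w') (ns2_bracket K x y)
  end.

Definition aact x w := wact (size w) x w.
Definition mact x : {linear {poly K} -> {poly K}} := ext (aact x).

Lemma mactP x k u v : mact x (k *: u + v) = k *: mact x u + mact x v.
Proof. exact: linearP. Qed.
Lemma mactD x u v : mact x (u + v) = mact x u + mact x v.
Proof. exact: linearD. Qed.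
Lemma mactZ x k u : mact x (k *: u) = k *: mact x u.
Proof. exact: linearZ. Qed.
Lemma mact0 x : mact x 0 = 0.
Proof. exact: linear0. Qed.

Lemma wactE n x w : (size w <= n)%N -> wact n x w = aact x w.
Proof.
elim: n w => [|n IH] [|y w] //= le_n.
have [lt_n|] := ltnP (size w) n; first by rewrite IH.
move=> le_n'; have E : size w = n by apply/eqP; rewrite eqn_leq le_n' andbT -ltnS.
by subst n; rewrite /aact /= ltnn.
Qed.

Lemma mact_ew x w : mact x (ew w) = aact x w.
Proof. exact: ext_ew. Qed.

Lemma aact_nil x : aact x [::] = if lower x then ew [:: x] else chi x *: ew [::].
Proof. by []. Qed.

Lemma aact_abnormal x w : ~~ normal w -> aact x w = 0.
Proof. by case: w => // y w H; rewrite /aact /= ltnn -[_ && _]/(normal (y :: w)) H. Qed.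

Lemma aact_cons x w : normal w -> consable x w -> aact x w = ew (x :: w).
Proof.
case: w => [|y w] Hw H; first by rewrite aact_nil; case/andP: H => ->.
by rewrite /aact /= ltnn -[_ && _]/(normal (y :: w)) Hw H.
Qed.

(** The words that can occur in x . w: either not longer than w, or a rearrangement of all the
    letters. *)
Definition letters (x : ns2_gen) (w u : word) : Prop :=
  normal u /\ ((size u <= size w)%N \/ perm_eq u (x :: w)).

(** If x does not fit in front of y, then y has the largest key among the letters of x :: y :: w,
    hence fits in front of any normal rearrangement of x :: w. *)
Lemma consable_letters x y w u : normal (y :: w) -> ~~ consable x (y :: w) -> x != y ->
  normal u -> perm_eq u (x :: w) -> consable y u.
Proof.
move=> Hyw Hx xy Hu Huw; rewrite /consable.
have /andP[lowy _] : lower y && all lower w by have := normal_lower Hyw.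
rewrite lowy /=; case: u Huw Hu => // z u Huw Hu.
have zin : z \in x :: w by rewrite -(perm_mem Huw) mem_head.
have lowx : lower x.
  by have := normal_lower Hu; rewrite (perm_all _ Huw) => /andP[].
move: zin; rewrite inE => /orP[/eqP ->|zw]; last exact: normal_head zw.
move: Hx; rewrite /consable lowx /= (negbTE xy) /= orbF -leqNgt leq_eqVlt.
by case/orP => [/eqP /key_inj E|->//]; rewrite E eqxx in xy.
Qed.

Lemma wact_fun_aact y n u : ((normal u && consable y u) || (size u <= n)%N) ->
  (if normal u && consable y u then ew (y :: u) else wact n y u) = aact y u.
Proof. by case: andP => [[Hu Hyu] _|_ /wactE //]; rewrite aact_cons. Qed.

(** This control of the words produced shows that the fuel of [wact] never runs out, whence
    [aact_exchange]. *)
Lemma aact_letters w x : normal w -> inspan (letters x w) (aact x w).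
Proof.
have [n] := ubnP (size w); elim: n w x => // n IH [|y w] x /ltnSE-le_n Hw.
  rewrite aact_nil; case: ifP => lowx.
    by apply: inspan_ew; split; rewrite /= ?/consable ?lowx //; right.
  by apply: inspanZ; apply: inspan_ew; split=> //; left.
have [Hc|Hc] := boolP (consable x (y :: w)).
  rewrite aact_cons //; apply: inspan_ew; split; last by right.
  by rewrite [normal _]/= Hc; exact: Hw.
rewrite /aact /= ltnn -[_ && _]/(normal (y :: w)) Hw (negbTE Hc) /=.
case: eqVneq => [_|xy]; first exact: inspan0.
have Hw' : normal w by case/andP: Hw.
apply: inspanD.
  apply: inspanZ; apply: inspan_ext; first exact: IH.
  move=> u [Hu Hsz]; have [lt|ge] := leqP (size u) (size w); last first.
    case: Hsz => [le|Huw]; first by rewrite leqNgt ge in le.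
    have Hyu := consable_letters Hw Hc xy Hu Huw.
    rewrite Hu Hyu; apply: inspan_ew; split; first by rewrite /= Hyu.
    right; rewrite (perm_trans (y := y :: x :: w)) ?perm_cons //.
    by rewrite -[y :: x :: w]/([:: y] ++ [:: x] ++ w) perm_catCA.
  rewrite wact_fun_aact ?lt ?orbT //.
  apply: inspan_sub (@IH u y _ Hu); last exact: leq_ltn_trans lt le_n.
  move=> v [Hv Hv']; split=> //; left=> /=.
  by case: Hv' => [le|/perm_size ->]; [exact: leq_trans le (leqW lt) | rewrite /= ltnS].
apply: inspan_lcomb => t _; apply: inspan_sub (@IH w t.2 le_n Hw').
move=> v [Hv Hv']; split=> //; left.
by case: Hv' => [le|/perm_size ->] //=; exact: leqW.
Qed.

Lemma aact_exchange x y w : normal (y :: w) -> ~~ consable x (y :: w) -> x != y ->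
  mact x (mact y (ew w)) =
  ssign K x y *: mact y (mact x (ew w))
  + lcomb (fun z => mact z (ew w)) (ns2_bracket K x y).
Proof.
move=> Hw Hc xy; have [Hyw Hw'] : consable y w /\ normal w by case/andP: Hw.
rewrite !mact_ew aact_cons // mact_ew.
rewrite {1}/aact /= ltnn -[_ && _]/(normal (y :: w)) Hw (negbTE Hc) (negbTE xy) /=.
congr (_ *: _ + _).
  rewrite -/(aact x w) -[RHS]/(ext (aact y) (aact x w)).
  apply: (inspan_eq_ext (@aact_letters w x Hw')) => u [Hu Hu'].
  rewrite wact_fun_aact //.
  have [//|ge] := leqP (size u) (size w); rewrite ?orbT //.
  case: Hu' => [le|Huw]; first by rewrite leqNgt ge in le.
  by rewrite Hu (consable_letters Hw Hc xy Hu Huw).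
by apply: eq_lcomb => t _; rewrite mact_ew.
Qed.

Hypothesis chi_odd : forall x, ns2_parity x -> chi x = 0.
Hypothesis chi_lower : forall x y t, ~~ lower x -> ~~ lower y ->
  t \in ns2_bracket K x y -> ~~ lower t.2.
Hypothesis chi_bracket : forall x y, ~~ lower x -> ~~ lower y ->
  lcomb (chi : ns2_gen -> K^o) (ns2_bracket K x y) = 0.

Lemma ssignC x y : ssign K x y = ssign K y x.
Proof. by rewrite /ssign andbC. Qed.
Lemma ssignK x y : ssign K x y * ssign K x y = 1.
Proof. by rewrite /ssign -expr2 sqrr_sign. Qed.
Lemma ssign_bracket x y z t : t \in ns2_bracket K x y ->
  ssign K t.2 z = ssign K x z * ssign K y z.
Proof.
move/bracket_parity; rewrite /ssign => ->.
by do 3!case: ns2_parity; rewrite /= ?expr0 ?expr1 ?mulrNN ?mulr1 ?mul1r.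
Qed.
Lemma bracket_self (V : lmodType K) (f : ns2_gen -> V) x :
  lcomb f (ns2_bracket K x x) = 0.
Proof.
have [|Hx] := boolP (ns2_parity x); first by case: x => // i _; exact: lcomb_nil.
have := bracket_antisym f x x; rewrite /ssign (negbTE Hx) expr0 scaleN1r.
by move/eqP; rewrite -addr_eq0 => /eqP /addrr_eq0.
Qed.

Definition comm_at x y (m : {poly K}) : Prop :=
  mact x (mact y m) =
  ssign K x y *: mact y (mact x m) + lcomb (fun z => mact z m) (ns2_bracket K x y).

Lemma comm_at_sym x y m : comm_at y x m -> comm_at x y m.
Proof.
rewrite /comm_at => ->; rewrite bracket_antisym (ssignC y x) scalerDr !scalerA ssignK mulrN ssignK.
by rewrite scale1r scaleN1r subrK.
Qed.

Lemma comm_at0 x y : comm_at x y 0.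
Proof.
rewrite /comm_at !mact0 scaler0 add0r /lcomb big1 // => t _.
by rewrite mact0 scaler0.
Qed.

Lemma comm_atZD x y k u v : comm_at x y u -> comm_at x y v -> comm_at x y (k *: u + v).
Proof.
move=> Hu Hv; rewrite /comm_at !mactP Hu Hv.
have -> : lcomb (fun z => mact z (k *: u + v)) (ns2_bracket K x y) =
   k *: lcomb (fun z => mact z u) (ns2_bracket K x y)
   + lcomb (fun z => mact z v) (ns2_bracket K x y).
  by rewrite -lcombZ -lcombD; apply: eq_lcomb => t _; rewrite mactP.
by lmod.
Qed.

Lemma comm_at_inspan P x y m : inspan P m ->
  (forall w, P w -> comm_at x y (ew w)) -> comm_at x y m.
Proof.
by move=> Pm H; apply: (Pm (comm_at x y)) => //; [exact: comm_at0 | exact: comm_atZD].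
Qed.

Lemma aact_same x w : normal (x :: w) -> ~~ consable x (x :: w) ->
  mact x (mact x (ew w)) = 0.
Proof.
move=> Hw Hc; have /andP[Hxw Hw'] := Hw.
rewrite mact_ew aact_cons // mact_ew.
by rewrite /aact /= ltnn -[_ && _]/(normal (x :: w)) Hw (negbTE Hc) eqxx.
Qed.

Lemma comm_at_cons x y w : normal (y :: w) -> comm_at x y (ew w).
Proof.
move=> Hw; have [Hyw Hw'] : consable y w /\ normal w by case/andP: Hw.
have [->|xy] := eqVneq x y.
  rewrite /comm_at bracket_self addr0 /ssign andbb.
  have [Hc|Hc] := boolP (consable y (y :: w)); last by rewrite aact_same // scaler0.
  case/andP: Hc => _; rewrite ltnn eqxx /= => /negbTE ->.
  by rewrite expr0 scale1r.
have [Hc|Hc] := boolP (consable x (y :: w)); last exact: aact_exchange.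
have lt_yx : (key y < key x)%N.
  by move: Hc; rewrite /consable (negbTE xy) /= orbF => /andP[].
have Hxw : consable x w.
  rewrite /consable; case/andP: Hc => -> _ /=.
  case: w Hw {Hyw Hw'} => // z w Hw.
  by have := normal_head Hw (mem_head z w) => /orP[/ltn_trans -> //|/andP[/eqP <- _]]; rewrite lt_yx.
apply: comm_at_sym; apply: aact_exchange; rewrite 1?eq_sym //.
  by rewrite /= Hxw; exact: Hw'.
by rewrite /consable /= eq_sym (negbTE xy) /= orbF negb_and -leqNgt (ltnW lt_yx) orbT.
Qed.

(** The core of PBW, by induction on the length. On the empty word this says that [chi] is a
    character. If x or y fits in front of z :: L, it is the definition of the action. Otherwise both
    letters are moved past z, and the remaining double brackets cancel by the Jacobi identity. *)
Lemma comm_at_ew w x y : normal w -> comm_at x y (ew w).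
Proof.
have [n] := ubnP (size w); elim: n w x y => // n IH [|z L] x y /ltnSE-le_n Hw.
  have [lowx|lowx] := boolP (lower x).
    by apply: comm_at_sym; apply: comm_at_cons; rewrite /= /consable lowx.
  have [lowy|lowy] := boolP (lower y).
    by apply: comm_at_cons; rewrite /= /consable lowy.
  have E u : ~~ lower u -> mact u (ew [::]) = chi u *: ew [::].
    by rewrite mact_ew aact_nil => /negbTE ->.
  rewrite /comm_at !E // !mactZ !E // !scalerA.
  have -> : lcomb (fun u => mact u (ew [::])) (ns2_bracket K x y) = 0.
    rewrite (eq_lcomb (g := fun u => chi u *: ew [::])) => [|t Ht]; last first.
      by rewrite E // (chi_lower lowx lowy).
    have := chi_bracket lowx lowy; rewrite /lcomb => H.
    rewrite -[RHS](scale0r (ew [::])) -H scaler_suml.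
    by apply: eq_bigr => t _; rewrite scalerA.
  rewrite addr0 /ssign; have [px|px] := boolP (ns2_parity x).
    by rewrite (chi_odd px) !(mulr0, mul0r) scale0r.
  by rewrite expr0 mul1r mulrC.
have [HzL HL] : consable z L /\ normal L by case/andP: Hw.
have le_L : (size L < n)%N by [].
have [Hc|Hcy] := boolP (consable y (z :: L)).
  by apply: comm_at_cons; rewrite [normal _]/= Hc; exact: Hw.
have [Hc|Hcx] := boolP (consable x (z :: L)).
  by apply: comm_at_sym; apply: comm_at_cons; rewrite [normal _]/= Hc; exact: Hw.
have far u v : ~~ consable v (z :: L) -> v != z -> comm_at u z (mact v (ew L)).
  move=> Hcv vz; rewrite mact_ew.
  apply: (comm_at_inspan (@aact_letters L v HL)) => m [Hm Hm'].
  have [le|gt] := leqP (size m) (size L).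
    by apply: IH => //; exact: leq_ltn_trans le le_L.
  case: Hm' => [le|Hmp]; first by rewrite leqNgt gt in le.
  by apply: comm_at_cons; rewrite /= (consable_letters Hw Hcv vz Hm Hmp).
have near u v : comm_at u v (ew L) by apply: IH.
(* [C1] and [C2] carry a letter across a bracket; their last terms are the double brackets of the
   Jacobi identity. *)
have C1 u u' v : lcomb (fun t => mact t (mact v (ew L))) (ns2_bracket K u u') =
   (ssign K u v * ssign K u' v) *: mact v (lcomb (fun t => mact t (ew L)) (ns2_bracket K u u'))
   + lcomb (fun t => lcomb (fun s => mact s (ew L)) (ns2_bracket K t v)) (ns2_bracket K u u').
  rewrite lcomb_linear -lcombZ -lcombD; apply: eq_lcomb => t Ht.
  by rewrite near (ssign_bracket _ Ht).
have C2 u v : mact u (lcomb (fun t => mact t (ew L)) (ns2_bracket K v z)) =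
   (ssign K u v * ssign K u z) *: lcomb (fun t => mact t (mact u (ew L))) (ns2_bracket K v z)
   + lcomb (fun t => lcomb (fun s => mact s (ew L)) (ns2_bracket K u t)) (ns2_bracket K v z).
  rewrite lcomb_linear -lcombZ -lcombD; apply: eq_lcomb => t Ht.
  rewrite (near u t.2) [ssign K u t.2]ssignC (ssign_bracket _ Ht).
  by rewrite [ssign K v u]ssignC [ssign K z u]ssignC.
have ez : ew (z :: L) = mact z (ew L) by rewrite mact_ew aact_cons.
rewrite ez.
have odd_square v m : ns2_parity v -> comm_at v v m -> mact v (mact v m) = 0.
  move=> pv; rewrite /comm_at bracket_self addr0 /ssign pv /= expr1 scaleN1r.
  by move/eqP; rewrite -addr_eq0 => /eqP /addrr_eq0.
have pz v : ~~ consable v (z :: L) -> v = z -> ns2_parity z.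
  move=> Hcv E; move: Hcv; rewrite E /consable ltnn eqxx /=.
  by case/andP: HzL => -> _ /=; rewrite negbK.
(* When one of the two letters is z itself, z is odd; the Jacobi identity for v, z, z makes the
   double bracket equal to its opposite, hence zero. *)
have special v : ~~ consable v (z :: L) -> ns2_parity z -> comm_at v z (mact z (ew L)).
  move=> Hcv Hz.
  have zz : mact z (mact z (ew L)) = 0 by apply: odd_square.
  rewrite /comm_at zz mact0.
  have [->|vz] := eqVneq v z; first by rewrite zz mact0 bracket_self scaler0 addr0.
  have J := bracket_jacobi (fun s => mact s (ew L)) v z z.
  rewrite near mactD mactZ (odd_square z) //; last exact: far.
  rewrite C1; move: J; rewrite bracket_self add0r => J.
  set A := lcomb _ _ in J *.
  have A0 : A = 0.
    move: J; rewrite /ssign Hz /= ?expr1 scaleN1r => /esym/eqP; rewrite -addr_eq0.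
    by move/eqP/addrr_eq0.
  rewrite A0 [in RHS]/ssign Hz /=. by lmod.
have [yz|yz] := eqVneq y z; first by rewrite yz; apply: special => //; exact: pz yz.
have [xz|xz] := eqVneq x z.
  by rewrite xz; apply: comm_at_sym; apply: special => //; exact: pz xz.
have J := bracket_jacobi (fun s => mact s (ew L)) x y z.
rewrite /comm_at [mact y (mact z _)]near [mact x (mact z _)]near !mactD !mactZ.
rewrite far // [mact y (mact z _)]far //.
rewrite near mactD mactZ (C2 x y) (C1 x y z) (C1 x z y) -J.
rewrite ?(ssignC z y) ?(ssignC z x) ?(ssignC y x).
rewrite /ssign; case: (ns2_parity x); case: (ns2_parity y);
  case: (ns2_parity z); rewrite ?expr0 ?expr1; by lmod.
Qed.

Lemma mact_junk x i : pickle_inv i = None :> option word -> mact x ('X^i : {poly K}) = 0.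
Proof.
move=> Hi; rewrite /mact /= /ext size_polyXn big_ord_recr /= Hi scaler0 addr0.
by rewrite big1 // => j _; rewrite coefXn ltn_eqF // scale0r.
Qed.

Lemma poly_ew_ind (P : {poly K} -> Prop) :
  P 0 -> (forall (k : K) u v, P u -> P v -> P (k *: u + v)) ->
  (forall w, P (ew w)) ->
  (forall i, pickle_inv i = None :> option word -> P ('X^i : {poly K})) ->
  forall m, P m.
Proof.
move=> P0 PZ Pw Pj m; rewrite -[m]coefK poly_def.
elim/big_rec: _ => // i m' _; apply: PZ.
case E: (pickle_inv i : option word) => [w|]; last exact: Pj.
by have := @pickle_invK word i; rewrite E /= => <-; exact: Pw.
Qed.

Lemma mactB x y m :
  mact x (mact y m) - ssign K x y *: mact y (mact x m)
  = lcomb (fun z => mact z m) (ns2_bracket K x y).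
Proof.
suff -> : comm_at x y m by rewrite addrC addKr.
elim/poly_ew_ind: m => [|k u v|w|i Hi].
- exact: comm_at0.
- exact: comm_atZD.
- have [Hw|Hw] := boolP (normal w); first exact: comm_at_ew.
  have E z : mact z (ew w) = 0 by rewrite mact_ew aact_abnormal.
  rewrite /comm_at !E !mact0 scaler0 add0r /lcomb big1 // => t _.
  by rewrite E scaler0.
- rewrite /comm_at !mact_junk // !mact0 scaler0 add0r /lcomb big1 // => t _.
  by rewrite mact_junk // scaler0.
Qed.

Definition verma_model : rep K := @Rep K {poly K} mact mactB.

(* Universality up to a submodule, which serves for submodules generated by   *)
(* vectors that are singular only modulo another submodule.                    *)
Section Universal.
Variables (N : rep K) (S : N -> Prop) (HS : is_sub S) (v : N).
Hypothesis Hv : forall x, ~~ lower x -> S (ract x v - chi x *: v).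

Definition wev (w : word) : N := foldr (fun x u => ract x u) v w.
Definition mev : {linear {poly K} -> N} := ext (fun w => if normal w then wev w else 0).

Lemma mev_ew w : normal w -> mev (ew w) = wev w.
Proof. by move=> Hw; rewrite [LHS]ext_ew Hw. Qed.

Let D x m := S (ract x (mev m) - mev (mact x m)).

Let D0 x : D x 0.
Proof. by rewrite /D mact0 (linear0 mev) (linear0 (ract x)) subrr; exact: sub0. Qed.

Let DZ x k u m : D x u -> D x m -> D x (k *: u + m).
Proof.
rewrite /D => Hu Hm; rewrite mactP (linearP mev) linearP (linearP mev) /=.
rewrite opprD addrACA -scalerBr; exact: subZD.
Qed.

Let D_inspan P x m : inspan P m -> (forall w, P w -> D x (ew w)) -> D x m.
Proof. by move=> Pm H; apply: (Pm (D x)) => //; exact: DZ. Qed.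

(** The straightening rule only uses relations valid in every module, so evaluation at v follows it
    by the same induction on length. *)
Lemma mev_act x m : S (ract x (mev m) - mev (mact x m)).
Proof.
rewrite -/(D x m); elim/poly_ew_ind: m => [||w|i Hi]; [exact: D0|exact: DZ| |]; last first.
  rewrite /D mact_junk // linear0 subr0.
  have -> : mev 'X^i = 0; last by rewrite linear0; exact: sub0.
  rewrite /mev /= /ext size_polyXn big_ord_recr /= Hi scaler0 addr0.
  by rewrite big1 // => j _; rewrite coefXn ltn_eqF // scale0r.
have [Hw|Hw] := boolP (normal w); last first.
  rewrite /D mact_ew aact_abnormal // linear0 subr0 [mev _]ext_ew (negbTE Hw) linear0.
  exact: sub0.
have [n] := ubnP (size w); elim: n w x Hw => // n IH [|y w] x Hw /ltnSE-le_n.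
  rewrite /D mact_ew aact_nil mev_ew //.
  case: ifPn => lowx; last by rewrite linearZ /= mev_ew //; exact: Hv.
  rewrite mev_ew ?subrr; first exact: sub0.
  by rewrite /= /consable lowx.
have [Hyw Hw'] : consable y w /\ normal w by case/andP: Hw.
have cons u z : normal u -> consable z u -> D z (ew u).
  move=> Hu Hzu; rewrite /D mact_ew aact_cons // !mev_ew ?subrr //; first exact: sub0.
  by rewrite /= Hzu.
have [Hc|Hc] := boolP (consable x (y :: w)); first exact: cons.
have Ey : mev (ew (y :: w)) = ract y (mev (ew w)) by rewrite !mev_ew.
have [xy|xy] := eqVneq x y.
  subst y; rewrite /D mact_ew.
  have -> : aact x (x :: w) = 0.
    by have := aact_same Hw Hc; rewrite mact_ew aact_cons // mact_ew.
  rewrite linear0 subr0 Ey.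
  have px : ns2_parity x.
    move: Hc; rewrite /consable ltnn eqxx /=.
    by case/andP: Hyw => -> _ /=; rewrite negbK.
  by rewrite ract_odd_square //; exact: sub0.
have ez : ew (y :: w) = mact y (ew w) by rewrite mact_ew aact_cons.
rewrite /D Ey ez aact_exchange // ract_comm linearD linearZ /=.
rewrite opprD addrACA -scalerBr; apply: subD => //; last first.
  rewrite lcomb_linear -scaleN1r -lcombZ -lcombD; apply: sub_lcomb => // t.
  by rewrite scaleN1r; apply: (IH w t).
apply: subZ => //.
have -> : ract y (ract x (mev (ew w))) - mev (mact y (mact x (ew w)))
   = ract y (ract x (mev (ew w)) - mev (mact x (ew w)))
     + (ract y (mev (mact x (ew w))) - mev (mact y (mact x (ew w)))).
  by rewrite linearB /= addrA subrK.
apply: subD => //; first by apply: sub_act => //; apply: (IH w x).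
rewrite -/(D y _) mact_ew; apply: (D_inspan (@aact_letters w x Hw')) => u [Hu Hu'].
have [le|gt] := leqP (size u) (size w); first by apply: IH => //; exact: leq_ltn_trans le le_n.
case: Hu' => [le|Hp]; first by rewrite leqNgt gt in le.
by apply: cons => //; exact: consable_letters Hw Hc xy Hu Hp.
Qed.
End Universal.
End VermaModel.

(** * Weights *)

Section Weights.
Variable K : numFieldType.

(** The drop of the J_0 eigenvalue caused by x; [dl] is twice the rise of the L_0 eigenvalue. *)
Definition dj (x : ns2_gen) : int := match x with Gp _ => -1 | Gm _ => 1 | _ => 0 end.
Definition dl (x : ns2_gen) : int :=
  match x with
  | Ln n | Jn n => - (n * 2) | Cc => 0 | Gp k | Gm k => - (k * 2) - 1
  end.

(* [l] is twice the level, hence an integer. *)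
Definition wt (N : rep K) (h q : K) (j l : int) (u : N) : Prop :=
  ract (Jn 0) u = (q - j%:~R) *: u /\ ract (Ln 0) u = (h + l%:~R / 2%:R) *: u.

Variable N : rep K.
Implicit Types (u v : N).

Lemma wt_act h q j l x u : wt h q j l u -> wt h q (j + dj x) (l + dl x) (ract x u).
Proof.
case=> HJ HL; split.
  rewrite ract_comm HJ linearZ /ssign /= expr0 scale1r.
  by case: x => [n|n||n|n] /=; rewrite ?lcomb_cons ?lcomb_nil /= ?addr0 ?add0r; lmod_field.
rewrite ract_comm HL linearZ /ssign /= expr0 scale1r.
by case: x => [n|n||n|n] /=; rewrite ?lcomb_cons ?lcomb_nil /= ?addr0 ?add0r /halfmode; lmod_field.
Qed.

Lemma wt_inj (h q : K) j l j' l' :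
  q - j%:~R = q - j'%:~R -> h + l%:~R / 2%:R = h + l'%:~R / 2%:R :> K -> (j, l) = (j', l').
Proof.
move/addrI/oppr_inj/intr_inj => -> /addrI E.
have n2 : (2%:R : K) != 0 by rewrite pnatr_eq0.
by congr pair; apply: (@intr_inj K); apply: (mulIf (invr_neq0 n2)).
Qed.

(* The components of distinct weights of an element of a submodule lie in it:  *)
(* apply the operators [X - lambda] with [X] = [J_0] or [L_0] killing the      *)
(* other weights.                                                              *)
Lemma wt_split (S : N -> Prop) (HS : is_sub S) h q (s : seq ((int * int) * N)) p :
  {in s, forall t, wt h q t.1.1 t.1.2 t.2} ->
  S (\sum_(t <- s) t.2) -> S (\sum_(t <- s | t.1 == p) t.2).
Proof.
move=> Hs Ss; have [Q HQ HpQ] : exists2 Q : seq (int * int), p \notin Q &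
    {in s, forall t, (t.1 == p) || (t.1 \in Q)}.
  exists [seq r <- [seq t.1 | t <- s] | r != p]; first by rewrite mem_filter eqxx.
  by move=> t ts; rewrite mem_filter (map_f fst ts) andbT orbN.
elim: Q s Hs Ss HQ HpQ => [|r Q IH] s Hs Ss.
  move=> _ H; rewrite (_ : \sum_(t <- s | _) _ = \sum_(t <- s) t.2) //.
  rewrite big_seq_cond [RHS]big_seq; apply: eq_bigl => t.
  by case E: (t \in s) => //=; have := H _ E; rewrite in_nil orbF.
rewrite inE negb_or => /andP[pr pQ] H.
have [X [lam [HX Hlam]]] : exists (X : ns2_gen) (lam : int * int -> K),
    {in s, forall t, ract X t.2 = lam t.1 *: t.2} /\ lam p != lam r.
  have [E|E] := eqVneq (q - p.1%:~R) (q - r.1%:~R).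
    exists (Ln 0), (fun t => h + t.2%:~R / 2%:R); split; first by move=> t /Hs[].
    apply/eqP=> E'; move: pr; have := wt_inj E E'.
    by rewrite -!surjective_pairing => ->; rewrite eqxx.
  by exists (Jn 0), (fun t => q - t.1%:~R); split=> // t /Hs[].
pose s' := [seq (t.1, (lam t.1 - lam r) *: t.2) | t <- s & t.1 != r].
have Es (P : pred (int * int)) : \sum_(t <- s' | P t.1) t.2
    = \sum_(t <- s | P t.1) (lam t.1 - lam r) *: t.2.
  rewrite /s' big_map big_filter_cond /=.
  rewrite [RHS](bigID (fun t => t.1 != r)) /= [X in _ + X]big1 ?addr0 => [|t].
    by apply: eq_bigl => t; rewrite andbC.
  by rewrite negbK => /andP[_ /eqP ->]; rewrite subrr scale0r.
have Sp : S (\sum_(t <- s' | t.1 == p) t.2).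
  apply: IH => //.
  - move=> _ /mapP [t + ->]; rewrite mem_filter => /andP[_ /Hs [H1 H2]].
    by split; rewrite /= linearZ /= ?H1 ?H2 !scalerA mulrC.
  - rewrite (Es predT) /= (_ : \sum_(t <- s) _
      = ract X (\sum_(t <- s) t.2) - lam r *: \sum_(t <- s) t.2).
      by apply: subB => //; [exact: sub_act | exact: subZ].
    rewrite linear_sum scaler_sumr -sumrB; apply: eq_big_seq => t /HX ->.
    by rewrite scalerBl.
  - move=> _ /mapP [t + ->]; rewrite mem_filter => /andP[/negbTE tr /H].
    by rewrite inE tr.
move: Sp; rewrite (Es (pred1 p)) => Sp.
have -> : \sum_(t <- s | t.1 == p) t.2
    = (lam p - lam r)^-1 *: \sum_(t <- s | t.1 == p) (lam t.1 - lam r) *: t.2.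
  rewrite scaler_sumr; apply: eq_bigr => t /eqP ->.
  by rewrite scalerA mulVf ?scale1r // subr_eq0.
exact: subZ.
Qed.
End Weights.

Section NS2Verma.
Variable K : numFieldType.

(** On the generators that are not lowering this is the character from which the Verma module is
    induced. *)
Definition vchi (h q c : K) (x : ns2_gen) : K :=
  match x with
  | Ln n => if n == 0 then h else 0
  | Jn n => if n == 0 then q else 0
  | Cc => c
  | _ => 0
  end.

Lemma vchi_odd h q c x : ns2_parity x -> vchi h q c x = 0.
Proof. by case: x. Qed.

Lemma vchi_lower x y (t : K * ns2_gen) : ~~ lower x -> ~~ lower y ->
  t \in ns2_bracket K x y -> ~~ lower t.2.
Proof.
case: x => [n|n||n|n]; case: y => [m|m||m|m] //= Hx Hy; rewrite ?inE => *;
  repeat match goal with H : is_true (_ || _) |- _ => case/orP: H => H end;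
  match goal with H : is_true (_ == _) |- _ => move/eqP: H => -> end => //=; lia.
Qed.

Lemma vchi_bracket h q c x y : ~~ lower x -> ~~ lower y ->
  lcomb (vchi h q c : ns2_gen -> K^o) (ns2_bracket K x y) = 0.
Proof.
case: x => [n|n||n|n]; case: y => [m|m||m|m] //= Hx Hy;
  rewrite ?lcomb_cons ?lcomb_nil //= ?scaler0 ?addr0 //.
all: match goal with |- context [?i == 0] =>
  have [E|_] := eqVneq i 0;
  [try (exfalso; lia); assert (n0 : n = 0) by lia; assert (m0 : m = 0) by lia;
    rewrite ?n0 ?m0 /GRing.scale /=; try ring | by rewrite ?mulr0 ?scaler0 ?scale0r ?addr0] end.
Qed.

Definition verma h q c : rep K :=
  verma_model (@vchi_odd h q c) (@vchi_lower) (@vchi_bracket h q c).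

Definition vgen h q c : verma h q c := ew K [::].

Lemma vgen_lower h q c x : ~~ lower x -> ract x (vgen h q c) = vchi h q c x *: vgen h q c.
Proof. by move=> Hx; rewrite [LHS]mact_ew aact_nil (negbTE Hx). Qed.

Definition wtj (w : word) : int := \sum_(x <- w) dj x.
Definition wtl (w : word) : int := \sum_(x <- w) dl x.

Lemma dl_lower x : lower x -> (1 <= dl x).
Proof. case: x => [n|n||n|n] /= H. 1,2,4,5: lia. all: by []. Qed.

Lemma wtl_size w : all lower w -> ((size w)%:Z <= wtl w).
Proof.
rewrite /wtl; elim: w => [|x w IH] /=; first by rewrite big_nil.
case/andP=> /dl_lower Hx /IH; rewrite big_cons.
by move: (dl x) (\sum_(y <- w) dl y) Hx => a b; lia.
Qed.

Definition alphabet (n : nat) : seq ns2_gen :=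
  flatten [seq [:: Ln (- i%:Z); Jn (- i%:Z); Gp (- i%:Z); Gm (- i%:Z)] | i <- iota 1 n].

Fixpoint words (n k : nat) : seq word :=
  if k is k'.+1 then [::] :: [seq x :: w | x <- alphabet n, w <- words n k'] else [:: [::]].

Lemma mem_alphabet n x : lower x -> (dl x <= n%:Z) -> x \in alphabet n.
Proof.
move=> Hx Hn; apply/flattenP.
pose i := match x with Ln m | Jn m | Gp m | Gm m => absz m | Cc => 0%N end.
exists [:: Ln (- i%:Z); Jn (- i%:Z); Gp (- i%:Z); Gm (- i%:Z)].
  apply/mapP; exists i => //; rewrite mem_iota.
  by move: Hx Hn; rewrite /i; case: x {i} => [m|m||m|m] //=; lia.
have E m : m < 0 -> m = - (absz m)%:Z by lia.
by move: Hx; rewrite !inE /i; case: x {i Hn} => [m|m||m|m] //= /E <-; rewrite eqxx ?orbT.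
Qed.

Lemma mem_words n w : all lower w -> (wtl w <= n%:Z) -> w \in words n n.
Proof.
move=> Hw Hn; have : (size w <= n)%N by have := wtl_size Hw; lia.
have : all (fun x => x \in alphabet n) w.
  elim: w Hw Hn => //= x w IH /andP[Hx Hw]; rewrite /wtl big_cons => Hn.
  have := wtl_size Hw; have := dl_lower Hx; rewrite -/(wtl w) in Hn => H1 H2.
  by rewrite mem_alphabet ?IH //; lia.
move: {2 4}n => k; elim: k w {Hw Hn} => [|k IH] [|x w] //= /andP[Hx Hw] Hs.
by rewrite inE /=; apply/allpairsP; exists (x, w); split=> //=; apply: IH.
Qed.

(** Each lowering letter adds at least 1 to l, so at most l letters from a finite alphabet are
    involved: weight spaces have finite explicit bases. *)
Definition basis (j l : int) : seq word :=
  undup [seq w <- words (absz l) (absz l) | [&& normal w, wtj w == j & wtl w == l]].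

Lemma basis_uniq j l : uniq (basis j l).
Proof. exact: undup_uniq. Qed.

Lemma mem_basis j l w : w \in basis j l = [&& normal w, wtj w == j & wtl w == l].
Proof.
rewrite mem_undup mem_filter; case: and3P => //= -[Hw _ /eqP Hl].
apply: mem_words; first exact: normal_lower.
by have := wtl_size (normal_lower Hw); lia.
Qed.
End NS2Verma.

Section Evaluation.
Variables (K : numFieldType) (N : rep K) (v : N).

Lemma mevE (m : {poly K}) :
  mev v m = \sum_(w <- pmap pickle_inv (iota 0 (size m)) | normal w)
              m`_(pickle w) *: wev v w.
Proof.
rewrite /mev /= /ext -(big_mkord predT (fun i => m`_i *:
   (if pickle_inv i is Some w then if normal w then wev v w else 0 else 0))).
rewrite /index_iota subn0; elim: (iota 0 (size m)) => [|i s IH]; first by rewrite !big_nil.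
rewrite big_cons IH /=; case E: (pickle_inv i : option word) => [w|] /=; last first.
  by rewrite scaler0 add0r.
have := @pickle_invK word i; rewrite E /= => <-; rewrite big_cons.
by case: ifP => // _; rewrite scaler0 add0r.
Qed.

Lemma pmap_pickle_uniq n : uniq (pmap (@pickle_inv word) (iota 0 n)).
Proof.
apply: (@pmap_uniq _ _ _ pickle); last exact: iota_uniq.
exact: pickle_invK.
Qed.

Lemma mem_pmap_pickle n w : (w \in pmap (@pickle_inv word) (iota 0 n)) = (pickle w < n)%N.
Proof.
rewrite mem_pmap; apply/mapP/idP => [[n0] | lt_n].
  rewrite mem_iota add0n => /= lt_n E.
  by have := @pickle_invK word n0; rewrite -E /= => ->.
by exists (pickle w); rewrite ?pickleK_inv // mem_iota.
Qed.

Definition bpart (j l : int) (m : {poly K}) : {poly K} :=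
  \sum_(w <- basis j l) m`_(pickle w) *: ew K w.

Lemma mev_bpart j l m :
  mev v (bpart j l m) = \sum_(w <- basis j l) m`_(pickle w) *: wev v w.
Proof.
rewrite linear_sum /=; apply: eq_big_seq => w; rewrite mem_basis => /and3P[Hw _ _].
by rewrite linearZ /= mev_ew.
Qed.

Lemma wt_wev h q w : wt h q 0 0 v -> wt h q (wtj w) (wtl w) (wev v w).
Proof.
move=> Hv; elim: w => [|x w IH] /=; first by rewrite /wtj /wtl !big_nil.
by rewrite /wtj /wtl !big_cons addrC [dl x + _]addrC; apply: wt_act.
Qed.

(** As u has weight (j, l), [wt_split] shows that only the words of that weight count in an
    expression of u modulo S. *)
Lemma wt_proj (S : N -> Prop) (HS : is_sub S) h q j l u m :
  wt h q 0 0 v -> wt h q j l u -> S (u - mev v m) -> S (u - mev v (bpart j l m)).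
Proof.
move=> Hv Hu; set W := pmap (@pickle_inv word) (iota 0 (size m)).
pose s := ((j, l), u) :: [seq ((wtj w, wtl w), - m`_(pickle w) *: wev v w) | w <- W & normal w].
have Es (P : pred (int * int)) : \sum_(t <- s | P t.1) t.2 =
    (if P (j, l) then u else 0) - \sum_(w <- W | normal w && P (wtj w, wtl w)) m`_(pickle w) *: wev v w.
  rewrite big_cons big_map big_filter_cond /= -sumrN.
  under [X in _ = _ + X]eq_bigr do rewrite -scaleNr.
  by case: ifP => // _; rewrite add0r.
move=> Su; have := @wt_split K N S HS h q s (j, l).
have Hs : {in s, forall t, wt h q t.1.1 t.1.2 t.2}.
  move=> t; rewrite inE => /orP[/eqP -> //|/mapP [w _ ->]].
  by split; rewrite /= linearZ /= (wt_wev w Hv).1 || rewrite /= linearZ /= (wt_wev w Hv).2;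
    rewrite !scalerA mulrC.
move/(_ Hs).
rewrite -[\sum_(t <- s) t.2]/(\sum_(t <- s | predT t.1) t.2) Es /=.
under eq_bigl do rewrite andbT.
rewrite -mevE => /(_ Su).
rewrite (Es (pred1 (j, l))) /= eqxx mev_bpart.
suff -> : \sum_(w <- W | normal w && ((wtj w, wtl w) == (j, l))) m`_(pickle w) *: wev v w
   = \sum_(w <- basis j l) m`_(pickle w) *: wev v w by [].
rewrite -big_filter [RHS](bigID (fun w => pickle w < size m)%N) /=.
rewrite [X in _ + X]big1 => [|w]; last first.
  by rewrite -leqNgt => le; rewrite nth_default ?scale0r.
rewrite addr0 -[RHS]big_filter; apply: perm_big; apply: uniq_perm.
- exact/filter_uniq/pmap_pickle_uniq.
- exact/filter_uniq/basis_uniq.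
move=> w; rewrite !mem_filter mem_pmap_pickle mem_basis -xpair_eqE.
by case: (normal w); rewrite //= andbC.
Qed.

Lemma mev_gen h q c : (forall x, ~~ lower x -> ract x v = vchi h q c x *: v) ->
  forall u, gen (eq v) u -> exists m, u = mev v m.
Proof.
move=> Hv u Hu.
have Hact x m : ract x (mev v m) = mev v (mact (vchi h q c) x m).
  have Hv' y : ~~ lower y -> ract y v - vchi h q c y *: v = 0.
    by move/Hv ->; rewrite subrr.
  by apply/eqP; rewrite -subr_eq0; apply/eqP; exact: (@mev_act K _ N _ (@sub_zero K N) v Hv').
apply: (Hu (fun u => exists m, u = mev v m)).
  split=> [|k _ _ [m1 ->] [m2 ->]|x _ [m ->]].
  - by exists 0; rewrite linear0.
  - by exists (k *: m1 + m2); rewrite linearP.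
  - by exists (mact (vchi h q c) x m).
by move=> _ <-; exists (ew K [::]); rewrite mev_ew.
Qed.
End Evaluation.

(** * Generic rank in polynomial families *)

Section Tame.
Variable K : numFieldType.
Implicit Types (k : K).

Definition evmx m n k (A : 'M[{poly K}]_(m, n)) : 'M[K]_(m, n) :=
  map_mx (horner_eval k) A.

Lemma evmxM m n l k (A : 'M[{poly K}]_(m, n)) (B : 'M_(n, l)) :
  evmx k (A *m B) = evmx k A *m evmx k B.
Proof. exact: map_mxM. Qed.
Lemma evmxB m n k (A B : 'M[{poly K}]_(m, n)) : evmx k (A - B) = evmx k A - evmx k B.
Proof. exact: map_mxB. Qed.
Lemma evmxC m n k (A : 'M[K]_(m, n)) : evmx k (map_mx polyC A) = A.
Proof. by apply/matrixP => i j; rewrite !mxE /horner_eval hornerC. Qed.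
Lemma evmx_det n k (A : 'M[{poly K}]_n) : \det (evmx k A) = (\det A).[k].
Proof. exact: det_map_mx. Qed.

Lemma roots_finite (d : {poly K}) : d != 0 -> exists ex : seq K, forall k, k \notin ex -> d.[k] != 0.
Proof.
have [n] := ubnP (size d); elim: n d => // n IH d /ltnSE-le_n d0.
have [[k dk]|H] := pselect (exists k, root d k); last first.
  by exists [::] => k _; apply/negP => H'; apply: H; exists k.
have [d' E] := factor_theorem d k dk.
have d'0 : d' != 0 by apply: contraNneq d0 => E'; rewrite E E' mul0r.
have [|ex Hex] := IH d' _ d'0.
  by move: le_n; rewrite E size_Mmonic ?monicXsubC // size_XsubC addn2.
exists (k :: ex) => k'; rewrite inE negb_or => /andP[kk' /Hex H].
by rewrite E hornerM mulf_neq0 // hornerXsubC subr_eq0.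
Qed.

Lemma rank_factor m n (A : 'M[K]_(m, n)) : exists (U : 'M_(\rank A, m)) (W : 'M_(n, \rank A)),
  U *m A *m W = 1%:M.
Proof.
exists (pid_mx (\rank A) *m invmx (col_ebase A)), (invmx (row_ebase A) *m pid_mx (\rank A)).
set P := pid_mx _; set Q := pid_mx _.
have -> : P *m invmx (col_ebase A) *m A *m (invmx (row_ebase A) *m Q)
  = P *m invmx (col_ebase A) *m (col_ebase A *m pid_mx (\rank A) *m row_ebase A)
    *m (invmx (row_ebase A) *m Q) by rewrite mulmx_ebase.
rewrite !mulmxA mulmxKV ?col_ebase_unit // /P /Q.
rewrite -!mulmxA mulKVmx ?row_ebase_unit // !mulmxA !mul_pid_mx.
rewrite !minnn (minn_idPr (rank_leq_row A)) !minnn (minn_idPr (rank_leq_col A)).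
exact: pid_mx_1.
Qed.

(* At a parameter of maximal rank some minor, a polynomial in the parameter,  *)
(* does not vanish.                                                            *)
Lemma generic_minor m n (A : 'M[{poly K}]_(m, n)) :
  exists (r : nat) (U : 'M[K]_(r, m)) (W : 'M[K]_(n, r)) (ex : seq K),
    forall k, k \notin ex -> \rank (evmx k A) = r /\ U *m evmx k A *m W \in unitmx.
Proof.
pose P r := `[< exists k, \rank (evmx k A) = r >].
have exP : exists r, P r by exists (\rank (evmx 0 A)); apply/asboolP; exists 0.
have leP r : P r -> (r <= m)%N by case/asboolP=> k <-; exact: rank_leq_row.
case: (ex_maxnP exP leP) => r /asboolP [k0 Er] rmax; subst r.
have [U [W UW]] := rank_factor (evmx k0 A).
pose S := map_mx polyC U *m A *m map_mx polyC W.
have ES k : evmx k S = U *m evmx k A *m W by rewrite !evmxM !evmxC.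
have dS : \det S != 0.
  apply: contra_eq_neq (ES k0) => dS; rewrite UW; apply/eqP => E.
  by have := evmx_det k0 S; rewrite E det1 dS horner0 => /eqP; rewrite oner_eq0.
have [ex Hex] := roots_finite dS.
exists (\rank (evmx k0 A)), U, W, ex => k /Hex; rewrite -evmx_det ES => H.
have uS : U *m evmx k A *m W \in unitmx by rewrite unitmxE unitfE.
split=> //; apply/eqP; rewrite eqn_leq rmax /=; last by apply/asboolP; exists k.
apply: (@leq_trans (\rank (U *m evmx k A *m W))); first by rewrite mxrank_unit.
by apply: leq_trans (mxrankM_maxl _ _) _; exact: mxrankM_maxr.
Qed.

Lemma generic_rank m n (A : 'M[{poly K}]_(m, n)) :
  exists r (ex : seq K), forall k, k \notin ex -> \rank (evmx k A) = r.
Proof.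
by have [r [U [W [ex H]]]] := generic_minor A; exists r, ex => k /H[].
Qed.

(** Cramer's rule: with S = U A W an invertible minor of maximal size, put Z = det S - A W adj(S) U.
    If z A = 0 then z Z = det S z; conversely Z A = 0, because the rows of A are combinations of
    those of U A. *)
Lemma generic_kernel m n (A : 'M[{poly K}]_(m, n)) :
  exists (Z : 'M[{poly K}]_m) (ex : seq K), forall k, k \notin ex ->
    forall z : 'rV[K]_m, (z *m evmx k A == 0) = (z <= evmx k Z)%MS.
Proof.
have [r [U [W [ex H]]]] := generic_minor A.
have [S ES] : exists S, forall k, evmx k S = U *m evmx k A *m W.
  by exists (map_mx polyC U *m A *m map_mx polyC W) => k; rewrite !evmxM !evmxC.
pose Z := (\det S)%:M - A *m map_mx polyC W *m \adj S *m map_mx polyC U.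
exists Z, ex => k /H[rk uS] z; set B := evmx k A in rk uS *.
have EZ : evmx k Z = (\det (evmx k S))%:M - B *m W *m \adj (evmx k S) *m U.
  have E1 : evmx k (\adj S) = \adj (evmx k S) by rewrite /evmx map_mx_adj.
  have E2 : evmx k ((\det S)%:M : 'M_m) = ((\det S).[k])%:M.
    by apply/matrixP => i j; rewrite !mxE /horner_eval hornerMn.
  by rewrite evmxB !evmxM !evmxC evmx_det E1 E2.
have dS : \det (evmx k S) != 0 by rewrite ES -unitfE -unitmxE.
apply/eqP/idP => [zB|/submxP[y ->]].
  have zZ : z *m evmx k Z = \det (evmx k S) *: z.
    by rewrite EZ mulmxBr !mulmxA zB !mul0mx subr0 mul_mx_scalar.
  apply/submxP; exists ((\det (evmx k S))^-1 *: z).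
  by rewrite -scalemxAl zZ scalerA mulVf // scale1r.
rewrite -mulmxA; suff -> : evmx k Z *m B = 0 by rewrite mulmx0.
have /submxP[Y EY] : (B <= U *m B)%MS.
  have sub : (U *m B <= B)%MS := submxMl U B.
  rewrite -(mxrank_leqif_sup sub) eqn_leq mxrankS //= rk.
  apply: (@leq_trans (\rank (U *m B *m W))); first by rewrite mxrank_unit.
  exact: mxrankM_maxl.
rewrite EZ mulmxBl mul_scalar_mx -!mulmxA [X in _ - X](_ : _ = \det (evmx k S) *: B) ?subrr //.
rewrite {1}EY -!mulmxA (mulmxA U B) (mulmxA (U *m B)) -ES.
rewrite (mulmxA (evmx k S)) mul_mx_adj mul_scalar_mx -scalemxAr.
by rewrite -EY.
Qed.

(* Families of subspaces given, for almost all values of the parameter, by    *)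
(* the row space of a polynomial matrix.                                       *)
Definition tame n (E : K -> 'rV[K]_n -> Prop) : Prop :=
  exists m (Z : 'M[{poly K}]_(m, n)) (ex : seq K), forall k, k \notin ex ->
    forall z, E k z <-> (z <= evmx k Z)%MS.

Lemma tame_eq n (E E' : K -> 'rV[K]_n -> Prop) :
  (forall k z, E k z <-> E' k z) -> tame E -> tame E'.
Proof.
move=> H [m [Z [ex HZ]]]; exists m, Z, ex => k kex z.
by rewrite -H; exact: HZ.
Qed.

Lemma tame_zero n : tame (fun _ (z : 'rV[K]_n) => z = 0).
Proof.
exists 0%N, 0, [::] => k _ z; split=> [->|]; first exact: sub0mx.
by case/submxP=> y ->; rewrite [y]thinmx0 mul0mx.
Qed.

(** z P = y Z says that the row (z, y) is in the kernel of P stacked over - Z, which is generically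
    the row space of a polynomial matrix. *)
Lemma tame_preim n n' (P : 'M[{poly K}]_(n, n')) (E : K -> 'rV[K]_n' -> Prop) :
  tame E -> tame (fun k z => E k (z *m evmx k P)).
Proof.
case=> m [Z [ex HZ]].
have [Y [ex' HY]] := generic_kernel (col_mx P (- Z)).
exists (n + m)%N, (lsubmx Y), (ex ++ ex') => k.
rewrite mem_cat negb_or => /andP[/HZ H1 /HY H2] z; rewrite H1.
have E2 (y : 'rV_m) : (row_mx z y <= evmx k Y)%MS = (z *m evmx k P == y *m evmx k Z).
  rewrite -H2 /evmx map_col_mx mul_row_col map_mxN mulmxN.
  by rewrite subr_eq0.
split=> [/submxP[y Ey]|/submxP[y Ey]].
  have : (row_mx z y <= evmx k Y)%MS by rewrite E2 Ey.
  case/submxP=> x Ex; apply/submxP; exists x.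
  have := congr1 lsubmx Ex; rewrite row_mxKl => ->.
  by rewrite /evmx map_lsubmx mulmx_lsub.
apply/submxP; exists (y *m evmx k (rsubmx Y)); apply/eqP; rewrite -E2.
apply/submxP; exists y; rewrite Ey /evmx map_lsubmx map_rsubmx -mul_mx_row.
by rewrite hsubmxK.
Qed.

Lemma tame_img n n' (P : 'M[{poly K}]_(n, n')) (E : K -> 'rV[K]_n -> Prop) :
  tame E -> tame (fun k z => exists2 y, E k y & z = y *m evmx k P).
Proof.
case=> m [Z [ex HZ]]; exists m, (Z *m P), ex => k /HZ H z; rewrite evmxM.
split=> [[y /H/submxP[x ->] ->]|/submxP[x ->]].
  by apply/submxP; exists x; rewrite mulmxA.
by exists (x *m evmx k Z); [apply/H; exact: submxMl | rewrite mulmxA].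
Qed.

(** If E is the row space of Z, the intersection is the image under Z of the preimage of E' under
    Z. *)
Lemma tame_and n (E E' : K -> 'rV[K]_n -> Prop) :
  tame E -> tame E' -> tame (fun k z => E k z /\ E' k z).
Proof.
case=> m [Z [ex HZ]] /(tame_preim Z) /(tame_img Z) [m' [Y [ex' HY]]].
exists m', Y, (ex ++ ex') => k; rewrite mem_cat negb_or => /andP[/HZ H1 /HY H2] z.
rewrite -H2; split=> [[/H1/submxP[y ->] E'y]|[y E'y ->]]; first by exists y.
by split=> //; apply/H1; exact: submxMl.
Qed.

Lemma tame_sum n (E E' : K -> 'rV[K]_n -> Prop) :
  tame E -> tame E' ->
  tame (fun k z => exists z1 z2, [/\ E k z1, E' k z2 & z = z1 + z2]).
Proof.
case=> m [Z [ex HZ]] [m' [Z' [ex' HZ']]].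
exists (m + m')%N, (col_mx Z Z'), (ex ++ ex') => k.
rewrite mem_cat negb_or => /andP[/HZ H1 /HZ' H2] z.
rewrite /evmx map_col_mx -/(evmx k Z) -/(evmx k Z').
split=> [[z1 [z2 [/H1/submxP[x1 ->] /H2/submxP[x2 ->] ->]]]|/submxP[x ->]].
  by apply/submxP; exists (row_mx x1 x2); rewrite mul_row_col.
exists (lsubmx x *m evmx k Z), (rsubmx x *m evmx k Z'); split.
- by apply/H1; exact: submxMl.
- by apply/H2; exact: submxMl.
- by rewrite -mul_row_col hsubmxK.
Qed.

Definition exceeds n (E F : 'rV[K]_n -> Prop) : Prop := exists2 z, E z & ~ F z.
Definition exceeds_by_line n (E F : 'rV[K]_n -> Prop) : Prop :=
  exists z, [/\ E z, ~ F z & forall z', E z' -> exists t : K, F (z' - t *: z)].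

(** The ranks of both families are generically constant, hence so is dim E / F; [exceeds] says that
    it is positive, [exceeds_by_line] that it is 1. *)
Lemma generic_codim n (E F : K -> 'rV[K]_n -> Prop) :
  tame E -> tame F -> (forall k z, F k z -> E k z) ->
  exists ex : seq K, forall k k', k \notin ex -> k' \notin ex ->
    (exceeds (E k) (F k) -> exceeds (E k') (F k')) /\
    (exceeds_by_line (E k) (F k) -> exceeds_by_line (E k') (F k')).
Proof.
case=> m [Z [ex1 HE]] [m' [Y [ex2 HF]]] sFE.
have [r [ex3 Hr]] := generic_rank Z; have [s [ex4 Hs]] := generic_rank Y.
exists (ex1 ++ ex2 ++ ex3 ++ ex4).
have codim k : k \notin ex1 ++ ex2 ++ ex3 ++ ex4 ->
    (evmx k Y <= evmx k Z)%MS /\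
    ((exceeds (E k) (F k) <-> (s < r)%N) /\ (exceeds_by_line (E k) (F k) <-> r = s.+1)).
  rewrite !mem_cat !negb_or => /and4P[/HE H1 /HF H2 /Hr H3 /Hs H4].
  have sub : (evmx k Y <= evmx k Z)%MS by apply/rV_subP => z /H2 /sFE /H1.
  split=> //.
  have le_sr : (s <= r)%N by rewrite -H3 -H4 mxrankS.
  have notE : exceeds (E k) (F k) <-> ~~ (evmx k Z <= evmx k Y)%MS.
    split=> [[z /H1 zZ nFz]|/rV_subP nsub].
      by apply/negP => /(submx_trans zZ) /H2.
    by case: (pselect (exceeds (E k) (F k))) => // nex; case: nsub => z /H1 Ez;
      apply/H2; case: (pselect (F k z)) => // nF; case: nex; exists z.
  have eqrank : (evmx k Z <= evmx k Y)%MS = (r == s).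
    by rewrite -(mxrank_leqif_sup sub) H3 H4 eq_sym.
  split; first by rewrite notE eqrank ltn_neqAle le_sr andbT eq_sym.
  split=> [[z [Ez nFz Hz]]|Ers].
    have ltsr : (s < r)%N.
      rewrite ltn_neqAle le_sr andbT eq_sym -eqrank; apply/notE; by exists z.
    apply/eqP; rewrite eqn_leq ltsr andbT.
    have : (evmx k Z <= evmx k Y + z)%MS.
      apply/rV_subP => z' /H1 /Hz [t /H2 H].
      by rewrite -[z'](subrK (t *: z)) addmx_sub_adds // scalemx_sub.
    move/mxrankS; rewrite H3 => /leq_trans; apply.
    apply: leq_trans (mxrank_adds_leqif _ _) _; rewrite H4 -[s.+1]addn1 leq_add2l.
    exact: rank_leq_row.
  have /notE : ~~ (evmx k Z <= evmx k Y)%MS by rewrite eqrank Ers gtn_eqF.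
  case=> z Ez nFz; exists z; split=> // z' /H1 z'Z.
  have sub2 : (evmx k Y + z <= evmx k Z)%MS by rewrite addsmx_sub sub; apply/H1.
  have nzY : ~~ (evmx k Y + z <= evmx k Y)%MS.
    by rewrite addsmx_sub submx_refl /=; apply/negP => /H2.
  have : (evmx k Z <= evmx k Y + z)%MS.
    rewrite -(mxrank_leqif_sup sub2) eqn_leq mxrankS //= H3 Ers -H4.
    rewrite ltn_neqAle (mxrankS (addsmxSl _ _)) andbT.
    by rewrite (mxrank_leqif_sup (addsmxSl _ _)) nzY.
  move=> /(submx_trans z'Z) /sub_addsmxP [[y1 y2] /= ->].
  exists (y2 0 0); apply/H2.
  have -> : y2 *m z = y2 0 0 *: z by rewrite {1}[y2]mx11_scalar mul_scalar_mx.
  by rewrite addrK submxMl.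
move=> k k' /codim [_ [H1 H2]] /codim [_ [H3 H4]]; split.
  by move/H1/H3.
by move/H2/H4.
Qed.
End Tame.

(** * Iterated singular vectors of Verma modules *)

Section VermaWeights.
Variables (K : numFieldType) (h q c : K).
Let V := verma h q c.
Notation chi := (vchi h q c).

Lemma mev_hom (N : rep K) (v : N) :
  (forall x, ~~ lower x -> ract x v = chi x *: v) ->
  @hom K V N (mev v).
Proof.
move=> Hv x m; apply/eqP; rewrite eq_sym -subr_eq0; apply/eqP.
apply: (@mev_act K _ N _ (@sub_zero K N) v) => y /Hv ->; exact: subrr.
Qed.

Lemma wev_vgen w : normal w -> wev (vgen h q c) w = ew K w.
Proof.
elim: w => //= x w IH /andP[Hxw Hw].
by rewrite IH // [LHS]mact_ew aact_cons.
Qed.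

Lemma mev_vgen m : inspan (fun w => normal w) m -> mev (vgen h q c) m = m.
Proof.
move=> Hm; apply: (Hm (fun m => mev (vgen h q c) m = m)); first by rewrite linear0.
  by move=> k u v Hu Hv; rewrite linearP Hu Hv.
by move=> w Hw; rewrite mev_ew // wev_vgen.
Qed.

Lemma wt_vgen : wt h q 0 0 (vgen h q c).
Proof.
split; rewrite vgen_lower //= ?subr0 //.
by rewrite mul0r addr0.
Qed.

(** Defined by words alone, hence the same subspace for all h, q, c, as comparison within a family
    of Verma modules requires. *)
Definition Mwt (j l : int) (m : {poly K}) : Prop := m = bpart j l m.

Lemma bpart_normal j l m : inspan (fun w => normal w) (@bpart K j l m).
Proof.
rewrite /bpart big_seq; apply: big_ind => [|u v|w]; [exact: inspan0|exact: inspanD|].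
by rewrite mem_basis => /and3P[Hw _ _]; apply: inspanZ; apply: inspan_ew.
Qed.

Lemma Mwt_wt j l m : Mwt j l m -> @wt K V h q j l m.
Proof.
move=> ->; rewrite /bpart.
split; rewrite linear_sum scaler_sumr; apply: eq_big_seq => w; rewrite mem_basis;
  case/and3P=> Hw /eqP Ej /eqP El; rewrite linearZ /= -(wev_vgen Hw).
  by rewrite (wt_wev w wt_vgen).1 Ej !scalerA mulrC.
by rewrite (wt_wev w wt_vgen).2 El !scalerA mulrC.
Qed.

Lemma wt_Mwt j l m : inspan (fun w => normal w) m -> @wt K V h q j l m -> Mwt j l m.
Proof.
move=> Hm Hw.
have E0 : m - mev (vgen h q c) m = 0 by rewrite mev_vgen // subrr.
have := @wt_proj K V (vgen h q c) _ (@sub_zero K V) h q j l m m wt_vgen Hw E0.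
rewrite mev_vgen; last exact: bpart_normal.
by move/eqP; rewrite subr_eq0 => /eqP.
Qed.

Lemma normal_act x m : inspan (fun w => normal w) m -> inspan (fun w => normal w) (mact chi x m).
Proof.
move=> Hm; apply: (inspan_ext Hm) => w Hw.
by apply: inspan_sub (@aact_letters K chi w x Hw) => u [].
Qed.

Lemma Mwt_act j l x m : Mwt j l m -> Mwt (j + dj x) (l + dl x) (mact chi x m).
Proof.
move=> Hm; apply: wt_Mwt; last by apply: (@wt_act K V); exact: Mwt_wt.
by apply: normal_act; rewrite Hm; exact: bpart_normal.
Qed.

Definition tov (b : seq word) (z : 'rV[K]_(size b)) : {poly K} :=
  \sum_(i < size b) z 0 i *: ew K (nth [::] b i).
Definition cov (b : seq word) (m : {poly K}) : 'rV[K]_(size b) :=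
  \row_i m`_(pickle (nth [::] b i)).

Lemma tov_linear b : linear (@tov b).
Proof.
move=> k u v; rewrite /tov scaler_sumr -big_split; apply: eq_bigr => i _.
by rewrite !mxE scalerDl scalerA.
Qed.

Lemma covK b m : tov (cov b m) = \sum_(w <- b) m`_(pickle w) *: ew K w.
Proof. by rewrite (big_nth [::]) big_mkord; apply: eq_bigr => i _; rewrite mxE. Qed.

Lemma tovK b (z : 'rV[K]_(size b)) : uniq b -> cov b (tov z) = z.
Proof.
move=> Ub; apply/rowP => i; rewrite mxE /tov coef_sum (bigD1 i) //= coefZ coefXn eqxx mulr1.
rewrite big1 ?addr0 // => i' ii'; rewrite coefZ coefXn.
case: eqP => [/(pcan_inj pickleK) /eqP|_]; last by rewrite mulr0.
by rewrite nth_uniq // => /eqP/val_inj E; rewrite E eqxx in ii'.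
Qed.

Lemma Mwt_cov j l m : Mwt j l m <-> m = tov (cov (basis j l) m).
Proof. by rewrite covK. Qed.

Lemma Mwt_tov j l (z : 'rV_(size (basis j l))) : Mwt j l (tov z).
Proof. by rewrite Mwt_cov tovK //; exact: basis_uniq. Qed.

(* [KD [:: n_1; ..; n_s]] is obtained from 0 by adjoining successively, for    *)
(* [n_s], ..., [n_1], the vectors of weight [(0, n_i)] singular modulo what    *)
(* precedes.                                                                   *)
Fixpoint KD (D : seq nat) : V -> Prop :=
  if D is n :: D' then
    gen (fun m : V => KD D' m \/ (Mwt 0 (n * 2)%N m /\ forall x, ns2_pos x -> KD D' (ract x m)))
  else fun m => m = 0.

Definition SG (D : seq nat) (n : nat) (m : V) : Prop :=
  Mwt 0 (n * 2)%N m /\ forall x, ns2_pos x -> KD D (ract x m).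

Lemma KD_sub D : is_sub (KD D).
Proof. case: D => [|n D]; [exact: sub_zero | exact: gen_sub]. Qed.

Lemma KD_SG n D m : SG D n m -> KD (n :: D) m.
Proof. by move=> H; apply: gen_in; right. Qed.

Lemma KD_cons n D m : KD D m -> KD (n :: D) m.
Proof. by move=> H; apply: gen_in; left. Qed.

Lemma MwtZD j l k m m' : Mwt j l m -> Mwt j l m' -> Mwt j l (k *: m + m').
Proof.
rewrite !Mwt_cov => -> ->; rewrite -tov_linear tovK //; exact: basis_uniq.
Qed.

Lemma SGZD D n k m m' : SG D n m -> SG D n m' -> SG D n (k *: m + m').
Proof.
case=> H1 H2 [H3 H4]; split; first exact: MwtZD.
by move=> x Hx; rewrite linearP; apply: subZD; [exact: KD_sub|exact: H2|exact: H4].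
Qed.
End VermaWeights.
Arguments KD {K} h q c D _ : simpl never.
Arguments SG {K} h q c D n _.

Section Central.
Variable K : numFieldType.
Lemma central_act (N : rep K) x (u : N) : ract Cc (ract x u) = ract x (ract Cc u).
Proof. by rewrite ract_comm /ssign /= expr0 scale1r lcomb_nil addr0. Qed.

Lemma central_normal (h q c : K) m : inspan (fun w => normal w) m ->
  @ract K (verma h q c) Cc m = c *: m.
Proof.
move=> Hm; apply: (Hm (fun m => @ract K (verma h q c) Cc m = c *: m)).
- by rewrite linear0 scaler0.
- by move=> k u v Hu Hv; rewrite linearP /= Hu Hv scalerDr !scalerA mulrC.
move=> w Hw; rewrite -(wev_vgen h q c Hw); elim: w {Hw} => [|x w IH]; first exact: vgen_lower.
by rewrite -[wev _ (x :: w)]/(ract x (wev (vgen h q c) w)) central_act IH linearZ.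
Qed.

(** Brackets with J_1 produce all G^+ and G^- of positive mode from the lowest ones; their mutual
    brackets then give L_n and J_n, combinations with different r - s separating the two. *)
Lemma pos_generators (N : rep K) (S : N -> Prop) (HS : is_sub S) u :
  S (ract (Gp 0) u) -> S (ract (Gm 0) u) -> S (ract (Jn 1) u) ->
  forall x, ns2_pos x -> S (ract x u).
Proof.
move=> HGp HGm HJ.
have Gpn (n : nat) : S (ract (Gp n) u).
  elim: n => // n IH.
  have -> : ract (Gp n.+1) u = ract (Jn 1) (ract (Gp n) u) - ract (Gp n) (ract (Jn 1) u).
    have := ractB (Jn 1) (Gp n) u.
    rewrite /ssign /= expr0 scale1r => ->; rewrite lcomb_cons lcomb_nil /= scale1r addr0.
    by congr (ract (Gp _) u); lia.
  by apply: subB => //; apply: sub_act.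
have Gmn (n : nat) : S (ract (Gm n) u).
  elim: n => // n IH.
  have -> : ract (Gm n.+1) u = - (ract (Jn 1) (ract (Gm n) u) - ract (Gm n) (ract (Jn 1) u)).
    have := ractB (Jn 1) (Gm n) u.
    rewrite /ssign /= expr0 scale1r => ->; rewrite lcomb_cons lcomb_nil /= scaleN1r addr0 opprK.
    by congr (ract (Gm _) u); lia.
  by apply: subN => //; apply: subB => //; apply: sub_act.
have GG (k l : nat) : S (2%:R *: ract (Ln (k + l).+1) u + (k%:R - l%:R) *: ract (Jn (k + l).+1) u).
  have -> : 2%:R *: ract (Ln (k + l).+1) u + (k%:R - l%:R) *: ract (Jn (k + l).+1) u
     = ract (Gp k) (ract (Gm l) u) + ract (Gm l) (ract (Gp k) u).
    have := ractB (Gp k) (Gm l) u.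
    rewrite /ssign /= expr1 scaleN1r opprK => ->; rewrite !lcomb_cons lcomb_nil /=.
    rewrite (_ : (Posz k + l + 1 == 0) = false); last by lia.
    rewrite (_ : Posz k + l + 1 = (k + l).+1); last by lia.
    rewrite mulr0 scale0r !addr0; congr (_ + _ *: _).
    by rewrite /halfmode -!pmulrn; ring.
  by apply: subD => //; apply: sub_act.
have J (n : nat) : S (ract (Jn n.+1) u).
  case: n => // n.
  have -> : ract (Jn n.+2) u = (2%:R * n.+1%:R)^-1 *:
     ((2%:R *: ract (Ln (n.+1 + 0).+1) u + (n.+1%:R - 0%:R) *: ract (Jn (n.+1 + 0).+1) u)
      - (2%:R *: ract (Ln (0 + n.+1).+1) u + (0%:R - n.+1%:R) *: ract (Jn (0 + n.+1).+1) u)).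
    rewrite addn0 add0n.
    have : (n.+1%:R : K) != 0 by rewrite pnatr_eq0.
    move: (n.+1%:R : K) => e e0; lmod_coefs.
    by split; [field => // | split; [field => // | ]].
  by apply: subZ => //; apply: subB => //; exact: GG.
case=> [[n|n]|[n|n]||[n|n]|[n|n]] //=.
- case: n => // n _.
  have -> : ract (Ln n.+1) u = 2%:R^-1 *: ((2%:R *: ract (Ln (n + 0).+1) u
      + (n%:R - 0%:R) *: ract (Jn (n + 0).+1) u) - (n%:R - 0%:R) *: ract (Jn n.+1) u).
    by rewrite addn0; lmod_field.
  by apply: (subZ HS); apply: (subB HS); [exact: GG | apply: (subZ HS)].
- by case: n.
Qed.
End Central.

Section KDspan.
Variables (K : numFieldType) (h q c : K).
Let V : rep K := verma h q c.

Lemma wevP (N : rep K) w (k : K) (u v : N) : wev (k *: u + v) w = k *: wev u w + wev v w.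
Proof. by elim: w => //= x w ->; rewrite linearP. Qed.

Lemma wev0 (N : rep K) w : wev (0 : N) w = 0.
Proof. by elim: w => //= x w ->; rewrite linear0. Qed.

Lemma wev_sub (N : rep K) (S : N -> Prop) (HS : is_sub S) w v : S v -> S (wev v w).
Proof. by move=> Sv; elim: w => //= x w; exact: sub_act. Qed.

(** Modulo [KD D], z is a highest weight vector of weight (h + n, q), so Verma words may be
    evaluated at it. *)
Lemma SG_act D n (z : V) x : SG h q c D n z -> ~~ lower x ->
  KD h q c D (ract x z - vchi (h + n%:R) q c x *: z).
Proof.
move=> [Hz Hpos] Hx.
have HS := KD_sub h q c D.
have [HJ HL] := Mwt_wt h q c Hz.
have pos y : ns2_pos y -> vchi (h + n%:R) q c y = 0 ->
    KD h q c D (ract y z - vchi (h + n%:R) q c y *: z).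
  by move=> Hy ->; rewrite scale0r subr0; exact: Hpos.
case: x Hx => [m|m||m|m] Hx.
- have [m0|m0] := eqVneq m 0; last first.
    by apply: (pos (Ln m)); [move: Hx m0 => /=; lia | rewrite /= (negbTE m0)].
  have -> : vchi (h + n%:R) q c (Ln m) = h + (n * 2)%N%:~R / 2%:R.
    by rewrite m0 /= -pmulrn natrM mulfK // pnatr_eq0.
  by rewrite m0 HL subrr; exact: sub0.
- have [m0|m0] := eqVneq m 0; last first.
    by apply: (pos (Jn m)); [move: Hx m0 => /=; lia | rewrite /= (negbTE m0)].
  by rewrite m0 HJ subr0 subrr; exact: sub0.
- have -> : ract Cc z = c *: z.
    by apply: central_normal; rewrite Hz; exact: bpart_normal.
  by rewrite subrr; exact: sub0.
- by apply: (pos (Gp m)) => //; move: Hx => /=; lia.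
- by apply: (pos (Gm m)) => //; move: Hx => /=; lia.
Qed.

Lemma SG_mev_act D n (z : V) x m : SG h q c D n z ->
  KD h q c D (ract x (mev z m) - mev z (mact (vchi (h + n%:R) q c) x m)).
Proof.
move=> Hz; apply: (mev_act (KD_sub h q c D)) => y; exact: SG_act.
Qed.

(** Modulo [KD D], u is a sum of evaluations at the vectors of the list [gs]; an element of
    [KD (n :: D)] involves only finitely many of them. *)
Fixpoint GS (n : nat) (D : seq nat) (gs : seq V) (u : V) : Prop :=
  if gs is g :: gs' then exists m, GS n D gs' (u - mev g m) else KD h q c D u.

Lemma GS_sub n D gs : (forall g, List.In g gs -> SG h q c D n g) -> is_sub (GS n D gs).
Proof.
elim: gs => [|g gs IH] Hgs; first exact: (KD_sub h q c D).
have HS : is_sub (GS n D gs) by apply: IH => t Ht; apply: Hgs; right.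
have Hg : SG h q c D n g by apply: Hgs; left.
have KDGS y : KD h q c D y -> GS n D gs y.
  elim: {IH Hgs HS} gs y => //= t gs IH y Hy.
  by exists 0; rewrite linear0 subr0; exact: IH.
split=> [|k u v [m1 Hu] [m2 Hv]|x u [m Hu]].
- by exists 0; rewrite linear0 subr0; exact: (sub0 HS).
- exists (k *: m1 + m2); rewrite linearP opprD addrACA -scalerBr; exact: (subZD HS).
- exists (mact (vchi (h + n%:R) q c) x m).
  have -> : ract x u - mev g (mact (vchi (h + n%:R) q c) x m)
    = ract x (u - mev g m) + (ract x (mev g m) - mev g (mact (vchi (h + n%:R) q c) x m)).
    by rewrite linearB /= addrA subrK.
  apply: (subD HS); first exact: sub_act.
  by apply: KDGS; exact: SG_mev_act.
Qed.

Lemma GS_catl n D gs gs' u : GS n D gs u -> GS n D (gs ++ gs') u.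
Proof.
elim: gs u => [|g gs IH] u /=; last by case=> m /IH H; exists m.
by elim: gs' u => //= g gs' IH u Hu; exists 0; rewrite linear0 subr0; exact: IH.
Qed.

Lemma GS_catr n D gs gs' u : GS n D gs u -> GS n D (gs' ++ gs) u.
Proof.
by elim: gs' => //= g gs' IH Hu; exists 0; rewrite linear0 subr0; exact: IH.
Qed.

Lemma KD_GS n D u : KD h q c (n :: D) u ->
  exists2 gs, forall g, List.In g gs -> SG h q c D n g & GS n D gs u.
Proof.
move=> Hu; apply: (Hu (fun u => exists2 gs, forall g, List.In g gs -> SG h q c D n g & GS n D gs u)).
  split=> [|k u1 v [gs Hgs Hu1] [gt Hgt Hv]|x u1 [gs Hgs Hu1]].
  - by exists [::]; last exact: (sub0 (KD_sub h q c D)).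
  - have H g : List.In g (gs ++ gt) -> SG h q c D n g.
      by case/List.in_app_iff=> [/Hgs|/Hgt].
    exists (gs ++ gt) => //; apply: (subZD (GS_sub H)); [exact: GS_catl|exact: GS_catr].
  - by exists gs => //; apply: (sub_act (GS_sub Hgs)).
move=> v [Hv|Hv]; first by exists [::].
exists [:: v] => [g|]; first by case=> // <-.
exists (ew K [::]); have -> : mev v (ew K [::]) = v by rewrite mev_ew.
by rewrite subrr; exact: (sub0 (KD_sub h q c D)).
Qed.

Lemma wt_shift (N : rep K) n j l (u : N) :
  wt h q j l u -> wt (h + n%:R) q j (l - (n * 2)%N%:Z) u.
Proof.
case=> HJ HL; split=> //; rewrite HL; congr (_ *: _).
by rewrite rmorphB /= -pmulrn natrM; field.
Qed.

Lemma wtB (N : rep K) h' j l (u v : N) : wt h' q j l u -> wt h' q j l v -> wt h' q j l (u - v).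
Proof. by case=> H1 H2 [H3 H4]; split; rewrite linearB /= ?H1 ?H2 ?H3 ?H4 scalerBr. Qed.

Lemma wt_mev_bpart (N : rep K) h' j l (v : N) m :
  wt h' q 0 0 v -> wt h' q j l (mev v (bpart j l m)).
Proof.
move=> Hv; rewrite mev_bpart; split; rewrite linear_sum scaler_sumr;
  apply: eq_big_seq => w; rewrite mem_basis => /and3P [Hw /eqP Ej /eqP El];
  rewrite linearZ /=.
  by rewrite (wt_wev w Hv).1 Ej !scalerA mulrC.
by rewrite (wt_wev w Hv).2 El !scalerA mulrC.
Qed.

(* The spanning words of [K^(n :: D)] in a given weight: only words of the     *)
(* complementary weight contribute.                                            *)
Fixpoint GW (n : nat) (D : seq nat) (W : seq word) (u : V) : Prop :=
  if W is w :: W' then exists2 g, SG h q c D n g & GW n D W' (u - wev g w) else KD h q c D u.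

Lemma SG0 n D : SG h q c D n 0.
Proof.
split; first by rewrite /Mwt /bpart big1 // => w _; rewrite coef0 scale0r.
by move=> x _; rewrite linear0; exact: (sub0 (KD_sub h q c D)).
Qed.

Lemma GW_KD n D W u : KD h q c D u -> GW n D W u.
Proof.
elim: W u => // w W IH u Hu; exists 0; first exact: SG0.
by rewrite wev0 subr0; exact: IH.
Qed.

Lemma GW_mev n D g W (m : {poly K}) u : SG h q c D n g ->
  GW n D W u -> GW n D W (u + \sum_(w <- W) m`_(pickle w) *: wev g w).
Proof.
move=> Hg; elim: W u => [|w W IH] u; first by rewrite big_nil addr0.
case=> g' Hg' Hu; exists (m`_(pickle w) *: g + g'); first exact: SGZD.
rewrite big_cons wevP.
have -> : u + (m`_(pickle w) *: wev g w + \sum_(j <- W) m`_(pickle j) *: wev g j) -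
  (m`_(pickle w) *: wev g w + wev g' w)
  = u - wev g' w + \sum_(j <- W) m`_(pickle j) *: wev g j.
  by lmod.
exact: IH.
Qed.

(** Projecting each evaluation to the weight of u leaves finitely many words, fixed in advance,
    applied to singular vectors: a description uniform in h and q. *)
Lemma KD_GW n D j l u : wt h q j l u -> KD h q c (n :: D) u ->
  GW n D (basis j (l - (n * 2)%N%:Z)) u.
Proof.
move=> Hu /KD_GS [gs Hgs]; elim: gs u Hu Hgs => [|g gs IH] u Hu Hgs; first exact: GW_KD.
case=> m Hm.
have Hgs' t : List.In t gs -> SG h q c D n t by move=> Ht; apply: Hgs; right.
have Hg : SG h q c D n g by apply: Hgs; left.
have Hg0 : wt (h + n%:R) q 0 0 g.
  by have := wt_shift n (Mwt_wt h q c (proj1 Hg)); rewrite subrr.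
have := wt_proj (GS_sub Hgs') Hg0 (wt_shift n Hu) Hm => {}Hm.
have Hu' : wt h q j l (u - mev g (bpart j (l - (n * 2)%N%:Z) m)).
  have := wtB (wt_shift n Hu) (wt_mev_bpart j (l - (n * 2)%N%:Z) m Hg0).
  case=> H1 H2; split; rewrite ?H1 ?H2 //; congr (_ *: _).
  by rewrite rmorphB /= -pmulrn natrM; field.
have := IH _ Hu' Hgs' Hm; rewrite mev_bpart => /(GW_mev m Hg).
by rewrite subrK.
Qed.

Lemma GW_KDcons n D W u : GW n D W u -> KD h q c (n :: D) u.
Proof.
elim: W u => [|w W IH] u; first exact: KD_cons.
case=> g /KD_SG Hg /IH Hu; rewrite -[u](subrK (wev g w)).
apply: (subD (KD_sub h q c _)) => //.
by apply: (wev_sub (KD_sub h q c _)).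
Qed.
End KDspan.

(** * Polynomial families of Verma modules *)

Section Family.
Variables (K : numFieldType) (c : K) (H Q : {poly K}).
Notation chi k := (vchi H.[k] Q.[k] c).
Notation Vk k := (verma H.[k] Q.[k] c).

(** Families of vectors with fixed finite support and coefficients polynomial in the parameter. *)
Definition polyvec (f : K -> {poly K}) : Prop :=
  exists s : seq ({poly K} * word), forall k, f k = \sum_(t <- s) t.1.[k] *: ew K t.2.

Lemma polyvec_ew w : polyvec (fun _ => ew K w).
Proof. by exists [:: (1, w)] => k; rewrite big_seq1 hornerC scale1r. Qed.

Lemma polyvec0 : polyvec (fun _ => 0).
Proof. by exists [::] => k; rewrite big_nil. Qed.

Lemma polyvecZ (P : {poly K}) f : polyvec f -> polyvec (fun k => P.[k] *: f k).
Proof.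
case=> s Hs; exists [seq (P * t.1, t.2) | t <- s] => k.
rewrite Hs big_map scaler_sumr; apply: eq_bigr => t _.
by rewrite hornerM scalerA.
Qed.

Lemma polyvecD f g : polyvec f -> polyvec g -> polyvec (fun k => f k + g k).
Proof.
by case=> s Hs [s' Hs']; exists (s ++ s') => k; rewrite big_cat Hs Hs'.
Qed.

Lemma polyvec_eq f g : f =1 g -> polyvec f -> polyvec g.
Proof. by move=> E [s Hs]; exists s => k; rewrite -E. Qed.

Lemma polyvecZc (a : K) f : polyvec f -> polyvec (fun k => a *: f k).
Proof.
by move=> Hf; apply: polyvec_eq (polyvecZ a%:P Hf) => k; rewrite hornerC.
Qed.

Lemma polyvec_ext (f : K -> word -> {poly K}) g :
  (forall w, polyvec (f^~ w)) -> polyvec g -> polyvec (fun k => ext (f k) (g k)).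
Proof.
move=> Hf [s Hs].
apply: (@polyvec_eq (fun k => \sum_(t <- s) t.1.[k] *: f k t.2)) => [k|].
  by rewrite Hs linear_sum; apply: eq_bigr => t _; rewrite linearZ /= ext_ew.
elim: s {Hs} => [|t s IH].
  by apply: polyvec_eq polyvec0 => k; rewrite big_nil.
apply: polyvec_eq (polyvecD (polyvecZ t.1 (Hf t.2)) IH) => k.
by rewrite big_cons.
Qed.

Lemma polyvec_lcomb (f : K -> ns2_gen -> {poly K}) s :
  (forall x, polyvec (f^~ x)) -> polyvec (fun k => lcomb (f k) s).
Proof.
move=> Hf; elim: s => [|t s IH].
  by apply: polyvec_eq polyvec0 => k; rewrite lcomb_nil.
apply: polyvec_eq (polyvecD (polyvecZc t.1 (Hf t.2)) IH) => k.
by rewrite lcomb_cons.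
Qed.

Lemma polyvec_wact n x w : polyvec (fun k => wact (chi k) n x w).
Proof.
have nilcase z : polyvec (fun k => if lower z then ew K [:: z] else chi k z *: ew K [::]).
  case: (lower z); first exact: polyvec_ew.
  have [P HP] : exists P : {poly K}, forall k, chi k z = P.[k].
    case: z => [m|m||m|m] /=.
    - by exists (if m == 0 then H else 0) => k; case: eqP; rewrite ?horner0.
    - by exists (if m == 0 then Q else 0) => k; case: eqP; rewrite ?horner0.
    - by exists c%:P => k; rewrite hornerC.
    - by exists 0 => k; rewrite horner0.
    - by exists 0 => k; rewrite horner0.
  by apply: polyvec_eq (polyvecZ P (polyvec_ew [::])) => k; rewrite HP.
elim: n x w => [|n IH] x [|y w] //=; first exact: polyvec0.
case: (size w < n)%N; first exact: IH.
case: (~~ (consable y w && normal w)); first exact: polyvec0.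
case: (consable x (y :: w)); first exact: polyvec_ew.
case: (x == y); first exact: polyvec0.
apply: polyvecD; last by apply: polyvec_lcomb => z; exact: IH.
apply: polyvecZc; apply: polyvec_ext => [u|]; last exact: IH.
by case: (normal u && consable y u); [exact: polyvec_ew | exact: IH].
Qed.

Lemma polyvec_mact x f : polyvec f -> polyvec (fun k => mact (chi k) x (f k)).
Proof. by apply: polyvec_ext => w; exact: polyvec_wact. Qed.

Lemma polyvec_coef f i : polyvec f -> exists P : {poly K}, forall k, (f k)`_i = P.[k].
Proof.
case=> s Hs; exists (\sum_(t <- s) (ew K t.2)`_i *: t.1) => k.
rewrite Hs coef_sum horner_sum; apply: eq_bigr => t _.
by rewrite coefZ hornerZ mulrC.
Qed.

(** Straightening introduces the parameter only through [chi], so in the PBW bases the entries of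
    the action are polynomial in it. *)
Lemma act_matrix x j l : exists P : 'M[{poly K}]_(size (basis j l), size (basis (j + dj x) (l + dl x))),
  forall k (z : 'rV_(size (basis j l))), mact (chi k) x (tov z) = tov (z *m evmx k P).
Proof.
pose b := basis j l; pose b' := basis (j + dj x) (l + dl x).
have Hcoef (ij : 'I_(size b) * 'I_(size b')) : exists P : {poly K},
    forall k, (mact (chi k) x (ew K (nth [::] b ij.1)))`_(pickle (nth [::] b' ij.2)) = P.[k].
  by apply: polyvec_coef; apply: polyvec_mact; exact: polyvec_ew.
have [P HP] := boolp.choice Hcoef.
exists (\matrix_(i, i') P (i, i')) => k z.
have /Mwt_cov -> := Mwt_act H.[k] Q.[k] c x (Mwt_tov z).
congr tov; apply/rowP => i'; rewrite !mxE /tov linear_sum coef_sum.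
apply: eq_bigr => i _; rewrite linearZ /= coefZ; congr (_ * _).
by rewrite !mxE /horner_eval -HP.
Qed.

Lemma word_matrix w j l j' l' : j' = j + wtj w -> l' = l + wtl w ->
  exists P : 'M[{poly K}]_(size (basis j l), size (basis j' l')),
  forall k (z : 'rV_(size (basis j l))), @wev K (Vk k) (tov z) w = tov (z *m evmx k P).
Proof.
elim: w j' l' => [|x w IH] j' l' -> ->.
  rewrite /wtj /wtl !big_nil !addr0; exists 1%:M => k z.
  by rewrite /evmx map_mx1 mulmx1.
have [P HP] := IH _ _ erefl erefl.
have -> : j + wtj (x :: w) = j + wtj w + dj x by rewrite /wtj big_cons [dj x + _]addrC addrA.
have -> : l + wtl (x :: w) = l + wtl w + dl x by rewrite /wtl big_cons [dl x + _]addrC addrA.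
have [P' HP'] := act_matrix x (j + wtj w) (l + wtl w).
exists (P *m P') => k z; rewrite -[LHS]/(mact (chi k) x (@wev K (Vk k) (tov z) w)).
by rewrite HP HP' evmxM mulmxA.
Qed.

Lemma tovB b (y z : 'rV[K]_(size b)) : tov (y - z) = tov y - tov z.
Proof. by rewrite addrC -scaleN1r tov_linear scaleN1r addrC. Qed.

Lemma tovBZ b (t : K) (y z : 'rV[K]_(size b)) : tov (y - t *: z) = tov y - t *: tov z.
Proof. by rewrite -scaleNr addrC tov_linear addrC scaleNr. Qed.

Lemma tame_and3 n (E1 E2 E3 : K -> 'rV[K]_n -> Prop) :
  tame E1 -> tame E2 -> tame E3 -> tame (fun k z => [/\ E1 k z, E2 k z & E3 k z]).
Proof.
move=> T1 T2 T3; apply: tame_eq (tame_and T1 (tame_and T2 T3)) => k z.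
by split=> [[? []]|[]].
Qed.

Let tame_SG_step D n :
  (forall j l, tame (fun k (z : 'rV_(size (basis j l))) => KD H.[k] Q.[k] c D (tov z))) ->
  tame (fun k (z : 'rV_(size (basis 0 (n * 2)%N))) => SG H.[k] Q.[k] c D n (tov z)).
Proof.
move=> TD.
have T x : tame (fun k (z : 'rV_(size (basis 0 (n * 2)%N))) =>
    KD H.[k] Q.[k] c D (mact (chi k) x (tov z))).
  have [P HP] := act_matrix x 0 (n * 2)%N.
  apply: tame_eq (tame_preim P (TD (0 + dj x) ((n * 2)%N%:Z + dl x))) => k z.
  by rewrite HP.
apply: tame_eq (tame_and3 (T (Gp 0)) (T (Gm 0)) (T (Jn 1))) => k z; split.
  case=> H1 H2 H3; split; first exact: Mwt_tov.
  by apply: pos_generators => //; exact: KD_sub.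
by case=> _ Hpos; split; apply: Hpos.
Qed.

(** By induction on D: singular vectors are cut out by three preimage conditions ([pos_generators]),
    and [KD (n :: D)] is a finite sum of their images under word matrices ([GW]). *)
Lemma tame_KD D j l :
  tame (fun k (z : 'rV_(size (basis j l))) => KD H.[k] Q.[k] c D (tov z)).
Proof.
elim: D j l => [|n D IH] j l.
  apply: tame_eq (tame_zero K (size (basis j l))) => k z; split=> [->|E].
    by rewrite /KD /tov big1 // => i _; rewrite mxE scale0r.
  by rewrite -(tovK z (basis_uniq j l)) E; apply/rowP => i; rewrite !mxE coef0.
have TS := tame_SG_step n IH.
have TW (W : seq word) : (forall w, w \in W -> w \in basis j (l - (n * 2)%N%:Z)) ->
    tame (fun k (z : 'rV_(size (basis j l))) => GW (h := H.[k]) (q := Q.[k]) (c := c) n D W (tov z)).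
  elim: W => [|w W IHW] HW; first exact: IH.
  have := HW w (mem_head _ _); rewrite mem_basis => /and3P[_ /eqP Ej /eqP El].
  have [||P HP] := @word_matrix w 0 (n * 2)%N j l; [lia|lia|].
  have TW' : tame (fun k (z : 'rV_(size (basis j l))) => GW (h := H.[k]) (q := Q.[k]) (c := c) n D W (tov z)).
    by apply: IHW => u Hu; apply: HW; rewrite inE Hu orbT.
  apply: tame_eq (tame_sum (tame_img P TS) TW') => k z; split.
    case=> _ [z2 [[y Hy ->] Hz2 ->]]; exists (tov y) => //.
    by rewrite HP -tovB addrAC subrr add0r.
  case=> g Hg Hz; have [E _] := Hg; move/Mwt_cov: E => E.
  exists (cov (basis 0 (n * 2)%N) g *m evmx k P),
    (z - cov (basis 0 (n * 2)%N) g *m evmx k P); split.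
  - by exists (cov (basis 0 (n * 2)%N) g); rewrite // -E.
  - by rewrite tovB -HP -E.
  - by rewrite addrC subrK.
apply: tame_eq (TW _ (fun w Hw => Hw)) => k z; split; first exact: GW_KDcons.
by apply: KD_GW; apply: Mwt_wt; exact: Mwt_tov.
Qed.

Lemma tame_SG D n :
  tame (fun k (z : 'rV_(size (basis 0 (n * 2)%N))) => SG H.[k] Q.[k] c D n (tov z)).
Proof. by apply: tame_SG_step => j l; exact: tame_KD. Qed.

Lemma KD_Mwt_SG h q D n m : Mwt 0 (n * 2)%N m -> KD h q c D m -> SG h q c D n m.
Proof.
move=> Hm HD; split=> // x _.
exact: (sub_act (KD_sub h q c D)).
Qed.

Definition sing_nz (h q : K) D n : Prop :=
  exists2 m, SG h q c D n m & ~ KD h q c D m.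
Definition sing_line (h q : K) D n : Prop :=
  exists m, [/\ SG h q c D n m, ~ KD h q c D m &
    forall m', SG h q c D n m' -> exists t : K, KD h q c D (m' - t *: m)].

(** Whether singular vectors modulo [KD D] exist, and whether they form a line, does not depend on
    the parameter outside a finite set. *)
Lemma generic_sing D n : exists ex : seq K, forall k k', k \notin ex -> k' \notin ex ->
  (sing_nz H.[k] Q.[k] D n -> sing_nz H.[k'] Q.[k'] D n) /\
  (sing_line H.[k] Q.[k] D n -> sing_line H.[k'] Q.[k'] D n).
Proof.
have [|ex Hex] := @generic_codim K _ _ _ (tame_SG D n) (tame_KD D 0 (n * 2)%N).
  by move=> k z; apply: KD_Mwt_SG; exact: Mwt_tov.
exists ex => k k' Hk Hk'; have [H1 H2] := Hex k k' Hk Hk'; split.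
  case=> m Hm nm; have /Mwt_cov E := Hm.1.
  have [|z Hz nz] := H1; first by exists (cov (basis 0 (n * 2)%N) m); rewrite -E.
  by exists (tov z).
case=> m [Hm nm Hl]; have /Mwt_cov E := Hm.1.
have [|z [Hz nz Hl']] := H2.
  exists (cov (basis 0 (n * 2)%N) m); rewrite -E; split=> // z' /Hl [t Ht].
  by exists t; rewrite tovBZ -E.
exists (tov z); split=> // m' Hm'; have /Mwt_cov E' := Hm'.1.
have [|t Ht] := Hl' (cov (basis 0 (n * 2)%N) m'); first by rewrite -E'.
by exists t; move: Ht; rewrite tovBZ -E'.
Qed.
End Family.

(** * Spectral flow and strings of singular vectors *)

Section Strings.
Variable K : numFieldType.
Implicit Types N : rep K.

Lemma flowGp k N i (u : N) : @ract K (flow k N) (Gp i) u = ract (Gp (i + k)) u.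
Proof. by rewrite [LHS]lcomb_cons lcomb_nil addr0 scale1r. Qed.
Lemma flowGm k N i (u : N) : @ract K (flow k N) (Gm i) u = ract (Gm (i - k)) u.
Proof. by rewrite [LHS]lcomb_cons lcomb_nil addr0 scale1r. Qed.
Lemma flowC k N (u : N) : @ract K (flow k N) Cc u = ract Cc u.
Proof. by rewrite [LHS]lcomb_cons lcomb_nil addr0 scale1r. Qed.
Lemma flowJ k N n (u : N) : @ract K (flow k N) (Jn n) u
  = ract (Jn n) u + (k%:~R / 3%:R * (n == 0)%:R) *: ract Cc u.
Proof. by rewrite [LHS]lcomb_cons lcomb_cons lcomb_nil addr0 scale1r. Qed.
Lemma flowL k N n (u : N) : @ract K (flow k N) (Ln n) u
  = ract (Ln n) u + k%:~R *: ract (Jn n) u + (k%:~R ^+ 2 / 6%:R * (n == 0)%:R) *: ract Cc u.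
Proof. by rewrite [LHS]lcomb_cons !lcomb_cons lcomb_nil addr0 scale1r addrA. Qed.

Lemma flow_flow l k N x (u : N) :
  @ract K (flow l (flow k N)) x u = @ract K (flow (l + k) N) x u.
Proof.
case: x => [n|n||i|i].
- rewrite (@flowL l (flow k N)) !(@flowL _ N) !flowJ flowC.
  by lmod_field.
- by rewrite (@flowJ l (flow k N)) !(@flowJ _ N) flowC; lmod_field.
- by rewrite !flowC.
- by rewrite !flowGp; congr (ract (Gp _) u); lia.
- by rewrite !flowGm; congr (ract (Gm _) u); lia.
Qed.

Lemma flow0 N x (u : N) : @ract K (flow 0 N) x u = ract x u.
Proof.
case: x => [n|n||i|i]; rewrite ?flowL ?flowJ ?flowC ?flowGp ?flowGm ?addr0 ?subr0 //.
  by rewrite scale0r addr0 expr0n !mul0r scale0r addr0.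
by rewrite !mul0r scale0r addr0.
Qed.

Definition hwv N (h q c : K) (u : N) : Prop :=
  [/\ forall x, ns2_pos x -> ract x u = 0, ract (Ln 0) u = h *: u,
      ract (Jn 0) u = q *: u & ract Cc u = c *: u].

Lemma hwv_lower N h q c (u : N) : hwv h q c u ->
  forall x, ~~ lower x -> ract x u = vchi h q c x *: u.
Proof.
case=> Hpos HL HJ HC [m|m||m|m] Hx //.
- have [->|m0] := eqVneq m 0; first by rewrite HL.
  by rewrite /= (negbTE m0) scale0r Hpos //; move: Hx m0 => /=; lia.
- have [->|m0] := eqVneq m 0; first by rewrite HJ.
  by rewrite /= (negbTE m0) scale0r Hpos //; move: Hx m0 => /=; lia.
- by rewrite /= scale0r Hpos //; move: Hx => /=; lia.
- by rewrite /= scale0r Hpos //; move: Hx => /=; lia.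
Qed.

Lemma hwv_wt N h q c (u : N) : hwv h q c u -> wt h q 0 0 u.
Proof. by case=> _ HL HJ _; split; rewrite ?HL ?HJ ?subr0 ?mul0r ?addr0. Qed.

Lemma hwv_pos_generators N h q c (u : N) :
  ract (Gp 0) u = 0 -> ract (Gm 0) u = 0 -> ract (Jn 1) u = 0 ->
  ract (Ln 0) u = h *: u -> ract (Jn 0) u = q *: u -> ract Cc u = c *: u -> hwv h q c u.
Proof.
move=> H1 H2 H3 HL HJ HC; split=> //.
exact: (pos_generators (@sub_zero K N)).
Qed.

Lemma GpGm N i j (u : N) : ract (Gp i) (ract (Gm j) u) =
  - ract (Gm j) (ract (Gp i) u) + (2%:R *: ract (Ln (i + j + 1)) u
  + (i%:~R - j%:~R) *: ract (Jn (i + j + 1)) u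
  + (3%:R^-1 * (i * (i + 1))%:~R * (i + j + 1 == 0)%:R) *: ract Cc u).
Proof.
rewrite ract_comm /ssign /= expr1 scaleN1r !lcomb_cons lcomb_nil /= /halfmode.
by lmod_field.
Qed.

(** G^-_{-1/2} is odd with square zero, so it also kills its image of u; this is the extra condition
    for the positive part moved by one unit of flow. *)
Lemma hwv_lower_string N h q c (u : N) : hwv h q c u ->
  hwv (N := flow 1 N) (h + q + c / 6%:R - 2%:R^-1) (q - 1 + c / 3%:R) c (ract (Gm (-1)) u).
Proof.
move=> Hu; have [Hpos HL HJ HC] := Hu.
have [WJ WL] := wt_act (Gm (-1)) (hwv_wt Hu).
have HC' : ract Cc (ract (Gm (-1)) u) = c *: ract (Gm (-1)) u by rewrite central_act HC linearZ.
have HGp : ract (Gp (0 + 1)) (ract (Gm (-1)) u) = 0.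
  rewrite GpGm (Hpos (Gp _)) // (Hpos (Ln _)) // (Hpos (Jn _)) // linear0 oppr0.
  by rewrite !scaler0 !add0r mulr0 scale0r.
have HJ1 : ract (Jn 1) (ract (Gm (-1)) u) = 0.
  rewrite ract_comm (Hpos (Jn _)) // linear0 scaler0 add0r.
  by rewrite lcomb_cons lcomb_nil /= Hpos // scaler0 addr0.
apply: hwv_pos_generators.
- by rewrite flowGp.
- by rewrite flowGm ract_odd_square.
- by rewrite flowJ mulr0 scale0r addr0.
- by rewrite flowL HC' WJ WL; lmod_field.
- by rewrite flowJ HC' WJ; lmod_field.
- by rewrite flowC HC'.
Qed.

Lemma hwv_upper_string N h q c (u : N) : hwv h q c u ->
  hwv (N := flow (-1) N) (h - q + c / 6%:R - 2%:R^-1) (q + 1 - c / 3%:R) c (ract (Gp (-1)) u).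
Proof.
move=> Hu; have [Hpos HL HJ HC] := Hu.
have [WJ WL] := wt_act (Gp (-1)) (hwv_wt Hu).
have HC' : ract Cc (ract (Gp (-1)) u) = c *: ract (Gp (-1)) u by rewrite central_act HC linearZ.
have HGm : ract (Gm (0 - -1)) (ract (Gp (-1)) u) = 0.
  have := GpGm (-1) 1 u; rewrite (Hpos (Gm _)) // (Hpos (Ln _)) // (Hpos (Jn _)) // linear0.
  rewrite !scaler0 !addr0 /= mulr0 scale0r !addr0.
  by move/eqP; rewrite eq_sym oppr_eq0 => /eqP.
have HJ1 : ract (Jn 1) (ract (Gp (-1)) u) = 0.
  rewrite ract_comm (Hpos (Jn _)) // linear0 scaler0 add0r.
  by rewrite lcomb_cons lcomb_nil /= Hpos // scaler0 addr0.
apply: hwv_pos_generators.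
- by rewrite flowGp ract_odd_square.
- by rewrite flowGm.
- by rewrite flowJ mulr0 scale0r addr0.
- by rewrite flowL HC' WJ WL; lmod_field.
- by rewrite flowJ HC' WJ; lmod_field.
- by rewrite flowC HC'.
Qed.

Lemma hwv_EF N h q c (u : N) : hwv h q c u ->
  ract (Gp 0) (ract (Gm (-1)) u) = (2%:R * h + q) *: u.
Proof.
case=> Hpos HL HJ HC; rewrite GpGm Hpos // HL HJ HC linear0 /=.
by lmod_field.
Qed.

Lemma hwv_FE N h q c (u : N) : hwv h q c u ->
  ract (Gm 0) (ract (Gp (-1)) u) = (2%:R * h - q) *: u.
Proof.
case=> Hpos HL HJ HC; have := GpGm (-1) 0 u; rewrite Hpos // linear0 HL HJ HC /= => H.
have -> : ract (Gm 0) (ract (Gp (-1)) u) = - (- ract (Gm 0) (ract (Gp (-1)) u) +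
  (2%:R *: (h *: u) + ((-1)%:~R - 0%:~R) *: (q *: u)
  + (3%:R^-1 * (-1 * (-1 + 1))%:~R * (-1 + 0 + 1 == 0 :> int)%:R) *: (c *: u)))
  + (2%:R * h - q) *: u by lmod_field.
by rewrite -H oppr0 add0r.
Qed.
End Strings.

(** * Level bounds for PBW words *)

Section WordBounds.

Lemma sum_distinct_odd n (s : seq nat) : uniq s -> all (fun i => i < n)%N s ->
  ((size s) ^ 2 <= \sum_(i <- s) (2 * i + 1))%N.
Proof.
elim: n s => [|n IH] s Us Hs.
  by case: s Us Hs => [|i s] //=; rewrite big_nil.
have [ns|ns] := boolP (n \in s); last first.
  apply: IH => //; apply/allP => i Hi; have := allP Hs i Hi; rewrite ltnS leq_eqVlt.
  by case/orP=> // /eqP [E]; rewrite -E Hi in ns.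
have Hp := perm_to_rem ns.
have Ur : uniq (rem n s) by apply: rem_uniq.
have Hr : all (fun i => i < n)%N (rem n s).
  apply/allP => i; rewrite mem_rem_uniq // inE => /andP[/= ni /(allP Hs)].
  by rewrite ltnS leq_eqVlt (negbTE ni).
rewrite (perm_big _ Hp) /= big_cons (perm_size Hp) /=.
have := IH _ Ur Hr.
have : (size (rem n s) <= n)%N.
  have := uniq_leq_size Ur (s2 := iota 0 n); rewrite size_iota; apply.
  by move=> i /(allP Hr); rewrite mem_iota.
move: (size _) (\sum_(_ <- _) _) => x y; nia.
Qed.

Definition odd_index (x : ns2_gen) : nat := (absz match x with Gp k | Gm k => k | _ => 0 end).-1.
Definition is_Gp (x : ns2_gen) : bool := if x is Gp _ then true else false.
Definition is_Gm (x : ns2_gen) : bool := if x is Gm _ then true else false.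

Lemma normal_odd_uniq w (P : pred ns2_gen) : (forall x, P x -> ns2_parity x) -> normal w ->
  uniq [seq x <- w | P x].
Proof.
move=> HP; elim: w => //= x w IH Hw; have /andP[_ Hw'] := Hw.
case: ifP => Px /=; last exact: IH.
rewrite IH // andbT mem_filter Px /=; apply/negP => xw.
have := normal_head (w := w) (x := x) Hw xw.
by rewrite ltnn eqxx HP.
Qed.

Lemma distinct_odd_extremal (s : seq nat) : uniq s ->
  (\sum_(i <- s) (2 * i + 1) <= size s ^ 2)%N -> perm_eq s (iota 0 (size s)).
Proof.
move=> Us Hs; apply: uniq_perm => //; first exact: iota_uniq.
have sub : {subset s <= iota 0 (size s)}.
  move=> m Hm; rewrite mem_iota /=; have Hp := perm_to_rem Hm.
  have Ur : uniq (rem m s) by apply: rem_uniq.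
  have := @sum_distinct_odd (\max_(i <- rem m s) i).+1 _ Ur.
  move: Hs; rewrite (perm_big _ Hp) /= big_cons (perm_size Hp) /=.
  move=> H1 H2; have {H2} := H2 _; move: H1.
  have -> : all (fun i => (i < (\max_(i <- rem m s) i).+1)%N) (rem m s).
    by apply/allP => i Hi; rewrite ltnS; apply: leq_bigmax_seq.
  move: (size _) (\sum_(_ <- _) _)%N => x y H1 /(_ isT) H2; nia.
by have [] := uniq_min_size Us sub; rewrite ?size_iota.
Qed.

(** The G^+ letters of a normal word are distinct, and so are the G^- letters; n distinct odd
    numbers add up to at least n^2, with equality only for 1, 3, .., 2n - 1. Here nA and nB count
    the two kinds and 2e is the excess. *)
Lemma wt_word w : normal w -> exists nA nB e : nat,
  [/\ wtj w = nB%:Z - nA%:Z,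
      wtl w = (nA ^ 2 + nB ^ 2 + 2 * e)%N,
      (Gp (-1) \notin w -> (nA <= e)%N) &
      (nA = 0 -> e = 0 -> perm_eq w [seq Gm (- (i.+1)%:Z) | i <- iota 0 nB])%N].
Proof.
move=> Hw; have Hlow := normal_lower Hw.
pose sA := [seq x <- w | is_Gp x]; pose sB := [seq x <- w | is_Gm x].
pose E := \sum_(x <- w) (if ns2_parity x then 0 else absz (dl x))%N.
have HE : exists e0, E = (2 * e0)%N.
  rewrite /E; elim: w {Hw Hlow sA sB E} => [|x w [e0 IH]]; first by exists 0%N; rewrite big_nil.
  rewrite big_cons IH; exists (e0 + absz (match x with Ln n | Jn n => n | _ => 0 end))%N.
  by case: x => [n|n||n|n] /=; lia.
have HJ : wtj w = (size sB)%:Z - (size sA)%:Z.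
  rewrite /wtj /sA /sB; elim: w {Hw Hlow sA sB E HE} => [|x w IH]; first by rewrite big_nil.
  by rewrite big_cons IH; case: x => [n|n||n|n] /=; lia.
have HL : wtl w = (E + \sum_(x <- sA) (2 * odd_index x + 1) + \sum_(x <- sB) (2 * odd_index x + 1))%N.
  rewrite /wtl /sA /sB /E; elim: w Hlow {Hw sA sB E HE HJ} => [|x w IH]; first by rewrite !big_nil.
  case/andP=> Hx /IH Hw; rewrite !big_cons Hw /=.
  case: x Hx => [n|n||n|n] //= Hx; rewrite ?big_cons /odd_index /=;
  by move: (\sum_(_ <- _) _)%N (\sum_(_ <- _) _)%N (\sum_(_ <- _) _)%N => u v t; lia.
have idx (P : pred ns2_gen) (s := [seq x <- w | P x]) :
    (forall x, P x -> ns2_parity x) ->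
    (forall x y, P x -> P y -> lower x -> lower y -> odd_index x = odd_index y -> x = y) ->
    uniq [seq odd_index x | x <- s].
  move=> HP Hinj; rewrite map_inj_in_uniq; first exact: normal_odd_uniq.
  move=> x y; rewrite !mem_filter => /andP[Px xw] /andP[Py yw].
  by apply: Hinj => //; apply: (allP Hlow).
have bound (s : seq nat) : uniq s -> ((size s) ^ 2 <= \sum_(i <- s) (2 * i + 1))%N.
  move=> Us; apply: (@sum_distinct_odd (\max_(i <- s) i).+1) => //.
  by apply/allP => i Hi; rewrite ltnS; apply: leq_bigmax_seq.
have injA x y : is_Gp x -> is_Gp y -> lower x -> lower y -> odd_index x = odd_index y -> x = y.
  by case: x => // n; case: y => // m _ _ /=; rewrite /odd_index => ? ? ?; congr Gp; lia.
have injB x y : is_Gm x -> is_Gm y -> lower x -> lower y -> odd_index x = odd_index y -> x = y.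
  by case: x => // n; case: y => // m _ _ /=; rewrite /odd_index => ? ? ?; congr Gm; lia.
have parA x : is_Gp x -> ns2_parity x by case: x.
have parB x : is_Gm x -> ns2_parity x by case: x.
have bA := bound _ (idx _ parA injA); have bB := bound _ (idx _ parB injB).
rewrite !size_map !big_map -/sA -/sB in bA bB.
have par (s : seq ns2_gen) : exists e0, (\sum_(x <- s) (2 * odd_index x + 1) = size s + 2 * e0)%N.
  elim: s => [|x s [e0 IH]]; first by exists 0%N; rewrite big_nil.
  by exists (odd_index x + e0)%N; rewrite big_cons IH /=; lia.
have [e0 He0] := HE; have [eA HeA] := par sA; have [eB HeB] := par sB.
have sq n : exists e1, (n ^ 2 = n + 2 * e1)%N.
  elim: n => [|n [e1 IH]]; first by exists 0%N.
  by exists (e1 + n)%N; lia.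
have [fA HfA] := sq (size sA); have [fB HfB] := sq (size sB).
(* Without [Gp (-1)] the odd numbers of the G^+ letters start at 3, so they remain distinct odd
   numbers after subtracting 2 from each. *)
have bA' : Gp (-1) \notin w -> ((size sA) ^ 2 + 2 * size sA <= \sum_(x <- sA) (2 * odd_index x + 1))%N.
  move=> nw.
  have Hpos x : x \in sA -> (0 < odd_index x)%N.
    rewrite mem_filter => /andP[Px xw]; case: x Px xw => // n _ xw.
    have /= := allP Hlow _ xw; rewrite /odd_index; have : n != -1 by apply: contraNneq nw => <-.
    by lia.
  have := bound [seq (odd_index x).-1 | x <- sA].
  rewrite size_map big_map => H.
  have -> : (\sum_(x <- sA) (2 * odd_index x + 1) = \sum_(x <- sA) (2 * (odd_index x).-1 + 1) + 2 * size sA)%N.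
    elim: (sA) Hpos {H} => [|x s IH] Hpos; first by rewrite !big_nil.
    rewrite !big_cons IH => [|y Hy]; last by apply: Hpos; rewrite inE Hy orbT.
    by have := Hpos x (mem_head _ _) => /=; lia.
  rewrite leq_add2r; apply: H; rewrite map_inj_in_uniq; first exact: normal_odd_uniq.
  move=> x y Hx Hy E2; have := Hpos x Hx; have := Hpos y Hy.
  move: Hx Hy; rewrite !mem_filter => /andP[Px xw] /andP[Py yw] ? ?.
  by apply: injA => //; [exact: (allP Hlow)|exact: (allP Hlow)|lia].
exists (size sA), (size sB), (e0 + (eA - fA) + (eB - fB))%N; split=> //.
- by rewrite HL; lia.
- by move=> /bA'; lia.
move=> /size0nil EA He; have e00 : e0 = 0%N by lia.
have allB : all is_Gm w.
  apply/allP => x xw; have := allP Hlow _ xw; have := mem_filter is_Gp x w.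
  rewrite -/sA EA xw andbT.
  have : (ns2_parity x || (absz (dl x) == 0))%N.
    have : (E == 0)%N by lia.
    rewrite /E (big_rem x xw) /= addn_eq0 => /andP[+ _].
    by case: (ns2_parity x).
  case: x {xw} => [n|n||n|n] //=; lia.
have EB : sB = w by apply/all_filterP.
have EoB : map odd_index w = [seq odd_index x | x <- sB] by rewrite EB.
have Ew : w = [seq Gm (- (i.+1)%:Z) | i <- map odd_index w].
  rewrite -map_comp -[LHS]map_id; apply/eq_in_map => x xw.
  have := allP Hlow _ xw; have := allP allB _ xw.
  by case: x {xw} => // n _ /= Hn; congr Gm; rewrite /odd_index; lia.
rewrite {1}Ew; apply: perm_map; rewrite EB -(size_map odd_index w).
apply: distinct_odd_extremal; first by rewrite EoB; exact: idx parB injB.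
by rewrite big_map size_map; rewrite EB in HeB HfB bB; lia.
Qed.
End WordBounds.

Section TopBounds.
Variables (K : numFieldType) (N : rep K) (h q c : K) (w0 : N).
Hypothesis Hw0 : hwv h q c w0.

Lemma wev_rcons (v : N) w x : wev v (rcons w x) = wev (ract x v) w.
Proof. by rewrite /wev foldr_rcons. Qed.

Lemma normal_last w : normal w -> Gp (-1) \in w -> exists w', w = rcons w' (Gp (-1)).
Proof.
elim: w => // x w IH Hw; rewrite inE => /orP[/eqP E|xw].
  subst x; exists [::]; case: w Hw {IH} => // y w Hw.
  have := normal_head Hw (mem_head y w); rewrite {1 2}/key eqxx ltn0 /=.
  by rewrite andbF.
have [|w' E] := IH _ xw; first by case/andP: Hw.
by exists (x :: w'); rewrite E.
Qed.

Lemma wt_basis_nz j l (u : N) : gen (eq w0) u -> wt h q j l u -> u <> 0 ->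
  exists2 w, w \in basis j l & wev w0 w <> 0.
Proof.
move=> Hgen Hu u0.
have [m Em] := mev_gen (hwv_lower Hw0) Hgen.
have E0 : u - mev w0 m = 0 by rewrite -Em subrr.
have := wt_proj (@sub_zero K N) (hwv_wt Hw0) Hu E0.
rewrite mev_bpart => /eqP; rewrite subr_eq0 => /eqP Eu.
have [//|H] := pselect (exists2 w, w \in basis j l & wev w0 w <> 0).
case: u0; rewrite Eu big_seq big1 // => w Hw.
have [->|E] := pselect (wev w0 w = 0); first by rewrite scaler0.
by case: H; exists w.
Qed.

(** A word ending in [Gp (-1)] kills [w0]. For the others nA <= e, and nA^2 + nB^2 = (nB - nA)^2 + 2
    nA nB gives the bound. *)
Lemma weight_bound_top j l (u : N) : gen (eq w0) u -> ract (Gp (-1)) w0 = 0 -> wt h q j l u -> u <> 0 ->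
  exists n : nat, l = j * j + (2 * n)%N%:Z /\ (- j <= n%:Z).
Proof.
move=> Hg Htop Hu u0; have [w Hw nz] := wt_basis_nz Hg Hu u0.
move: Hw; rewrite mem_basis => /and3P[Hw /eqP <- /eqP <-].
have [nA [nB [e [-> -> He _]]]] := wt_word Hw.
have ne : (nA <= e)%N.
  apply: He; apply/negP => /(normal_last Hw) [w' E]; apply: nz.
  by rewrite E wev_rcons Htop wev0.
by exists (nA * nB + e)%N; split; nia.
Qed.

Lemma central_gen (u : N) : gen (eq w0) u -> ract Cc u = c *: u.
Proof.
move=> Hg; have [m ->] := mev_gen (hwv_lower Hw0) Hg.
rewrite mevE linear_sum scaler_sumr; apply: eq_bigr => w _; rewrite linearZ /= !scalerA mulrC.
rewrite -scalerA; congr (_ *: _); rewrite ?scalerA.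
elim: w => [|x w IH]; first by case: Hw0.
by rewrite /= central_act IH linearZ.
Qed.

(** Some weight component of u is non-zero, and it lies in S by [wt_split]. *)
Lemma sub_weight_vector (S : N -> Prop) u : gen (eq w0) u -> is_sub S -> S u -> u <> 0 ->
  exists j l v, [/\ wt h q j l v, S v & v <> 0].
Proof.
move=> Hg HS Su u0.
have [m Em] := mev_gen (hwv_lower Hw0) Hg.
pose W := [seq w <- pmap (@pickle_inv word) (iota 0 (size m)) | normal w].
pose s : seq ((int * int) * N) := [seq ((wtj w, wtl w), m`_(pickle w) *: wev w0 w) | w <- W].
have Es : \sum_(t <- s) t.2 = u by rewrite big_map big_filter -mevE.
have Hs : {in s, forall t, wt h q t.1.1 t.1.2 t.2}.
  move=> t /mapP [w _ ->]; have [H1 H2] := wt_wev w (hwv_wt Hw0).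
  by split; rewrite linearZ /= ?H1 ?H2 !scalerA mulrC.
have [[p np]|H] := pselect (exists p, \sum_(t <- s | t.1 == p) t.2 <> 0).
  exists p.1, p.2, (\sum_(t <- s | t.1 == p) t.2); split=> //.
    split; rewrite linear_sum scaler_sumr big_seq_cond [RHS]big_seq_cond;
    by apply: eq_bigr => t /andP[/Hs [H1 H2] /eqP <-].
  by apply: (@wt_split K N S HS h q s p Hs); rewrite Es.
case: u0; rewrite -Es.
have {}H p : \sum_(t <- s | t.1 == p) t.2 = 0.
  by case: (pselect (\sum_(t <- s | t.1 == p) t.2 = 0)) => // E; case: H; exists p.
have [n] := ubnP (size s); elim: n s H {Es Hs} => // n IH [|t s] H; first by rewrite big_nil.
rewrite ltnS /= => Hn; rewrite (bigID (fun t' => t'.1 == t.1)) /= H add0r.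
rewrite big_cons eqxx /= -big_filter; apply: IH => [p|]; last first.
  by rewrite size_filter; apply: leq_ltn_trans (count_size _ _) Hn.
rewrite big_filter_cond /=; have [->|np] := eqVneq p t.1.
  by rewrite big1 // => t' /andP[/negbTE ->].
have np' : (t.1 == p) = false by rewrite eq_sym; exact: negbTE.
have Hp := H p; rewrite big_cons np' in Hp; rewrite -[RHS]Hp.
by apply: eq_bigl => t'; case: (t'.1 =P p) => [->|]; rewrite ?andbF ?np.
Qed.
End TopBounds.

(** * Singular vectors along the spectral flow *)

Section Levels.
Variables (K : numFieldType) (a : K).
Implicit Types (N : rep K) (rho : K) (k n : int).

Definition cch : K := 3%:R * (1 - 2%:R * a).
(* [J_0] and [L_0] on the extremal vector of charge [- kap] of the module of   *)
(* type [rho], in the frame [flow kap].                                        *)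
Definition hh rho (kap : K) : K := a * ((rho - 1) * (kap + 2%:R^-1) - kap ^+ 2).
Definition qq rho (kap : K) : K := a * (rho - 1 - 2%:R * kap).
(** The scalar by which G^+ G^- acts between the frames k and k + 1 ([Sk_EF], [Sk_FE]): a string can
    break only where it vanishes. *)
Definition cc rho k n : K := 2%:R * a * (k%:~R + 1) * (rho - k%:~R - 1) + 2%:R * n%:~R.

(* Singular vectors of charge [- k] and level [n] for the positive part        *)
(* transported by the spectral flow [k].                                       *)
Definition Sk N rho k n (u : N) : Prop :=
  hwv (N := flow k N) (hh rho k%:~R + n%:~R) (qq rho k%:~R) cch u.
Definition Topk N rho k n (u : N) : Prop :=
  Sk rho k n u /\ ract (Gp (k - 1)) u = 0.

Lemma hwv_flow N l k k' h q c h' q' (u : N) : l + k = k' -> h = h' -> q = q' ->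
  hwv (N := flow l (flow k N)) h q c u -> hwv (N := flow k' N) h' q' c u.
Proof.
move=> <- <- <- [H1 H2 H3 H4]; split; rewrite -?flow_flow //.
by move=> x Hx; rewrite -flow_flow; exact: H1.
Qed.

Lemma Sk_up N rho k n (u : N) : Sk rho k n u ->
  Sk rho (k + 1) n (ract (Gm (- (k + 1))) u).
Proof.
move=> Hu; have := hwv_lower_string Hu.
rewrite flowGm (_ : -1 - k = - (k + 1)); last by lia.
apply: hwv_flow; first by lia.
- by rewrite /hh /qq /cch ?rmorphD /=; field.
- by rewrite /hh /qq /cch ?rmorphD /=; field.
Qed.

Lemma Sk_down N rho k n (u : N) : Sk rho (k + 1) n u ->
  Sk rho k n (ract (Gp k) u).
Proof.
move=> Hu; have := hwv_upper_string Hu.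
rewrite flowGp (_ : -1 + (k + 1) = k); last by lia.
apply: hwv_flow; first by lia.
- by rewrite /hh /qq /cch ?rmorphD /=; field.
- by rewrite /hh /qq /cch ?rmorphD /=; field.
Qed.

Lemma Sk_EF N rho k n (u : N) : Sk rho k n u ->
  ract (Gp k) (ract (Gm (- (k + 1))) u) = cc rho k n *: u.
Proof.
move=> /hwv_EF; rewrite flowGp flowGm add0r (_ : -1 - k = - (k + 1)); last by lia.
by move=> ->; congr (_ *: _); rewrite /cc /hh /qq; field.
Qed.

Lemma Sk_FE N rho k n (u : N) : Sk rho (k + 1) n u ->
  ract (Gm (- (k + 1))) (ract (Gp k) u) = cc rho k n *: u.
Proof.
move=> /hwv_FE; rewrite flowGp flowGm sub0r (_ : -1 + (k + 1) = k); last by lia.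
by move=> ->; congr (_ *: _); rewrite /cc /hh /qq rmorphD /=; field.
Qed.

Lemma Sk_wt N rho k n (u : N) : Sk rho k n u -> wt (hh rho 0) (qq rho 0) k (k * k + 2 * n) u.
Proof.
case=> _ HL HJ; rewrite flowC => HC; move: HL HJ; rewrite flowL flowJ HC => HL HJ.
have EJ : ract (Jn 0) u = (qq rho 0 - k%:~R) *: u.
  have -> : ract (Jn 0) u = (qq rho k%:~R - k%:~R / 3%:R * cch) *: u.
    by rewrite scalerBl -HJ eqxx; lmod.
  by congr (_ *: _); rewrite /qq /cch; field.
split=> //.
have -> : ract (Ln 0) u = (hh rho k%:~R + n%:~R - k%:~R * (qq rho 0 - k%:~R)
   - k%:~R ^+ 2 / 6%:R * cch) *: u.
  by rewrite !scalerBl -HL EJ eqxx; lmod.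
by congr (_ *: _); rewrite /hh /qq /cch rmorphD !rmorphM /=; field.
Qed.

Definition topmod N rho (w : N) : Prop :=
  [/\ hwv (hh rho 0) (qq rho 0) cch w, ract (Gp (-1)) w = 0 & forall u, gen (eq w) u].

Section InTop.
Variables (N : rep K) (rho : K) (w : N).
Hypothesis HN : topmod rho w.

Lemma Sk_bound k n (u : N) : Sk rho k n u -> u <> 0 -> 0 <= n /\ - k <= n.
Proof.
case: HN => H1 H2 H3 /Sk_wt Hu u0.
by have [m [E Hm]] := weight_bound_top H1 (H3 u) H2 Hu u0; lia.
Qed.

(* Lowering [k] along a string stops, as [- n <= k].                           *)
Lemma Sk_descend (S : N -> Prop) k n (u : N) : is_sub S -> S u ->
  Sk rho k n u -> u <> 0 ->
  exists k0 z, [/\ k0 <= k, Topk rho k0 n z, S z & z <> 0].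
Proof.
move=> HS Su Hu u0; have [n0 Hkn] := Sk_bound Hu u0.
have [d] : exists d : nat, k = d%:Z - n by exists (absz (n + k)); lia.
elim: d k u Su Hu u0 {Hkn} => [|d IH] k u Su Hu u0 Ek.
  exists k, u; split=> //; split=> //.
  have [//|E0] := pselect (ract (Gp (k - 1)) u = 0).
  have Hu' : Sk rho (k - 1 + 1) n u by rewrite subrK.
  by have [] := Sk_bound (Sk_down Hu') E0; lia.
have [E0|E0] := pselect (ract (Gp (k - 1)) u = 0); first by exists k, u; split.
have Hu' : Sk rho (k - 1 + 1) n u by rewrite subrK.
have [|k0 [z [le Hz Sz z0]]] := IH (k - 1) _ (sub_act HS (Gp (k - 1)) Su) (Sk_down Hu') E0.
  by lia.
by exists k0, z; split=> //; lia.
Qed.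
End InTop.

(** Going down kills z, while going down and up again multiplies it by this scalar. *)
Lemma Topk_root N rho k n (z : N) : Topk rho k n z -> z <> 0 -> cc rho (k - 1) n = 0.
Proof.
case=> Hz E0 z0; have Hz' : Sk rho (k - 1 + 1) n z by rewrite subrK.
have := Sk_FE Hz'; rewrite E0 linear0 => /esym/eqP; rewrite scaler_eq0 => /orP[/eqP //|/eqP //].
Qed.

Definition nz N (P : N -> Prop) : Prop := exists2 u, P u & u <> 0.
Definition line N (P : N -> Prop) : Prop :=
  exists u, [/\ P u, u <> 0 & forall u', P u' -> exists t : K, u' = t *: u].

Section Transport.
Variables (N : rep K) (P Q : N -> Prop) (F E : {linear N -> N}) (t : K).
Hypothesis t0 : t != 0.
Hypothesis PF : forall u, P u -> Q (F u).
Hypothesis QE : forall u, Q u -> P (E u).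
Hypothesis EF : forall u, P u -> E (F u) = t *: u.
Hypothesis FE : forall u, Q u -> F (E u) = t *: u.

Lemma transport_nz : nz P -> nz Q.
Proof.
case=> u Pu u0; exists (F u); first exact: PF.
move=> F0; apply: u0; have := EF Pu; rewrite F0 linear0 => /esym/eqP.
by rewrite scaler_eq0 (negbTE t0) => /eqP.
Qed.

Lemma transport_line : line P -> line Q.
Proof.
case=> u [Pu u0 Hl]; exists (F u); split=> [||v Qv].
- exact: PF.
- move=> F0; apply: u0; have := EF Pu; rewrite F0 linear0 => /esym/eqP.
  by rewrite scaler_eq0 (negbTE t0) => /eqP.
- have [s Es] := Hl _ (QE Qv); exists (t^-1 * s).
  have := FE Qv; rewrite Es linearZ /= -scalerA => ->.
  by rewrite scalerA mulVf // scale1r.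
Qed.
End Transport.

Lemma Sk_nz_step N rho k n : cc rho k n != 0 ->
  nz (@Sk N rho k n) <-> nz (@Sk N rho (k + 1) n).
Proof.
move=> c0; split.
- apply: (@transport_nz N _ _ (ract (Gm (- (k + 1)))) (ract (Gp k)) _ c0).
  + exact: Sk_up. + exact: Sk_EF.
- apply: (@transport_nz N _ _ (ract (Gp k)) (ract (Gm (- (k + 1)))) _ c0).
  + exact: Sk_down. + exact: Sk_FE.
Qed.

Lemma Sk_line_step N rho k n : cc rho k n != 0 ->
  line (@Sk N rho k n) <-> line (@Sk N rho (k + 1) n).
Proof.
move=> c0; split.
- apply: (@transport_line N _ _ (ract (Gm (- (k + 1)))) (ract (Gp k)) _ c0).
  + exact: Sk_up. + exact: Sk_down. + exact: Sk_EF. + exact: Sk_FE.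
- apply: (@transport_line N _ _ (ract (Gp k)) (ract (Gm (- (k + 1)))) _ c0).
  + exact: Sk_down. + exact: Sk_up. + exact: Sk_FE. + exact: Sk_EF.
Qed.

Lemma Sk_nz_iter N rho k n (d : nat) : (forall j : int, k <= j < k + d%:Z -> cc rho j n != 0) ->
  nz (@Sk N rho k n) <-> nz (@Sk N rho (k + d%:Z) n).
Proof.
elim: d => [|d IH] H; first by rewrite addr0.
rewrite IH => [|j Hj]; last by apply: H; lia.
rewrite Sk_nz_step; last by apply: H; lia.
by rewrite (_ : k + d%:Z + 1 = k + d.+1%:Z) //; lia.
Qed.

Lemma Sk_line_iter N rho k n (d : nat) : (forall j : int, k <= j < k + d%:Z -> cc rho j n != 0) ->
  line (@Sk N rho k n) <-> line (@Sk N rho (k + d%:Z) n).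
Proof.
elim: d => [|d IH] H; first by rewrite addr0.
rewrite IH => [|j Hj]; last by apply: H; lia.
rewrite Sk_line_step; last by apply: H; lia.
by rewrite (_ : k + d%:Z + 1 = k + d.+1%:Z) //; lia.
Qed.

Hypothesis a0 : a != 0.

Lemma cc_roots rho k n k' : cc rho (k - 1) n = 0 ->
  cc rho (k' - 1) n = 2%:R * a * (k'%:~R - k%:~R) * (rho - k%:~R - k'%:~R).
Proof.
move=> E; rewrite -[LHS]subr0 -E /cc !rmorphB /=; ring.
Qed.

Lemma cc_neq0 rho k n k' : cc rho (k - 1) n = 0 -> k' != k -> rho != (k + k')%:~R ->
  cc rho (k' - 1) n != 0.
Proof.
move=> /cc_roots -> kk' Hr.
have a2 : 2%:R * a != 0 by rewrite mulf_neq0 // pnatr_eq0.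
rewrite mulf_neq0 //; first by rewrite mulf_neq0 // subr_eq0 eqr_int.
by rewrite -addrA -opprD subr_eq0 -rmorphD.
Qed.

(** The second root rho - k0 is not an integer up to k. So no string begins below k0, which makes
    [Topk] and [Sk] agree at k0, and the steps from k0 to k are invertible. *)
Lemma Topk_stable N rho k0 n k : (forall i : int, i <= k -> rho != (k0 + i)%:~R) ->
  forall w, @topmod N rho w -> cc rho (k0 - 1) n = 0 -> k0 <= k ->
  (nz (@Topk N rho k0 n) <-> nz (@Sk N rho k n)) /\
  (line (@Topk N rho k0 n) <-> line (@Sk N rho k n)).
Proof.
move=> Hr w HN Hroot le_k.
have ET : @Topk N rho k0 n = @Sk N rho k0 n.
  apply: funext => z; apply: propext; split=> [[]//|Hz]; split=> //.
  have [//|E0] := pselect (ract (Gp (k0 - 1)) z = 0).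
  have Hz' : Sk rho (k0 - 1 + 1) n z by rewrite subrK.
  have [//|k1 [y [le1 Hy _ y0]]] := Sk_descend HN (S := fun _ => True) _ I (Sk_down Hz') E0.
  have := Topk_root Hy y0; have k10 : k1 != k0 by lia.
  by move/eqP; rewrite (negbTE (cc_neq0 Hroot k10 (Hr _ _))) //; lia.
have Hcc (j : int) : k0 <= j < k0 + (absz (k - k0))%:Z -> cc rho j n != 0.
  move=> Hj; have -> : j = (j + 1) - 1 by lia.
  by apply: (cc_neq0 Hroot); [lia | apply: Hr; lia].
have Ek : k = k0 + (absz (k - k0))%:Z by lia.
by rewrite ET Ek; split; [exact: Sk_nz_iter | exact: Sk_line_iter].
Qed.
End Levels.

(** * Comparison with Verma modules in a far frame *)

Section MevMap.
Variable K : numFieldType.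

Lemma wev_hom (N1 N2 : rep K) (f : {linear N1 -> N2}) v w : hom f ->
  f (wev v w) = wev (f v) w.
Proof. by move=> hf; elim: w => //= x w <-; rewrite hf. Qed.

Lemma mev_map (N1 N2 : rep K) (f : {linear N1 -> N2}) v m : hom f ->
  f (mev v m) = mev (f v) m.
Proof.
move=> hf; rewrite !mevE linear_sum; apply: eq_bigr => w _.
by rewrite linearZ /= wev_hom.
Qed.

Lemma mevZ (N : rep K) (v : N) k m : mev (k *: v) m = k *: mev v m.
Proof.
rewrite !mevE scaler_sumr; apply: eq_bigr => w _; rewrite scalerA mulrC -scalerA.
by congr (_ *: _); elim: w => //= x w ->; rewrite linearZ.
Qed.

Lemma wev_gen (N : rep K) (A : N -> Prop) v w : A v -> gen A (wev v w).
Proof.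
by move=> Av; elim: w => [|x w IH] /=; [exact: gen_in | exact: (sub_act (@gen_sub _ _ _))].
Qed.

Lemma mev_in_gen (N : rep K) (A : N -> Prop) v m : A v -> gen A (mev v m).
Proof.
move=> Av; rewrite mevE; apply: (sub_sum (gen_sub A)) => w _.
by apply: (subZ (gen_sub A)); exact: wev_gen.
Qed.

Lemma hom_gen (N1 N2 : rep K) (f : {linear N1 -> N2}) v u : hom f ->
  gen (eq v) u -> gen (eq (f v)) (f u).
Proof.
move=> hf Hu; apply: (Hu (fun u => gen (eq (f v)) (f u))) => [|_ <-].
  exact: (hom_preim hf (@gen_sub _ _ _)).
exact: gen_in.
Qed.

Lemma gen_hom (N1 N2 : rep K) (f : {linear N1 -> N2}) v u : hom f ->
  gen (eq (f v)) u -> exists2 u', gen (eq v) u' & f u' = u.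
Proof.
move=> hf Hu; apply: (Hu (fun u => exists2 u', gen (eq v) u' & f u' = u)) => [|_ <-]; first exact: (hom_img hf (@gen_sub _ _ _)).
by exists v => //; exact: gen_in.
Qed.

Lemma flow_hom (N1 N2 : rep K) (f : {linear N1 -> N2}) k :
  hom f -> @hom K (flow k N1) (flow k N2) f.
Proof.
by move=> hf x u; rewrite [LHS]lcomb_linear; apply: eq_lcomb => t _; rewrite hf.
Qed.

Lemma flow_is_sub (N : rep K) k (S : N -> Prop) : is_sub S -> @is_sub K (flow k N) S.
Proof.
move=> HS; split; [exact: sub0 HS | exact: subZD HS | move=> x u Su].
by apply: (sub_lcomb HS) => y; exact: sub_act.
Qed.

Lemma is_sub_flow (N : rep K) k (S : N -> Prop) : @is_sub K (flow k N) S -> is_sub S.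
Proof.
move=> /(@flow_is_sub (flow k N) (- k)) HS.
split; [exact: sub0 HS | exact: subZD HS | move=> x u Su].
rewrite -flow0 -(addNr k) -flow_flow; exact: (sub_act HS).
Qed.

Lemma gen_to_flow (N : rep K) k (v u : N) : gen (eq v) u -> @gen K (flow k N) (eq v) u.
Proof. by move=> H S HS; apply: H; exact: is_sub_flow HS. Qed.

Lemma gen_trans (N : rep K) (u v t : N) : gen (eq u) v -> gen (eq v) t -> gen (eq u) t.
Proof. by move=> Huv Ht; apply: (Ht _ (@gen_sub _ _ _)) => _ <-. Qed.
End MevMap.

Section FlowStrings.
Variables (K : numFieldType) (a : K).
Implicit Types (N : rep K) (rho : K) (k n : int).

Lemma flow_wt N rho k j l (u : N) : ract Cc u = cch a *: u ->
  @wt K (flow k N) (hh a rho k%:~R) (qq a rho k%:~R) j l u ->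
  wt (hh a rho 0) (qq a rho 0) (j + k) (l + 2 * j * k + k * k) u.
Proof.
move=> HC [HJ HL]; rewrite flowL HC /= in HL; rewrite flowJ HC /= in HJ.
have EJ : ract (Jn 0) u = (qq a rho 0 - (j + k)%:~R) *: u.
  have -> : ract (Jn 0) u = (qq a rho k%:~R - j%:~R - k%:~R / 3%:R * cch a) *: u.
    by rewrite scalerBl -HJ; lmod.
  by congr (_ *: _); rewrite /qq /cch rmorphD /=; field.
split=> //.
have -> : ract (Ln 0) u = (hh a rho k%:~R + l%:~R / 2%:R - k%:~R * (qq a rho 0 - (j + k)%:~R)
   - k%:~R ^+ 2 / 6%:R * cch a) *: u.
  by rewrite !scalerBl -HL EJ; lmod.
by congr (_ *: _); rewrite /hh /qq /cch !rmorphD !rmorphM /=; field.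
Qed.

Lemma hwv_Sk0 N rho (u : N) : hwv (hh a rho 0) (qq a rho 0) (cch a) u <-> Sk a rho 0 0 u.
Proof.
rewrite /Sk addr0; split=> -[H1 H2 H3 H4].
  by split=> [x Hx|||]; rewrite flow0 //; exact: H1.
by split=> [x Hx|||]; rewrite -flow0 //; exact: H1.
Qed.

Lemma Sk_hom N1 N2 (f : {linear N1 -> N2}) rho k n u : hom f ->
  Sk a rho k n u -> Sk a rho k n (f u).
Proof.
move=> Hf; have hf := flow_hom (k := k) Hf; case=> H1 H2 H3 H4; split=> [x Hx|||].
- by rewrite -(hf x u) H1 // linear0.
- by rewrite -(hf _ u) H2 linearZ.
- by rewrite -(hf _ u) H3 linearZ.
- by rewrite -(hf _ u) H4 linearZ.
Qed.

Fixpoint str N (k : int) (i : nat) (u : N) : N :=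
  if i is i'.+1 then ract (Gm (- (k + i'%:Z + 1))) (str k i' u) else u.

Lemma Sk_str N rho k n i (u : N) : Sk a rho k n u -> Sk a rho (k + i%:Z) n (str k i u).
Proof.
move=> Hu; elim: i => [|i IH] /=; first by rewrite addr0.
by rewrite -[i.+1]addn1 PoszD addrA; exact: Sk_up.
Qed.

Lemma str_hom N1 N2 (f : {linear N1 -> N2}) k i u : hom f -> f (str k i u) = str k i (f u).
Proof. by move=> hf; elim: i => //= i <-; rewrite hf. Qed.

Lemma gen_str N k i (u : N) : gen (eq u) (str k i u).
Proof.
by elim: i => [|i IH] /=; [exact: gen_in | exact: (sub_act (@gen_sub _ _ _))].
Qed.

(** Each step of the string is undone by G^+ up to a non-zero scalar. *)
Lemma str_gen N rho k n i (u : N) : (forall j : int, k <= j < k + i%:Z -> cc a rho j n != 0) ->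
  Sk a rho k n u -> gen (eq (str k i u)) u.
Proof.
elim: i => [|i IH] Hc Hu; first exact: gen_in.
apply: (gen_trans (v := str k i u)); last first.
  by apply: IH => // j Hj; apply: Hc; lia.
have c0 : cc a rho (k + i%:Z) n != 0 by apply: Hc; lia.
rewrite -[X in gen _ X](scalerK c0) -(Sk_EF (Sk_str i Hu)).
exact: (subZ (@gen_sub _ _ _) _ (sub_act (@gen_sub _ _ _) _ (gen_in erefl))).
Qed.

Lemma str_inv N rho n i (u : N) : (forall j : int, 0 <= j < i%:Z -> cc a rho j n != 0) ->
  Sk a rho i%:Z n u ->
  exists x t, [/\ Sk a rho 0 n x, t != 0 & str 0 i x = t *: u].
Proof.
elim: i u => [|i IH] u Hc Hu; first by exists u, 1; rewrite oner_eq0 scale1r.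
have Hu' : Sk a rho (i%:Z + 1) n u by move: Hu; rewrite -addn1 PoszD.
have [|x [t [Hx t0 E]]] := IH _ _ (Sk_down Hu'); first by move=> j Hj; apply: Hc; lia.
exists x, (t * cc a rho i n); split=> //; first by rewrite mulf_neq0 //; apply: Hc; lia.
by rewrite /= E linearZ /= add0r (Sk_FE Hu') scalerA.
Qed.

End FlowStrings.

Section NormalParts.
Variables (K : numFieldType) (h q c : K).
Let V := verma h q c.

Lemma Mwt_normal j l (m : {poly K}) : Mwt j l m -> inspan (fun w => normal w) m.
Proof. by move=> ->; exact: bpart_normal. Qed.

Lemma Mwt_bpart j l (m : {poly K}) : Mwt j l (bpart j l m).
Proof. by rewrite /bpart -covK; exact: Mwt_tov. Qed.

(** The span of normal words is the genuine Verma module inside {poly K}; the remaining monomials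
    are killed by every generator. *)
Lemma normal_sub : @is_sub K V (inspan (fun w => normal w)).
Proof.
by split; [exact: inspan0 | move=> k u v; exact: inspanZD | move=> x u; exact: normal_act].
Qed.

Lemma KD_normal D m : KD h q c D m -> inspan (fun w => normal w) m.
Proof.
elim: D m => [|n D IH] m; first by move=> ->; exact: inspan0.
apply: gen_min; first exact: normal_sub.
by move=> m' [/IH //|[/Mwt_normal]].
Qed.

Lemma sub_bpart (S : V -> Prop) j l m : is_sub S -> inspan (fun w => normal w) m ->
  S m -> S (bpart j l m).
Proof.
move=> HS Hm Sm.
have W0 : @wt K V h q j l 0 by split; rewrite linear0 scaler0.
have H0 : S (0 - mev (vgen h q c) m) by rewrite mev_vgen // sub0r; exact: subN.
have := wt_proj HS (wt_vgen h q c) W0 H0.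
by rewrite mev_vgen ?sub0r; [move/(subN HS); rewrite opprK | exact: bpart_normal].
Qed.
End NormalParts.

Section Admissible.
Variables (K : numFieldType) (a : K).
Implicit Types (N : rep K) (rho : K).

Definition theta N (w : N) (k : nat) : {linear {poly K} -> N} :=
  @mev K (flow k N) (str 0 k w).

Notation VM rho k := (verma (hh a rho (Posz k)%:~R) (qq a rho (Posz k)%:~R) (cch a)).
Notation KDk rho k := (KD (hh a rho (Posz k)%:~R) (qq a rho (Posz k)%:~R) (cch a)).
Notation SGk rho k := (SG (hh a rho (Posz k)%:~R) (qq a rho (Posz k)%:~R) (cch a)).

(* For large [k] the singular vectors of the module [N] generated by [w] are   *)
(* read off from the Verma module of type [rho] at [k], where they form the    *)
(* iterated singular space [KD D] up to any given level.                       *)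
Definition adm rho (D : seq nat) N (w : N) : Prop :=
  forall n0 : nat, exists k1 : nat, forall k : nat, (k1 <= k)%N ->
    (forall m, KDk rho k D m -> theta w k m = 0) /\
    (forall j l m, -1 <= j -> Mwt j l m -> l - j * j <= (n0 * 2)%N%:Z ->
       theta w k m = 0 -> KDk rho k D m).

Section Theta.
Variables (N : rep K) (rho : K) (w : N).
Hypothesis Hw : Sk a rho 0 0 w.
Hypothesis Hr : forall i : int, rho != i%:~R.
Hypothesis a0 : a != 0.
Hypothesis Hgen : forall u, gen (eq w) u.

Lemma str_hwv (k : nat) : @hwv K (flow k N) (hh a rho k%:~R) (qq a rho k%:~R) (cch a) (str 0 k w).
Proof. by have := Sk_str k Hw; rewrite add0r /Sk addr0. Qed.

Lemma theta_hom (k : nat) : @hom K (VM rho k) (flow k N) (theta w k).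
Proof. by apply: mev_hom; apply: hwv_lower; exact: str_hwv. Qed.

Lemma cc0_neq0 (j : int) : 0 <= j -> cc a rho j 0 != 0.
Proof.
move=> Hj; rewrite /cc mulr0 addr0 mulf_neq0 //.
  rewrite !mulf_neq0 ?pnatr_eq0 //.
  by rewrite (_ : 1 = 1%:~R) // -rmorphD intr_eq0; lia.
by rewrite -addrA -opprD subr_eq0 (_ : _ + 1 = (j + 1)%:~R) // rmorphD.
Qed.

Lemma theta_wt (k : nat) j l m : Mwt j l m ->
  @wt K (flow k N) (hh a rho k%:~R) (qq a rho k%:~R) j l (theta w k m).
Proof.
move=> /(@Mwt_wt K (hh a rho k%:~R) (qq a rho k%:~R) (cch a)) [H1 H2].
by split; rewrite -(@theta_hom k) ?H1 ?H2 linearZ.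
Qed.

Lemma theta_Sk (k n : nat) m : Mwt 0 (n * 2)%N m ->
  (forall x, ns2_pos x -> theta w k (@ract K (VM rho k) x m) = 0) ->
  Sk a rho k n (theta w k m).
Proof.
move=> Hm Hpos; have [HJ HL] := theta_wt k Hm; split.
- by move=> x Hx; rewrite -(@theta_hom k) Hpos.
- by rewrite HL; congr (_ *: _); rewrite PoszM rmorphM /=; field.
- by rewrite HJ subr0.
- by rewrite -(@theta_hom k Cc) central_normal ?linearZ //; exact: Mwt_normal Hm.
Qed.

(** The string from w never breaks, as [cc rho j 0] has no root j >= 0; its k-th vector therefore
    generates the whole module. *)
Lemma theta_onto (k : nat) u : exists m, u = theta w k m.
Proof.
apply: (mev_gen (hwv_lower (str_hwv k))); apply: gen_to_flow.
apply: (gen_trans (v := w)) => //; apply: (str_gen _ Hw).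
by move=> j Hj; apply: cc0_neq0; lia.
Qed.

Lemma theta_proj (k : nat) j l u : @wt K (flow k N) (hh a rho k%:~R) (qq a rho k%:~R) j l u ->
  forall m, theta w k m = u -> theta w k (bpart j l m) = u.
Proof.
move=> Hu m E.
have E0 : u - @mev K (flow k N) (str 0 k w) m = 0 by rewrite -E subrr.
have := wt_proj (@sub_zero K (flow k N)) (hwv_wt (str_hwv k)) Hu E0.
by move/eqP; rewrite subr_eq0 => /eqP.
Qed.

Section Kernel.
Variables (D : seq nat) (k n : nat).
Hypothesis Hk1 : forall m, KDk rho k D m -> theta w k m = 0.
Hypothesis Hk2 : forall j l m, -1 <= j -> Mwt j l m -> l - j * j <= (n * 2)%N%:Z ->
       theta w k m = 0 -> KDk rho k D m.

Lemma SG_Sk m : SGk rho k D n m -> Sk a rho k n (theta w k m).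
Proof. by case=> Hm Hpos; apply: theta_Sk => // x Hx; apply: Hk1; exact: Hpos. Qed.

Lemma Sk_SG u : Sk a rho k n u -> exists2 m, SGk rho k D n m & theta w k m = u.
Proof.
move=> Hu; have [m0 E0] := theta_onto k u; have [Hpos HL HJ _] := Hu.
have Wu : @wt K (flow k N) (hh a rho k%:~R) (qq a rho k%:~R) 0 (n * 2)%N u.
  split; first by rewrite subr0.
  by rewrite HL; congr (_ *: _); rewrite PoszM rmorphM /=; field.
have E := theta_proj Wu (esym E0).
have Hm : Mwt 0 (n * 2)%N (bpart 0 (n * 2)%N m0).
  exact: Mwt_bpart.
exists (bpart 0 (n * 2)%N m0) => //; split=> //.
have H x : ns2_pos x -> (0 + dj x >= -1) ->
   (n * 2)%N%:Z + dl x - (0 + dj x) * (0 + dj x) <= (n * 2)%N ->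
   KDk rho k D (@ract K (VM rho k) x (bpart 0 (n * 2)%N m0)).
  move=> Hx Hj Hl; apply: (Hk2 Hj (Mwt_act (hh a rho k%:~R) (qq a rho k%:~R) (cch a) x Hm) Hl).
  by rewrite [LHS](@theta_hom k) E Hpos.
(* From charge 0 the generators G^+, G^- and J_1 lead to j = -1, 1, 0, whence the range - 1 <= j in
   [adm]; none of them raises l - j * j. *)
by apply: (pos_generators (@KD_sub K _ _ _ D)); apply: H => //=; lia.
Qed.

Lemma SG_ker m : SGk rho k D n m -> (KDk rho k D m <-> theta w k m = 0).
Proof.
case=> Hm _; split; first exact: Hk1.
by apply: Hk2 Hm _ => //; lia.
Qed.

Lemma sing_nz_Sk : sing_nz (cch a) (hh a rho k%:~R) (qq a rho k%:~R) D n <-> nz (@Sk K a N rho k n).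
Proof.
split=> [[m Hm nm]|[u /Sk_SG [m Hm <-] nu]].
  by exists (theta w k m); [exact: SG_Sk | rewrite -SG_ker].
by exists m => //; rewrite SG_ker.
Qed.

Lemma sing_line_Sk :
  sing_line (cch a) (hh a rho k%:~R) (qq a rho k%:~R) D n <-> line (@Sk K a N rho k n).
Proof.
split=> [[m [Hm nm Hl]]|[u [/Sk_SG [m Hm <-] nu Hl]]].
  exists (theta w k m); split; [exact: SG_Sk | by rewrite -SG_ker |].
  move=> _ /Sk_SG [m' Hm' <-]; have [t /Hk1] := Hl _ Hm'; exists t.
  by apply/eqP; rewrite -subr_eq0 -linearZ -linearB; apply/eqP.
exists m; split=> //; first by rewrite SG_ker.
move=> m' Hm'; have [t E] := Hl _ (SG_Sk Hm'); exists t.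
apply/SG_ker; last by rewrite linearB linearZ E /= subrr.
by rewrite addrC -scaleNr; apply: SGZD.
Qed.
End Kernel.
End Theta.
End Admissible.

(** * The reflection of rho to - rho, and passage to quotients *)

Section Transfer.
Variables (K : numFieldType) (a : K).
Hypothesis a0 : a != 0.
Implicit Types (N : rep K) (rho : K).

Lemma avoid (ex : seq K) (r : K) :
  exists k1 : nat, forall k : nat, (k1 <= k)%N -> (r + k%:~R) \notin ex.
Proof.
elim: ex => [|e ex [k1 H1]]; first by exists 0%N.
have [[k2 E2]|nE] := pselect (exists k2 : nat, r + k2%:~R = e).
  exists (maxn k1 k2.+1) => k; rewrite geq_max => /andP[/H1 Hk lt_k].
  rewrite inE negb_or Hk andbT -E2; apply/eqP => /addrI /eqP.
  by rewrite eqr_int; lia.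
exists k1 => k /H1 Hk; rewrite inE negb_or Hk andbT.
by apply/eqP => E; case: nE; exists k.
Qed.

Lemma topmod_Sk N rho (w : N) : topmod a rho w -> Sk a rho 0 0 w.
Proof. by case=> /hwv_Sk0. Qed.

(** Type - rho in the frame k' has the weights of the polynomial family of rho at rho + k' ([EH'],
    [EQ']). For large k and k' both parameters avoid the exceptional set of [generic_sing], so the
    two counts agree. *)
Lemma adm_reflect rho D N w N' w' n : (forall i : int, rho != i%:~R) ->
  @topmod K a N rho w -> adm a rho D w -> @topmod K a N' (- rho) w' -> adm a (- rho) D w' ->
  exists k1 : nat, forall k k' : nat, (k1 <= k)%N -> (k1 <= k')%N ->
    (nz (@Sk K a N rho k n%:Z) <-> nz (@Sk K a N' (- rho) k' n)) /\
    (line (@Sk K a N rho k n) <-> line (@Sk K a N' (- rho) k' n)).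
Proof.
move=> Hr HN HD HN' HD'.
have Hr' i : - rho != i%:~R by rewrite eqr_oppLR -rmorphN Hr.
pose H : {poly K} := a%:P * ((rho - 1)%:P * ('X + (2%:R^-1)%:P) - 'X ^+ 2).
pose Q : {poly K} := a%:P * ((rho - 1)%:P - (2%:R)%:P * 'X).
have EH k : H.[k] = hh a rho k by rewrite /H !hornerE.
have EQ k : Q.[k] = qq a rho k by rewrite /Q !hornerE.
have EH' k : hh a (- rho) k = H.[rho + k] by rewrite EH /hh; field.
have EQ' k : qq a (- rho) k = Q.[rho + k] by rewrite EQ /qq; ring.
have [ex Hex] := generic_sing (cch a) H Q D n.
have [k1 H1] := avoid ex 0; have [k2 H2] := avoid ex rho.
have [k3 H3] := HD n; have [k4 H4] := HD' n.
exists (maxn (maxn k1 k2) (maxn k3 k4)) => k k'.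
rewrite !geq_max => /andP[/andP[/H1 Hk1 _] /andP[/H3 [Hk3 Hk3'] _]].
move=> /andP[/andP[_ /H2 Hk2] /andP[_ /H4 [Hk4 Hk4']]].
have HG : forall u, gen (eq w) u by case: HN.
have HG' : forall u, gen (eq w') u by case: HN'.
rewrite -(sing_nz_Sk (topmod_Sk HN) Hr a0 HG Hk3 Hk3').
rewrite -(sing_line_Sk (topmod_Sk HN) Hr a0 HG Hk3 Hk3').
rewrite -(sing_nz_Sk (topmod_Sk HN') Hr' a0 HG' Hk4 Hk4').
rewrite -(sing_line_Sk (topmod_Sk HN') Hr' a0 HG' Hk4 Hk4').
rewrite EH' EQ' -EH -EQ; rewrite add0r in Hk1.
have [X1 X2] := Hex _ _ Hk1 Hk2; have [Y1 Y2] := Hex _ _ Hk2 Hk1.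
by split; split.
Qed.

(** [Topk_stable] moves both sides to a common far frame, where [adm_reflect] compares them; the
    root k of [cc] becomes - k. *)
Lemma Topk_reflect rho D N w N' w' (k : int) (n : nat) : (forall i : int, rho != i%:~R) ->
  @topmod K a N rho w -> adm a rho D w -> @topmod K a N' (- rho) w' -> adm a (- rho) D w' ->
  cc a rho (k - 1) n = 0 ->
  (nz (@Topk K a N rho k n) <-> nz (@Topk K a N' (- rho) (- k) n)) /\
  (line (@Topk K a N rho k n) <-> line (@Topk K a N' (- rho) (- k) n)).
Proof.
move=> Hr HN HD HN' HD' Hc.
have Hr' i : - rho != i%:~R by rewrite eqr_oppLR -rmorphN Hr.
have Hc' : cc a (- rho) (- k - 1) n = 0 by rewrite -Hc /cc !rmorphB rmorphN /=; ring.
have [k1 Hk] := adm_reflect n Hr HN HD HN' HD'.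
pose k2 := (k1 + absz k)%N; have le2 : (k1 <= k2)%N by rewrite leq_addr.
have [H1 H2] := Hk _ _ le2 le2.
have le_k : k <= k2 by rewrite /k2; lia.
have le_k' : - k <= k2 by rewrite /k2; lia.
have [-> ->] := Topk_stable a0 (fun i _ => Hr _) HN Hc le_k.
by have [-> ->] := Topk_stable a0 (fun i _ => Hr' _) HN' Hc' le_k'.
Qed.

Lemma theta_map N N' (g : {linear N -> N'}) (w : N) k m : hom g ->
  g (theta w k m) = theta (g w) k m.
Proof.
move=> hg; rewrite /theta -(str_hom 0 k w hg).
exact: (@mev_map K (flow k N) (flow k N') g _ _ (flow_hom hg)).
Qed.

(** In the frame k the string above z has reached charge 0: its vector is the image of one singular
    vector y modulo [KD D], unique up to scalar and generating the same submodule as z. Dividing by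
    z thus adjoins exactly level n to D. *)
Lemma adm_cons rho D N w N' (g : {linear N -> N'}) (k0 : int) (n : nat) (z : N) :
  (forall i : int, rho != i%:~R) -> topmod a rho w -> adm a rho D w -> hom g ->
  Topk a rho k0 n z -> z <> 0 ->
  (forall z', Topk a rho k0 n z' -> exists t : K, z' = t *: z) ->
  (forall u, g u = 0 <-> gen (eq z) u) -> adm a rho (n :: D) (g w).
Proof.
move=> Hr HN HD hg Hz z0 Hl Hker n0.
have HG : forall u, gen (eq w) u by case: HN.
have Hroot := Topk_root Hz z0.
have Hc i (j : int) : k0 <= j < k0 + i%:Z -> cc a rho j n != 0.
  move=> Hj; have -> : j = (j + 1) - 1 by lia.
  by apply: (cc_neq0 a0 Hroot) => //; lia.
have [k1 Hk1] := HD n; have [k2 Hk2] := HD n0.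
exists (maxn (maxn k1 k2) (absz k0)) => k; rewrite !geq_max => /andP[/andP[/Hk1 [H1 H1'] /Hk2 [_ H2]] lek].
have le_k : k0 <= k by lia.
pose i := absz (k%:Z - k0); have Ek : k0 + i%:Z = k by rewrite /i; lia.
have Hzk : Sk a rho k n (str k0 i z) by rewrite -Ek; apply: Sk_str; case: Hz.
have [y Hy Ey] := Sk_SG (topmod_Sk HN) Hr a0 HG H1' Hzk.
have Hgz : gen (eq (str k0 i z)) z by apply: (str_gen _ Hz.1); exact: Hc.
have HlS u : Sk a rho k n u -> exists t : K, u = t *: str k0 i z.
  have [_ [X _]] := Topk_stable a0 (fun i _ => Hr _) HN Hroot le_k.
  have [|y1 [Hy1 ny1 Hly1]] := X; first by exists z; split.
  move=> Hu; have [t1 E1] := Hly1 _ Hu; have [t2 E2] := Hly1 _ Hzk.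
  exists (t1 / t2); rewrite E1 E2 scalerA divfK //.
  apply/eqP => t20; rewrite t20 scale0r in E2; apply: z0.
  apply: (Hgz (fun u => u = 0)); first exact: sub_zero.
  by move=> _ <-.
split=> [m|j l m Hj Hm Hl' E].
  rewrite -(theta_map w k m hg) => Hm; apply/Hker.
  have hT := @theta_hom K a N rho w (topmod_Sk HN) k.
  have HS := @flow_is_sub K N k _ (@gen_sub K N (eq z)).
  apply: (Hm (fun m => gen (eq z) (theta w k m))).
    exact: (hom_preim hT HS).
  move=> m' [/H1 -> | Hm']; first exact: (sub0 (@gen_sub K N _)).
  have [t ->] := HlS _ (SG_Sk (topmod_Sk HN) H1 Hm').
  by apply: (subZ (@gen_sub K N _)); exact: gen_str.
rewrite -(theta_map w k m hg) in E; move/Hker: E => E.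
have {}E : @gen K (flow k N) (eq (theta w k y)) (theta w k m).
  by rewrite Ey; apply: gen_to_flow; exact: gen_trans Hgz E.
have hT := @theta_hom K a N rho w (topmod_Sk HN) k.
have [y' Hy' Ey'] := gen_hom hT E.
have HKy : KD (hh a rho k%:~R) (qq a rho k%:~R) (cch a) (n :: D) y' .
  by apply: (Hy' _ (KD_sub _ _ _ _)) => _ <-; exact: KD_SG.
have HKb := sub_bpart j l (KD_sub _ _ _ _) (KD_normal HKy) HKy.
rewrite -[m](subrK (bpart j l y')); apply: (subD (KD_sub _ _ _ _)) => //.
apply: KD_cons; apply: (H2 j l) => //.
  by have := MwtZD (-1) (@Mwt_bpart K j l y') Hm; rewrite scaleN1r addrC.
rewrite linearB /= (theta_proj (topmod_Sk HN) (theta_wt (topmod_Sk HN) k Hm) Ey').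
exact: subrr.
Qed.
End Transfer.

(** * Universal modules of type rho *)

Section TopModule.
Variables (K : numFieldType) (a : K).
Implicit Types (N : rep K) (rho : K).

Definition topvec N rho (w : N) : Prop :=
  hwv (hh a rho 0) (qq a rho 0) (cch a) w /\ ract (Gp (-1)) w = 0.
Definition universal N rho (w : N) : Prop :=
  forall N' (w' : N'), topvec rho w' -> exists f : {linear N -> N'}, hom f /\ f w = w'.

Lemma vgen_hwv (h q c : K) : hwv h q c (vgen h q c).
Proof.
split=> [x Hx|||]; rewrite vgen_lower //=.
- by case: x Hx => [n|n||n|n] //= Hx; rewrite ?scale0r //; case: eqP => [E|_];
    rewrite ?scale0r //; move: Hx; rewrite E.
- by case: x Hx => [n|n||n|n] //= Hx; lia.
Qed.

Lemma mev_vgen_id N (v : N) h q c : mev v (vgen h q c) = v.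
Proof. by rewrite /vgen mev_ew. Qed.

Section Verma.
Variable rho : K.
Let V0 := verma (hh a rho 0) (qq a rho 0) (cch a).
Let v0 : V0 := vgen (hh a rho 0) (qq a rho 0) (cch a).
Let e : V0 := ract (Gp (-1)) v0.

Lemma e_hwv : hwv (hh a rho 0 + 2%:R^-1) (qq a rho 0 + 1) (cch a) e.
Proof.
have H0 : hwv (hh a rho 0) (qq a rho 0) (cch a) v0 by exact: vgen_hwv.
have [Hpos HL HJ HC] := H0; have [WJ WL] := wt_act (Gp (-1)) (hwv_wt H0).
apply: hwv_pos_generators.
- by rewrite /e ract_comm lcomb_nil addr0 Hpos // linear0 scaler0.
- rewrite /e (hwv_FE H0) (_ : 2%:R * _ - _ = 0) ?scale0r //.
  by rewrite /hh /qq; field.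
- rewrite /e ract_comm (Hpos (Jn _)) // linear0 scaler0 add0r.
  by rewrite lcomb_cons lcomb_nil /= Hpos // scaler0 addr0.
- by rewrite WL; congr (_ *: _); rewrite /=; field.
- by rewrite WJ; congr (_ *: _); rewrite /=; ring.
- by rewrite /e central_act HC linearZ.
Qed.

(** e is a highest weight vector killed by G^+_{-1/2}, so [weight_bound_top] applies to it with
    shifted weights. In a frame of large charge its submodule begins at high level. *)
Lemma e_bound j l (y : V0) : gen (eq e) y -> wt (hh a rho 0) (qq a rho 0) j l y -> y <> 0 ->
  2 * j + 2 <= l - j * j.
Proof.
move=> Hy [HJ HL] y0.
have Hw : wt (hh a rho 0 + 2%:R^-1) (qq a rho 0 + 1) (j + 1) (l - 1) y.
  split; [rewrite HJ; congr (_ *: _) | rewrite HL; congr (_ *: _)].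
    by rewrite rmorphD /=; ring.
  by rewrite rmorphB /=; field.
have Ee : ract (Gp (-1)) e = 0 by rewrite /e ract_odd_square.
by have [n [E _]] := weight_bound_top e_hwv Hy Ee Hw y0; nia.
Qed.

Hypothesis a0 : a != 0.
Hypothesis Hr : forall i : int, rho != i%:~R.

(** An explicit left inverse: in the Verma module at k, flowed back, the generator is up to scalar
    the k-th string vector of some x ([str_inv]). Sending [v0] to x composes with [theta] to a
    non-zero multiple of the identity. *)
Lemma theta_verma_inj (k : nat) m : inspan (fun w => normal w) m -> theta v0 k m = 0 -> m = 0.
Proof.
move=> Hm E; pose h := hh a rho k%:~R; pose q := qq a rho k%:~R.
pose Vk := verma h q (cch a); pose N := flow (- k%:Z) Vk.
have EN x (u : N) : @ract K (flow k N) x u = @ract K Vk x u by rewrite flow_flow subrr flow0.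
have Hv : @Sk K a N rho k 0 (vgen h q (cch a)).
  have [H1 H2 H3 H4] := vgen_hwv h q (cch a); rewrite /Sk addr0.
  by split=> [x Hx|||]; rewrite EN //; exact: H1.
have [j Hj|x [t [Hx t0 Et]]] := str_inv _ Hv; first by apply: cc0_neq0 => //; lia.
have hpsi : @hom K V0 N (mev x) by apply/mev_hom/hwv_lower/hwv_Sk0.
have := theta_map v0 k m hpsi; rewrite E linear0 mev_vgen_id /theta Et mevZ.
have hid : @hom K (flow k N) Vk idfun by move=> y u; exact: EN.
have -> : @mev K (flow k N) (vgen h q (cch a)) m = m.
  by rewrite -[LHS]/(idfun _) (mev_map _ _ hid) mev_vgen.
by move/esym/eqP; rewrite scaler_eq0 (negbTE t0) => /eqP.
Qed.
End Verma.

Hypothesis a0 : a != 0.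

Lemma top_exists rho : exists N (w : N), [/\ topmod a rho w, universal rho w &
  (forall i : int, rho != i%:~R) -> adm a rho [::] w].
Proof.
pose V0 := verma (hh a rho 0) (qq a rho 0) (cch a).
pose v0 : V0 := vgen (hh a rho 0) (qq a rho 0) (cch a).
have Hv0 : hwv (hh a rho 0) (qq a rho 0) (cch a) v0 by exact: vgen_hwv.
pose e : V0 := ract (Gp (-1)) v0.
have hv : @hom K V0 V0 (mev v0) by apply/mev_hom/hwv_lower.
(* Pulling back along [mev v0] also divides out the monomials that are not normal words, so the
   quotient is generated by the image of [v0]. *)
pose S m := gen (eq e) (mev v0 m : V0).
have HS : @is_sub K V0 S by exact: (hom_preim hv (@gen_sub _ _ _)).
have [N [g [hg Hs Hk HU]]] := quotient_lift HS.
have Hmm (m : V0) : @mev K V0 v0 (mev v0 m) = mev v0 m.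
  by rewrite (mev_map v0 m hv) mev_vgen_id.
have Hw : topvec rho (g v0).
  split; last by rewrite -hg; apply/Hk; rewrite /S (hv _ v0) mev_vgen_id; exact: gen_in.
  have [H1 H2 H3 H4] := Hv0.
  split=> [x Hx|||]; rewrite -hg ?H2 ?H3 ?H4 ?linearZ //; by rewrite H1 ?linear0.
exists N; exists (g v0); split.
- have [H1 H2] := Hw; split=> [||u] //; have [m <-] := Hs u.
  have -> : g m = g (mev v0 m).
    apply/eqP; rewrite -subr_eq0 -linearB; apply/eqP/Hk.
    by rewrite /S linearB /= Hmm subrr; exact: (sub0 (@gen_sub _ _ _)).
  by apply: hom_gen => //; exact: mev_in_gen.
- move=> N' w' [Hw' Ew'].
  have hf : @hom K V0 N' (mev w') by apply/mev_hom/hwv_lower.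
  have [|f' [hf' Ef']] := HU _ _ hf; last first.
    by exists f'; split=> //; rewrite Ef' mev_vgen_id.
  move=> u Su; have <- : mev w' (mev v0 u) = mev w' u.
    by rewrite (mev_map v0 u hf) mev_vgen_id.
  apply: (Su (fun u => mev w' u = 0)); first exact: (hom_ker hf).
  by move=> _ <-; rewrite (hf _ v0) mev_vgen_id.
(* For k >= n0 + 2 and j >= - 1, [e_bound] places the submodule of e above level n0, where the
   quotient no longer matters. *)
move=> Hr n0; exists n0.+2 => k Hk1; split=> [m ->|j l m Hj Hm Hl]; first by rewrite linear0.
rewrite -(theta_map v0 k m hg) => /Hk; rewrite /S => Hg.
pose y : V0 := theta v0 k m.
have Ey : mev v0 y = y.
  apply: mev_vgen.
  have Hy : @gen K (flow k V0) (eq (str 0 k v0)) y by exact: mev_in_gen.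
  apply: (Hy _ (flow_is_sub k (@normal_sub K _ _ _))) => _ <-.
  by apply: (@gen_str K V0 0 k v0 _ (@normal_sub K _ _ _)) => _ <-; exact: inspan_ew.
rewrite -/y Ey in Hg.
have y0 : y = 0.
  have [//|ny] := pselect (y = 0).
  have Hw0 : Sk a rho 0 0 v0 by apply/hwv_Sk0.
  have HC : ract Cc y = cch a *: y.
    by apply: (central_gen (vgen_hwv _ _ _)); rewrite -Ey; exact: mev_in_gen.
  have := e_bound Hg (flow_wt HC (theta_wt Hw0 k Hm)) ny.
  by lia.
by apply: (theta_verma_inj a0 Hr) y0; exact: Mwt_normal Hm.
Qed.

(** Universality maps N to the module of [top_exists], so the kernel of [theta] on N is no larger
    than there. *)
Lemma universal_adm N rho (w : N) : (forall i : int, rho != i%:~R) ->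
  universal rho w -> adm a rho [::] w.
Proof.
move=> Hr HU; have [N' [w' [[H1 H2 _] _ Ha]]] := top_exists rho.
have [|f [hf Ef]] := HU N' w'; first by split.
move=> n0; have [k1 Hk1] := Ha Hr n0; exists k1 => k /Hk1 [_ Hk].
split=> [m ->|j l m Hj Hm Hl E]; first by rewrite linear0.
by apply: (Hk j l) => //; rewrite -Ef -(theta_map w k m hf) E linear0.
Qed.
End TopModule.

(** * Towers of quotients and their reflections *)

Section Tau.
Variables (K : numFieldType) (a : K).
Hypothesis a0 : a != 0.
Implicit Types (N : rep K) (rho : K).

Lemma Sk_char N rho k n (z : N) : ract (Gp k) z = 0 -> ract (Gm (- k)) z = 0 ->
  ract (Jn 1) z = 0 -> wt (hh a rho 0) (qq a rho 0) k (k * k + 2 * n) z ->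
  ract Cc z = cch a *: z -> Sk a rho k n z.
Proof.
move=> HGp HGm HJ1 [WJ WL] HC; apply: hwv_pos_generators.
- by rewrite flowGp add0r.
- by rewrite flowGm add0r.
- by rewrite flowJ mulr0 scale0r addr0.
- rewrite flowL HC WJ WL eqxx.
  rewrite !scalerA -!scalerDl; congr (_ *: _).
  by rewrite /hh /qq /cch rmorphD !rmorphM /=; field.
- rewrite flowJ HC WJ eqxx scalerA -scalerDl; congr (_ *: _) => /=.
  by rewrite /qq /cch; field.
- by rewrite flowC.
Qed.

(** The condition on [Gp k] follows from that on [Gp (k - 1)] by bracketing with J_1. What is left
    is symmetric under exchange of G^+ and G^-, as [Topk_tau] needs. *)
Lemma Topk_char N rho k n (z : N) : Topk a rho k n z <->
  [/\ ract (Gp (k - 1)) z = 0, ract (Gm (- k)) z = 0, ract (Jn 1) z = 0,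
      wt (hh a rho 0) (qq a rho 0) k (k * k + 2 * n) z & ract Cc z = cch a *: z].
Proof.
split=> [[Hz Ez]|[HGp HGm HJ1 Hw HC]].
  split=> //; last by case: Hz => _ _ _; rewrite flowC.
  - by case: Hz => /(_ (Gm 0) isT) + _ _ _; rewrite flowGm add0r.
  - by case: Hz => /(_ (Jn 1) isT) + _ _ _; rewrite flowJ mulr0 scale0r addr0.
  - exact: Sk_wt Hz.
split=> //; apply: Sk_char => //.
have := ractB (Jn 1) (Gp (k - 1)) z.
rewrite HGp HJ1 !linear0 lcomb_cons lcomb_nil /= ?scaler0 ?subr0 addr0 scale1r.
have -> : 1 + (k - 1) = k by lia.
by rewrite addr0 => <-.
Qed.

Lemma topvec_Topk N rho (w : N) : topvec a rho w <-> Topk a rho 0 0 w.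
Proof. by rewrite /topvec hwv_Sk0. Qed.

(* The automorphism exchanging [Gp (n - 1)] and [Gm n]. *)
Definition tau N : rep K := mirror (flow (-1) N).

Lemma tauGp N i (u : N) : @ract K (tau N) (Gp i) u = ract (Gm (i + 1)) u.
Proof. by rewrite [LHS]lcomb_cons lcomb_nil addr0 scale1r flowGm. Qed.
Lemma tauGm N i (u : N) : @ract K (tau N) (Gm i) u = ract (Gp (i - 1)) u.
Proof. by rewrite [LHS]lcomb_cons lcomb_nil addr0 scale1r flowGp. Qed.
Lemma tauC N (u : N) : @ract K (tau N) Cc u = ract Cc u.
Proof. by rewrite [LHS]lcomb_cons lcomb_nil addr0 scale1r flowC. Qed.
Lemma tauJ N n (u : N) : @ract K (tau N) (Jn n) u =
  - ract (Jn n) u + (3%:R^-1 * (n == 0)%:R) *: ract Cc u.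
Proof. by rewrite [LHS]lcomb_cons lcomb_nil addr0 /= flowJ; lmod_field. Qed.
Lemma tauL N n (u : N) : @ract K (tau N) (Ln n) u =
  ract (Ln n) u - ract (Jn n) u + (6%:R^-1 * (n == 0)%:R) *: ract Cc u.
Proof. by rewrite [LHS]lcomb_cons lcomb_nil addr0 /= flowL; lmod_field. Qed.

Lemma tau_tau N x (u : N) : @ract K (tau (tau N)) x u = ract x u.
Proof.
case: x => [n|n||i|i].
- by rewrite (@tauL (tau N)) !(@tauL N) !tauJ tauC; lmod_field.
- by rewrite (@tauJ (tau N)) !(@tauJ N) tauC; lmod_field.
- by rewrite !tauC.
- by rewrite tauGp tauGm addrK.
- by rewrite tauGm tauGp subrK.
Qed.

Lemma tau_hom N1 N2 (f : {linear N1 -> N2}) : hom f -> @hom K (tau N1) (tau N2) f.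
Proof.
move=> /(@flow_hom K _ _ f (-1)) hf x u.
by rewrite [LHS]lcomb_linear; apply: eq_lcomb => t _; exact: hf.
Qed.

Lemma tau_is_sub N (S : N -> Prop) : is_sub S -> @is_sub K (tau N) S.
Proof.
move=> /(@flow_is_sub K N (-1)) HS; split; [exact: sub0 HS | exact: subZD HS | move=> x u Su].
by apply: (sub_lcomb HS) => y; exact: (sub_act HS).
Qed.

Lemma is_sub_tau N (S : N -> Prop) : @is_sub K (tau N) S -> is_sub S.
Proof.
move=> /(@tau_is_sub (tau N)) HS; split; [exact: sub0 HS | exact: subZD HS | move=> x u Su].
by rewrite -tau_tau; exact: (sub_act HS).
Qed.

Lemma gen_tau N (v u : N) : @gen K (tau N) (eq v) u <-> gen (eq v) u.
Proof.
by split=> H S HS; apply: H; [exact: tau_is_sub | exact: is_sub_tau].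
Qed.

Lemma Topk_tau N rho k n (z : N) :
  Topk a rho k n z <-> @Topk K a (tau N) (a^-1 - rho) (- k) (n + k) z.
Proof.
rewrite !Topk_char tauGp tauGm tauJ tauC /wt tauL tauJ mulr0 scale0r addr0.
rewrite (_ : - k - 1 + 1 = - k); last by lia.
rewrite (_ : - - k - 1 = k - 1); last by lia.
rewrite !eqxx /=; split=> -[H1 H2 H3 [H4 H5] H6]; split=> //.
- by rewrite H3 oppr0.
- split.
    rewrite H4 H6; rewrite -scaleNr scalerA -scalerDl; congr (_ *: _).
    by rewrite /qq /cch rmorphN /=; field.
  rewrite H4 H5 H6 -scaleNr scalerA -!scalerDl; congr (_ *: _).
  by rewrite /hh /qq /cch !(rmorphD, rmorphM, rmorphN) /=; field.
- by move/eqP: H3; rewrite oppr_eq0 => /eqP.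
- have EJ : ract (Jn 0) z = (qq a rho 0 - k%:~R) *: z.
    have -> : ract (Jn 0) z = 3%:R^-1 *: ract Cc z
       - (- ract (Jn 0) z + (3%:R^-1 * 1%:R) *: ract Cc z) by lmod_field.
    rewrite H4 H6 scalerA -scalerBl; congr (_ *: _).
    by rewrite /qq /cch rmorphN /=; field.
  split=> //.
  have -> : ract (Ln 0) z = (ract (Ln 0) z - ract (Jn 0) z + (6%:R^-1 * 1%:R) *: ract Cc z)
     + ract (Jn 0) z - 6%:R^-1 *: ract Cc z by lmod_field.
  rewrite H5 EJ H6 scalerA -scalerDl -scalerBl; congr (_ *: _).
  by rewrite /hh /qq /cch !(rmorphD, rmorphM, rmorphN) /=; field.
Qed.

Lemma topvec_tau N rho (w : N) : topvec a rho w <-> @topvec K a (tau N) (a^-1 - rho) w.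
Proof. by rewrite !topvec_Topk Topk_tau oppr0 add0r. Qed.

Lemma topmod_tau N rho (w : N) : topmod a rho w -> @topmod K a (tau N) (a^-1 - rho) w.
Proof.
case=> H1 H2 H3; have /topvec_tau [H4 H5] : topvec a rho w by split.
by split=> // u; apply/gen_tau.
Qed.

Lemma universal_tau N rho (w : N) : universal a rho w -> @universal K a (tau N) (a^-1 - rho) w.
Proof.
move=> HU N' w' /topvec_tau; rewrite opprB addrC subrK => /HU [f [/tau_hom hf Ef]].
exists f; split=> // x u; rewrite -[RHS](@tau_tau N'); exact: hf.
Qed.
End Tau.

Section Towers.
Variables (K : numFieldType) (a : K).
Hypothesis a0 : a != 0.
Implicit Types (N : rep K) (rho : K).

Definition spans N (P : N -> Prop) (z : N) : Prop :=
  [/\ P z, z <> 0 & forall z', P z' -> exists t : K, z' = t *: z].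

(* [w] generates the module obtained from the universal one of type [rho] by   *)
(* dividing out successive lines of vectors of [Topk k n], the list giving     *)
(* the [(k, n)], the last one first.                                           *)
Inductive tow rho : seq (int * int) -> forall N, N -> Prop :=
| tow_nil N (w : N) : topmod a rho w -> universal a rho w -> tow rho [::] w
| tow_cons k n L N0 (w0 : N0) N (g : {linear N0 -> N}) z :
    tow rho L w0 -> hom g -> (forall u, exists v, g v = u) -> spans (@Topk K a N0 rho k n) z ->
    (forall u, g u = 0 <-> gen (eq z) u) -> tow rho ((k, n) :: L) (g w0).

Lemma topmod_img N0 (w0 : N0) N (g : {linear N0 -> N}) rho : hom g ->
  (forall u, exists v, g v = u) -> topmod a rho w0 -> topmod a rho (g w0).
Proof.
move=> hg Hs [H1 H2 H3]; split; last by move=> u; have [v <-] := Hs u; exact: hom_gen.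
  by apply/hwv_Sk0; apply: Sk_hom => //; apply/hwv_Sk0.
by rewrite -hg H2 linear0.
Qed.

Lemma tow_topmod rho L N (w : N) : tow rho L w -> topmod a rho w.
Proof. by elim=> // {L N w} k n L N0 w0 N g z _ IH hg Hs _ _; exact: topmod_img. Qed.

(** Only the levels survive in the far frame, since every string there passes through charge 0; L
    and [refl L] thus give the same iterated singular space. *)
Lemma tow_adm rho L N (w : N) : (forall i : int, rho != i%:~R) -> tow rho L w ->
  adm a rho [seq absz t.2 | t <- L] w.
Proof.
move=> Hr; elim=> [{N w} N w HN HU | {L N w} k n L N0 w0 N g z HT IH hg Hs [Hz z0 Hl] Hk].
  exact: universal_adm.
have [n0 _] := Sk_bound (tow_topmod HT) Hz.1 z0.
have En : n = (absz n)%:Z by lia.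
rewrite En in Hz Hl; rewrite /=.
exact: (adm_cons a0 Hr (tow_topmod HT) IH hg Hz z0 Hl Hk).
Qed.

Lemma tow_extend rho L N0 (w0 : N0) k n : tow rho L w0 -> line (@Topk K a N0 rho k n) ->
  exists N (w : N), tow rho ((k, n) :: L) w.
Proof.
move=> HT [z Hz]; have [N [g [hg Hs Hk _]]] := quotient_lift (@gen_sub K N0 (eq z)).
by exists N; exists (g w0); apply: (tow_cons HT hg Hs Hz Hk).
Qed.

Definition refl (L : seq (int * int)) := [seq (- t.1, t.2) | t <- L].
Definition tauw (L : seq (int * int)) := [seq (- t.1, t.2 + t.1) | t <- L].

(** The conditions 0 <= n and [cc = 0] of [Topk_reflect] hold as soon as either side has a non-zero
    vector. *)
Lemma tow_Topk_reflect rho L N (w : N) N' (w' : N') k n : (forall i : int, rho != i%:~R) ->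
  tow rho L w -> tow (- rho) (refl L) w' ->
  (nz (@Topk K a N rho k n) <-> nz (@Topk K a N' (- rho) (- k) n)) /\
  (line (@Topk K a N rho k n) <-> line (@Topk K a N' (- rho) (- k) n)).
Proof.
move=> Hr HT HT'.
have Hr' i : - rho != i%:~R by rewrite eqr_oppLR -rmorphN Hr.
have HA := tow_adm Hr HT; have HA' := tow_adm Hr' HT'.
have E : [seq absz t.2 | t <- refl L] = [seq absz t.2 | t <- L] by rewrite -map_comp.
rewrite E in HA'.
have H : 0 <= n -> cc a rho (k - 1) n = 0 ->
  (nz (@Topk K a N rho k n) <-> nz (@Topk K a N' (- rho) (- k) n)) /\
  (line (@Topk K a N rho k n) <-> line (@Topk K a N' (- rho) (- k) n)).
  move=> n0 Hc; have En : n = (absz n)%:Z by lia.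
  rewrite En in Hc *.
  exact: (Topk_reflect a0 Hr (tow_topmod HT) HA (tow_topmod HT') HA' Hc).
have H1 : nz (@Topk K a N rho k n) -> 0 <= n /\ cc a rho (k - 1) n = 0.
  case=> z Hz z0; split; last exact: Topk_root z0.
  by have [] := Sk_bound (tow_topmod HT) Hz.1 z0.
have H2 : nz (@Topk K a N' (- rho) (- k) n) -> 0 <= n /\ cc a rho (k - 1) n = 0.
  case=> z Hz z0; split; first by have [] := Sk_bound (tow_topmod HT') Hz.1 z0.
  by rewrite -(Topk_root Hz z0) /cc !rmorphB rmorphN /=; ring.
have Ln N1 (P : N1 -> Prop) : line P -> nz P by case=> u [Pu u0 _]; exists u.
split; split.
- by move=> X; have [Y1 Y2] := H1 X; apply/(H Y1 Y2).1.
- by move=> X; have [Y1 Y2] := H2 X; apply/(H Y1 Y2).1.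
- by move=> X; have [Y1 Y2] := H1 (Ln _ _ X); apply/(H Y1 Y2).2.
- by move=> X; have [Y1 Y2] := H2 (Ln _ _ X); apply/(H Y1 Y2).2.
Qed.

(** Built one quotient at a time: the reflection of the smaller tower supplies the line to divide by
    next. *)
Lemma tow_reflect_exists rho L N (w : N) : (forall i : int, rho != i%:~R) ->
  tow rho L w -> exists N' (w' : N'), tow (- rho) (refl L) w'.
Proof.
move=> Hr; elim=> [{N w} N w HN HU | {L N w} k n L N0 w0 N g z HT [N' [w' HT']] hg Hs Hz Hk].
  have [N' [w' [H1 H2 _]]] := top_exists a0 (- rho).
  by exists N'; exists w'; apply: tow_nil.
apply: (tow_extend HT').
by apply: (tow_Topk_reflect k n Hr HT HT').2.1; exists z.
Qed.

Lemma tow_tau rho L N (w : N) : tow rho L w -> @tow (a^-1 - rho) (tauw L) (tau N) w.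
Proof.
elim=> [{N w} N w HN HU | {L N w} k n L N0 w0 N g z HT IH hg Hs [Hz z0 Hl] Hk].
  by apply: tow_nil; [exact: (topmod_tau a0) | exact: (universal_tau a0)].
apply: (@tow_cons _ _ _ _ (tau N0) w0 (tau N) g z) => //.
- exact: tau_hom.
- rewrite /=; split=> //; first exact: (@Topk_tau K a a0 N0 rho k n z).1.
  by move=> z' /(@Topk_tau K a a0 N0 rho k n z').2 /Hl.
- by move=> u; rewrite Hk gen_tau.
Qed.

(* Reflection followed by [tau] moves [rho] by [1 / a] and keeps [k]. *)
Definition stepw (L : seq (int * int)) := [seq (t.1, t.2 - t.1) | t <- L].

Lemma tow_step rho L N (w : N) : (forall i : int, rho != i%:~R) -> tow rho L w ->
  exists N' (w' : N'), tow (rho + a^-1) (stepw L) w' /\ forall k n,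
  (nz (@Topk K a N rho k n) <-> nz (@Topk K a N' (rho + a^-1) k (n - k))) /\
  (line (@Topk K a N rho k n) <-> line (@Topk K a N' (rho + a^-1) k (n - k))).
Proof.
move=> Hr HT; have [N' [w' HT']] := tow_reflect_exists Hr HT.
have Er : a^-1 - - rho = rho + a^-1 by rewrite opprK addrC.
exists (tau N'); exists w'; split.
  have := tow_tau HT'; rewrite Er /tauw /refl -map_comp.
  rewrite (_ : map _ L = stepw L) //; apply: eq_map => -[k n] /=.
  by rewrite opprK.
move=> k n; have [-> ->] := tow_Topk_reflect k n Hr HT HT'.
have -> : @Topk K a N' (- rho) (- k) n = @Topk K a (tau N') (rho + a^-1) k (n - k) :> (N' -> Prop).
  by apply: funext => z; apply: propext; rewrite (@Topk_tau K a a0 N' (- rho) (- k) n z) Er opprK.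
by [].
Qed.
End Towers.

(** * Extremal vectors *)

Section Extremal.
Variables (K : numFieldType) (a : K).
Implicit Types (N : rep K) (rho : K).

Definition gmw (k : nat) : word := [seq Gm (- (i.+1)%:Z) | i <- rev (iota 0 k)].

Lemma gmwS k : gmw k.+1 = Gm (- (k.+1)%:Z) :: gmw k.
Proof. by rewrite /gmw -addn1 iotaD rev_cat /= addn1. Qed.

Lemma gmw_Gm k : all is_Gm (gmw k).
Proof. by rewrite all_map; apply/allP. Qed.

Lemma str_wev N k (v : N) : str 0 k v = wev v (gmw k).
Proof. by elim: k => // k IH; rewrite gmwS /= IH add0r -addn1 PoszD. Qed.

Lemma Gm_anti N i j (u : N) : ract (Gm i) (ract (Gm j) u) = - ract (Gm j) (ract (Gm i) u).
Proof. by rewrite ract_comm lcomb_nil addr0 /ssign expr1 scaleN1r. Qed.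

Lemma wev_rem N (v : N) x s : all is_Gm s -> x \in s ->
  exists2 t : K, t != 0 & wev v s = t *: ract x (wev v (rem x s)).
Proof.
elim: s => //= y s IH /andP[Hy Hs]; rewrite inE; have [->|yx] := eqVneq y x.
  by move=> _; exists 1; rewrite ?oner_eq0 ?scale1r.
rewrite /= => xs; have [t t0 ->] := IH Hs xs.
exists (- t); first by rewrite oppr_eq0.
have := allP Hs _ xs; case: x y {IH yx xs} Hy => [n|n||n|n] // [m|m||m|m] // _ _.
by rewrite linearZ /= Gm_anti scalerN scaleNr.
Qed.

Lemma wev_perm N (v : N) s s' : all is_Gm s -> perm_eq s s' ->
  exists2 t : K, t != 0 & wev v s = t *: wev v s'.
Proof.
elim: s' s => [|x s' IH] s Hs Hp.
  by exists 1; rewrite ?oner_eq0 // scale1r; move/perm_nilP: Hp => ->.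
have xs : x \in s by rewrite (perm_mem Hp) mem_head.
have [t t0 ->] := wev_rem v Hs xs.
have [||t' t'0 ->] := IH (rem x s).
- by apply/allP => y /mem_rem; exact: allP.
- by rewrite -(perm_cons x) -(permPl (perm_to_rem xs)).
by exists (t * t'); [rewrite mulf_neq0 | rewrite linearZ /= scalerA].
Qed.

Lemma normal_sorted w : all lower w -> sorted (relpre key gtn) w -> normal w.
Proof.
elim: w => // x w IH /= /andP[Hx Hw] Hs.
rewrite IH // ?(path_sorted Hs) // andbT /consable Hx.
by case: w Hs {IH Hw} => //= y w /andP[-> _].
Qed.

(** The G^- anticommute, so up to sign the string is its sorted word, a PBW basis element. *)
Lemma str_vgen_neq0 (h q c : K) k : str 0 k (vgen h q c) <> 0.
Proof.
pose s := sort (relpre key geq) (gmw k).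
have Ps : perm_eq (gmw k) s by rewrite perm_sym perm_sort.
have Us : uniq s.
  rewrite sort_uniq map_inj_uniq ?rev_uniq ?iota_uniq // => i j [].
  by lia.
have Ns : normal s.
  apply: normal_sorted.
    by apply/allP => x; rewrite mem_sort => /mapP [i _ ->].
  rewrite -sorted_map gtn_sorted_uniq_geq map_inj_uniq ?Us; last exact: key_inj.
  by rewrite sorted_map; apply: sort_sorted => x y; exact: leq_total.
have [t t0] := wev_perm (vgen h q c) (gmw_Gm k) Ps; rewrite str_wev => -> /eqP.
rewrite scaler_eq0 (negbTE t0) /= wev_vgen // => /eqP/polyP/(_ (pickle s)).
by rewrite coefXn eqxx coef0 => /eqP; rewrite oner_eq0.
Qed.

(** Otherwise the string in the Verma module would lie in the submodule of [e], below the level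
    allowed by [e_bound]. *)
Lemma str_neq0 N rho (w : N) k : universal a rho w -> str 0 k w <> 0.
Proof.
pose v0 := vgen (hh a rho 0) (qq a rho 0) (cch a).
pose e := ract (Gp (-1)) v0.
move=> HU E0; have [Q [g [hg _ Hk _]]] := quotient_lift (@gen_sub K _ (eq e)).
have Hv0 := vgen_hwv (hh a rho 0) (qq a rho 0) (cch a).
have [|f [hf Ef]] := HU Q (g v0).
  split; first by apply/hwv_Sk0; apply: Sk_hom => //; apply/hwv_Sk0.
  by rewrite -hg; apply/Hk; exact: gen_in.
have : gen (eq e) (str 0 k v0).
  by apply/Hk; rewrite (str_hom 0 k v0 hg) -Ef -(str_hom 0 k w hf) E0 linear0.
move=> Hg; have Hs : Sk a rho k%:Z 0 (str 0 k v0).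
  by rewrite -[k%:Z]add0r; apply: Sk_str; apply/hwv_Sk0.
have := e_bound Hg (Sk_wt Hs) (@str_vgen_neq0 _ _ _ k).
lia.
Qed.

(** At l = j * j no room is left in [wt_word]: the only words not killing w are rearrangements of
    G^-_{-1/2}, .., G^-_{-(2k-1)/2}. *)
Lemma extremal N rho (w : N) k u : topmod a rho w ->
  wt (hh a rho 0) (qq a rho 0) (Posz k) (Posz k * Posz k) u ->
  exists t : K, u = t *: str 0 k w.
Proof.
case=> Hw Ew Hg Hu; have [m Em] := mev_gen (hwv_lower Hw) (Hg u).
have E0 : u - mev w m = 0 by rewrite -Em subrr.
have := wt_proj (@sub_zero K N) (hwv_wt Hw) Hu E0.
rewrite mev_bpart => /eqP; rewrite subr_eq0 => /eqP ->.
rewrite big_seq; elim/big_rec: _ => [|x y Hx [t ->]]; first by exists 0; rewrite scale0r.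
suff [s ->] : exists s : K, wev w x = s *: str 0 k w.
  by exists (m`_(pickle x) * s + t); rewrite scalerA -scalerDl.
move: Hx; rewrite mem_basis => /and3P[Nx /eqP Hj /eqP Hl].
have [GpI|GpN] := boolP (Gp (-1) \in x).
  have [x' ->] := normal_last Nx GpI.
  by exists 0; rewrite scale0r wev_rcons Ew wev0.
have [nA [nB [e [Ej El He Hp]]]] := wt_word Nx.
have {}He := He GpN; rewrite Hj in Ej; rewrite Hl in El.
have nA0 : nA = 0%N by nia.
have nBk : nB = k by lia.
have {}Hp : perm_eq (gmw k) x.
  rewrite perm_sym -nBk; apply: perm_trans (Hp nA0 _) _; first by nia.
  by rewrite perm_sym /gmw map_rev perm_rev.
have [t1 t10 E] := wev_perm w (gmw_Gm k) Hp.
by exists t1^-1; rewrite str_wev E scalerK.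
Qed.
End Extremal.

(** * Submodules, integrable types and the chain of steps *)

Section Submodules.
Variables (K : numFieldType) (a : K).
Implicit Types (N : rep K) (rho : K).

Lemma wt_flow N rho k j l (u : N) : ract Cc u = cch a *: u ->
  wt (hh a rho 0) (qq a rho 0) j l u ->
  @wt K (flow k N) (hh a rho k%:~R) (qq a rho k%:~R) (j - k) (l - 2 * j * k + k * k) u.
Proof.
move=> HC [HJ HL]; split.
  rewrite flowJ HC HJ /= scalerA -!scalerDl; congr (_ *: _).
  by rewrite /qq /cch rmorphB /=; field.
rewrite flowL HC HJ HL /= !scalerA -!scalerDl; congr (_ *: _).
by rewrite /hh /qq /cch !(rmorphB, rmorphD, rmorphM) /=; field.
Qed.

Section InTopmod.
Variables (N : rep K) (rho : K) (w : N).
Hypothesis HN : topmod a rho w.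

Lemma topmod_C (u : N) : ract Cc u = cch a *: u.
Proof. by case: HN => Hw _ Hg; exact: (central_gen Hw). Qed.

Lemma topmod_bound j l (u : N) : wt (hh a rho 0) (qq a rho 0) j l u -> u <> 0 ->
  exists n : nat, l = j * j + 2 * n%:Z /\ - j <= n%:Z.
Proof.
case: HN => H1 H2 H3 Hu u0.
by have [m [E Hm]] := weight_bound_top H1 (H3 u) H2 Hu u0; exists m; lia.
Qed.

(** In the frame k, z satisfies the hypotheses of [weight_bound_top]. *)
Lemma gen_Topk_bound k n z j l (y : N) : Topk a rho k n z -> gen (eq z) y ->
  wt (hh a rho 0) (qq a rho 0) j l y -> y <> 0 ->
  2 * n <= l - j * j /\ 2 * n + 2 * (k - j) <= l - j * j.
Proof.
move=> [Hz Ez] Hg Hy y0.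
have Ez' : @ract K (flow k N) (Gp (-1)) z = 0.
  by rewrite flowGp -[RHS]Ez; congr (ract (Gp _) z); lia.
have [HJ HL] := wt_flow k (topmod_C y) Hy.
have Hy' : @wt K (flow k N) (hh a rho k%:~R + n%:~R) (qq a rho k%:~R) (j - k)
    (l - 2 * j * k + k * k - 2 * n) y.
  split=> //; rewrite HL; congr (_ *: _).
  by rewrite rmorphB rmorphM /=; field.
by have [m [E Hm]] := weight_bound_top Hz (@gen_to_flow K N k _ _ Hg) Ez' Hy' y0; nia.
Qed.

(** Induction on (l - j * j) / 2 for a weight vector of S. [Gp j], [Gm (- j)] and [Jn 1] each lower
    this number by 1; if all three vanish, the vector is singular in the frame j and [Sk_descend]
    finishes. *)
Lemma sub_Topk (S : N -> Prop) u : is_sub S -> S u -> u <> 0 ->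
  exists k n z, [/\ Topk a rho k n z, S z & z <> 0].
Proof.
move=> HS Su u0; have [Hw _ Hg] := HN.
have [j [l [v [Hv Sv v0]]]] := sub_weight_vector Hw (Hg u) HS Su u0.
have [n [El _]] := topmod_bound Hv v0; subst l.
elim: n j v Hv Sv v0 => [|n IH] j v Hv Sv v0.
  have H0 x : dl x - 2 * j * dj x < dj x * dj x -> ract x v = 0.
    move=> Hx; have [//|E] := pselect (ract x v = 0).
    by have [m [Em _]] := topmod_bound (wt_act x Hv) E; move: (dj x) (dl x) Hx Em => c d; nia.
  have Hs : Sk a rho j 0 v.
    by apply: (Sk_char _ _ _ Hv (topmod_C v)); apply: H0 => /=; lia.
  by have [k0 [z [_ Hz Sz z0]]] := Sk_descend HN HS Sv Hs v0; exists k0, 0, z.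
have step x j' : j + dj x = j' -> dl x - 2 * j * dj x = dj x * dj x - 2 -> ract x v <> 0 ->
    exists k n z, [/\ Topk a rho k n z, S z & z <> 0].
  move=> Ej El E; apply: (IH j' (ract x v)) => //; last exact: sub_act.
  have := wt_act x Hv; rewrite Ej.
  by congr (wt _ _ _ _ _); move: (dj x) (dl x) Ej El => c d *; nia.
have [E1|] := pselect (ract (Gp j) v = 0); last by apply: (step _ (j - 1)) => //=; lia.
have [E2|] := pselect (ract (Gm (- j)) v = 0); last by apply: (step _ (j + 1)) => //=; lia.
have [E3|] := pselect (ract (Jn 1) v = 0); last by apply: (step _ j) => //=; lia.
have Hs := Sk_char E1 E2 E3 Hv (topmod_C v).
by have [k0 [z [_ Hz Sz z0]]] := Sk_descend HN HS Sv Hs v0; exists k0, n.+1%:Z, z.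
Qed.
End InTopmod.

Hypothesis a0 : a != 0.

Section Integrable.
Variables (N : rep K) (r : nat) (w : N).
Notation rho := ((Posz r.+1)%:~R : K).
Hypothesis HN : topmod a rho w.
Hypothesis Hw : str 0 r.+1 w = 0.

Lemma cc_integrable (j : int) : 0 <= j < r%:Z -> cc a rho j 0 != 0.
Proof.
move=> Hj; have -> : cc a rho j 0 = 2%:R * a * ((j + 1) * (r.+1%:Z - j - 1))%:~R.
  by rewrite /cc rmorphM !rmorphB rmorphD /=; ring.
by rewrite !mulf_neq0 ?pnatr_eq0 // intr_eq0 mulf_neq0 //; lia.
Qed.

(* The vector at the end of the string below [w] is extremal for the frame in  *)
(* which the roles of [Gp] and [Gm] are exchanged.                             *)
Lemma Sk_upper_bound k n (u : N) : Sk a rho k n u -> u <> 0 -> k <= n + r%:Z.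
Proof.
move=> Hu u0; pose M := tau (flow r.+1 N); pose y := str 0 r w.
have Hy0 : Sk a rho r%:Z 0 y by rewrite -[r%:Z]add0r; apply/Sk_str/topmod_Sk.
have HC (v : N) : ract Cc v = cch a *: v by exact: (topmod_C HN).
have WM j l (v : N) : wt (hh a rho 0) (qq a rho 0) j l v ->
    @wt K M (hh a rho 0) (qq a rho 0) (r%:Z - j) (l + r%:Z * r%:Z - 2 * j * r%:Z) v.
  case=> HJ HL; split.
    by rewrite tauJ flowJ flowC HC HJ /= /qq /cch !(rmorphB, rmorphD) /= -?pmulrn; lmod_field.
  rewrite tauL flowL flowJ flowC HC HJ HL /= /hh /qq /cch !(rmorphB, rmorphD, rmorphM) /= -?pmulrn.
  by lmod_field.
have HyM : @hwv K M (hh a rho 0) (qq a rho 0) (cch a) y.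
  have [Hpos _ _ _] := Hy0.
  have [HJ HL] := WM _ _ _ (Sk_wt Hy0).
  apply: hwv_pos_generators.
  - rewrite tauGp flowGm; have := Hpos (Gm 0) isT; rewrite flowGm.
    by congr (ract (Gm _) y = 0); lia.
  - rewrite tauGm flowGp; have := Hpos (Gp 0) isT; rewrite flowGp.
    by congr (ract (Gp _) y = 0); lia.
  - rewrite tauJ mulr0 scale0r addr0 flowJ mulr0 scale0r addr0.
    by have := Hpos (Jn 1) isT; rewrite flowJ mulr0 scale0r addr0 => ->; rewrite oppr0.
  - by rewrite HL; congr (_ *: _); rewrite (_ : _ - _ = 0) ?mul0r ?addr0 //; lia.
  - by rewrite HJ subrr subr0.
  - by rewrite tauC flowC.
have EyM : @ract K M (Gp (-1)) y = 0.
  rewrite tauGp flowGm -[RHS]Hw /= add0r; congr (ract (Gm _) y); lia.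
have Hyw : gen (eq y) w.
  by apply: (str_gen _ (topmod_Sk HN)) => j; rewrite add0r; exact: cc_integrable.
have Hgen : @gen K M (eq y) u.
  apply: (@gen_tau K (flow r.+1 N) y u).2; apply: gen_to_flow.
  by apply: (gen_trans Hyw); case: HN.
have [m [E Hm]] := weight_bound_top HyM Hgen EyM (WM _ _ _ (Sk_wt Hu)) u0.
by nia.
Qed.

(** If 2k > r, the other root r + 1 - k of [cc] is at most k, and the string above z never breaks,
    against [Sk_upper_bound]. *)
Lemma integrable_Topk k n (z : N) : Topk a rho k n z -> z <> 0 -> 2 * k <= r%:Z.
Proof.
move=> Hz z0; have Hroot := Topk_root Hz z0.
have [//|lt_rk] : 2 * k <= r%:Z \/ r.+1%:Z <= 2 * k by lia.
pose i := (absz (n + r%:Z - k)%R).+1.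
have Hg : gen (eq (str k i z)) z.
  apply: (str_gen _ Hz.1) => j Hj; have -> : j = (j + 1) - 1 by lia.
  by apply: (cc_neq0 a0 Hroot); rewrite ?eqr_int; lia.
have nz : str k i z <> 0.
  by move=> E; apply: z0; apply: (Hg _ (@sub_zero K N)) => _ <-.
by have := Sk_upper_bound (Sk_str i Hz.1) nz; rewrite /i; lia.
Qed.
End Integrable.

Lemma tow_chain rho L N (w : N) (d : nat) : tow a rho L w ->
  (forall i : nat, (i < d)%N -> forall m : int, rho + i%:R / a != m%:~R) ->
  exists N' (w' : N'), tow a (rho + d%:R / a) [seq (t.1, t.2 - d%:Z * t.1) | t <- L] w' /\
  forall k n,
    (nz (@Topk K a N rho k n) <-> nz (@Topk K a N' (rho + d%:R / a) k (n - d%:Z * k))) /\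
    (line (@Topk K a N rho k n) <-> line (@Topk K a N' (rho + d%:R / a) k (n - d%:Z * k))).
Proof.
move=> HT; elim: d => [|d IH] Hd.
  exists N; exists w; rewrite mul0r addr0; split.
    rewrite (_ : map _ L = L) //; elim: {HT} L => //= -[k n] L ->.
    by rewrite mul0r subr0.
  by move=> k n; rewrite mul0r subr0.
have [|N' [w' [HT' H']]] := IH; first by move=> i Hi; apply: Hd; exact: ltnW.
have [N2 [w2 [HT2 H2]]] := tow_step a0 (Hd d (ltnSn d)) HT'.
have Er : rho + d%:R / a + a^-1 = rho + d.+1%:R / a by rewrite -natr1; field.
rewrite Er in HT2 H2; exists N2; exists w2; split.
  rewrite (_ : map _ L = stepw [seq (t.1, t.2 - d%:Z * t.1) | t <- L]) //.
  rewrite /stepw -map_comp; apply: eq_map => -[k n] /=; congr pair; lia.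
move=> k n; have [-> ->] := H' k n.
by rewrite (_ : n - d.+1%:Z * k = n - d%:Z * k - k) //; lia.
Qed.
End Submodules.

(** * The case of a rational parameter *)

Section TowerInversion.
Variables (K : numFieldType) (a : K).
Implicit Types (N : rep K) (rho : K).

Lemma tow_inv rho L N (w : N) : tow a rho L w ->
  match L with
  | [::] => topmod a rho w /\ universal a rho w
  | (k, n) :: L' => exists N0 (w0 : N0) (g : {linear N0 -> N}) z,
      [/\ tow a rho L' w0, hom g, g w0 = w, spans (@Topk K a N0 rho k n) z &
        forall u, g u = 0 <-> gen (eq z) u]
  end.
Proof.
case=> [{N w} N w HN HU // | {L N w} k n L N0 w0 N g z HT hg Hs Hz Hk].
by exists N0, w0, g, z.
Qed.

Lemma topvec_hom N1 N2 (f : {linear N1 -> N2}) rho w : hom f ->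
  topvec a rho w -> topvec a rho (f w).
Proof.
move=> hf [H1 H2]; split; last by rewrite -hf H2 linear0.
by apply/hwv_Sk0; apply: Sk_hom => //; apply/hwv_Sk0.
Qed.

Lemma str_Topk N (r : nat) (w : N) : topmod a r.+1%:~R w ->
  Topk a r.+1%:~R r.+1 0 (str 0 r.+1 w).
Proof.
move=> HN; have Hs i := Sk_str i (topmod_Sk HN).
have Hr := Hs r; have := Hs r.+1; rewrite !add0r in Hr * => H1; split=> //.
rewrite /= add0r (_ : r.+1%:Z - 1 = r); last by lia.
rewrite (Sk_EF Hr) (_ : cc _ _ _ _ = 0) ?scale0r //.
by rewrite /cc -!pmulrn -natr1; ring.
Qed.

Lemma str_spans N (r : nat) (w : N) : topmod a r.+1%:~R w -> str 0 r.+1 w <> 0 ->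
  spans (@Topk K a N r.+1%:~R r.+1 0) (str 0 r.+1 w).
Proof.
move=> HN nz; split=> //; first exact: str_Topk.
by move=> z [/Sk_wt Hz _]; apply: (extremal HN); move: Hz; rewrite addr0.
Qed.

Lemma wt00 N rho (w u : N) : topmod a rho w -> wt (hh a rho 0) (qq a rho 0) 0 0 u ->
  exists t : K, u = t *: w.
Proof. by move=> HN; exact: (@extremal K a N rho w 0). Qed.

End TowerInversion.

Section Integral.
Variables (K : numFieldType) (r s d : nat).
Let p := (r.+1 + s.+1)%N.
Hypothesis co : coprime p d.+1.
Let a : K := d.+1%:R / p%:R.
Implicit Types (N : rep K).

Lemma pnz : p%:R != 0 :> K. Proof. by rewrite pnatr_eq0. Qed.
Lemma dnz : d.+1%:R != 0 :> K. Proof. by rewrite pnatr_eq0. Qed.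
Lemma anz : a != 0. Proof. by rewrite mulf_neq0 ?invr_eq0 ?pnz ?dnz. Qed.
Lemma aV : a^-1 = p%:R / d.+1%:R. Proof. by rewrite invf_div. Qed.

Let rho1 : K := a^-1 - r.+1%:~R.

(** An integral value would make d + 1 divide (i + 1) p, hence i + 1 by coprimality, although i <
    d. *)
Lemma rho1_nonint (i : nat) : (i < d)%N -> forall m : int, rho1 + i%:R / a != m%:~R.
Proof.
move=> Hi m; apply/eqP => E.
have E1 : ((i.+1 * p)%N%:Z)%:~R = ((m + r.+1%:Z) * d.+1%:Z)%:~R :> K.
  rewrite rmorphM rmorphD /= -E /rho1 -[_ / a]/(_ * a^-1) aV -!pmulrn natrM -[i.+1]addn1 natrD.
  by field; rewrite ?natr1 ?nat1r pnatr_eq0.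
have {}E1 := intr_inj E1.
have : (d.+1 %| i.+1 * p)%N.
  have : (d.+1%:Z %| (i.+1 * p)%N%:Z)%Z by rewrite E1 dvdz_mull.
  by [].
by rewrite Gauss_dvdl 1?coprime_sym // => /dvdn_leq; lia.
Qed.

Lemma rho1_end : rho1 + d%:R / a = s.+1%:~R.
Proof.
rewrite /rho1 -[_ / a]/(_ * a^-1) aV -!pmulrn /p natrD -natr1; field.
by rewrite ?natr1 ?nat1r pnatr_eq0.
Qed.

Lemma rho1_root (k n : int) : cc a rho1 (k - 1) n = 0 ->
  (n + k) * p%:Z = k * (r.+1%:Z + k) * d.+1%:Z.
Proof.
have a0 := anz.
move=> E; apply: (@intr_inj K); rewrite !(rmorphM, rmorphD) /= -!pmulrn.
have En : n%:~R = - (a * k%:~R * (a^-1 - r.+1%:R - k%:~R)) :> K.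
  apply/eqP; rewrite -subr_eq0 opprK; apply/eqP.
  have -> : n%:~R + a * k%:~R * (a^-1 - r.+1%:R - k%:~R) = 2%:R^-1 * cc a rho1 (k - 1) n.
    by rewrite /cc /rho1 rmorphB /= -!pmulrn; field.
  by rewrite E mulr0.
have -> : n%:~R + k%:~R = a * k%:~R * (r.+1%:R + k%:~R) :> K by rewrite En; field.
by rewrite /a; field; exact: pnz.
Qed.

Section Universal.
Variables (V : rep K) (w : V).
Let rho : K := r.+1%:~R.
Hypothesis HV : topmod a rho w.
Hypothesis Hstr : str 0 r.+1 w = 0.
Hypothesis HU : forall N' (w' : N'), topvec a rho w' -> str 0 r.+1 w' = 0 ->
  exists f : {linear V -> N'}, hom f /\ f w = w'.

(** V is the universal module of type r + 1 divided by its extremal vector at (r + 1, 0): the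
    universal property of V over the quotient Q shows that nothing more is killed. *)
Lemma V_tow : tow a rho [:: (r.+1%:Z, 0)] w.
Proof.
have [N0 [w0 [HT U0 _]]] := top_exists anz rho.
have [|g [hg Eg]] := U0 V w; first by case: HV.
have [Q [q [hq _ Hk _]]] := quotient_lift (@gen_sub K N0 (eq (str 0 r.+1 w0))).
have sp := str_spans HT (str_neq0 (k := r.+1) U0).
rewrite -Eg; apply: (tow_cons (tow_nil HT U0) hg _ sp) => [u|u].
  have [_ _ /(_ u)] := HV; rewrite -Eg => /(gen_hom hg) [u' _ <-].
  by exists u'.
split=> [E|]; last first.
  move=> H; apply: (H (fun u => g u = 0)); first exact: hom_ker.
  by move=> _ <-; rewrite (str_hom 0 r.+1 w0 hg) Eg.
have [||f [hf Ef]] := HU (N' := Q) (w' := q w0).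
- by apply: topvec_hom => //; case: HT.
- by rewrite -(str_hom 0 r.+1 w0 hq); apply/Hk; exact: gen_in.
apply/Hk; have <- : f (g u) = q u; last by rewrite E linear0.
case: HT => _ _ Hall.
have hfg : @hom K N0 Q (f \o g) by move=> x v /=; rewrite hg hf.
apply: (@hom_ext K N0 Q (f \o g) q w0 hfg hq Hall).
by rewrite /= Eg.
Qed.

Lemma V_neq0 : w <> 0.
Proof.
move=> w0; have [N0 [w' [g [z [/tow_inv[HT U0] hg Eg [Hz z0 _] Hk]]]]] := tow_inv V_tow.
have Hw' := (topmod_Sk HT).
have Hz0 : gen (eq z) w' by apply/Hk; rewrite Eg.
have := gen_Topk_bound HT Hz Hz0 (Sk_wt Hw') (str_neq0 (k := 0) U0).
lia.
Qed.

Lemma tauV_tow : @tow K a rho1 [:: (- r.+1%:Z, r.+1%:Z)] (tau V) w.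
Proof. by have := tow_tau anz V_tow; rewrite /= add0r. Qed.

(** After d steps the type is s + 1 and (s + 1, (s + 1) d) has become (s + 1, 0), the place of the
    extremal vector. It survives in the quotient, as the submodule divided out begins at level (r +
    1)(d + 1) > 0. *)
Lemma tauV_line : line (@Topk K a (tau V) rho1 s.+1 (s.+1 * d)%N).
Proof.
have [N' [w' [HT H]]] := tow_chain anz tauV_tow rho1_nonint.
apply/(H _ _).2; rewrite rho1_end in HT *.
rewrite (_ : _ - _ = 0); last by lia.
have HN := tow_topmod HT; exists (str 0 s.+1 w'); apply: str_spans => // E0.
have [N0 [w0 [g [z [/tow_inv[HT0 U0] hg Eg [Hz z0 _] Hk]]]]] := tow_inv HT.
have Hg : gen (eq z) (str 0 s.+1 w0) by apply/Hk; rewrite (str_hom 0 s.+1 w0 hg) Eg.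
have Hs := Sk_str s.+1 (topmod_Sk HT0); rewrite add0r in Hs.
have := gen_Topk_bound HT0 Hz Hg (Sk_wt Hs) (str_neq0 (k := s.+1) U0).
rewrite /= mulr0 addr0 subrr => -[H1 _]; clear -H1; nia.
Qed.

(** [integrable_Topk] applies at both ends of the chain: at type r + 1 with charge index - k, and at
    type s + 1 with k. This gives - r <= 2k <= s. *)
Lemma topsing_trivial (N : rep K) (u : N) :
  tow a rho1 [:: (s.+1%:Z, (s.+1 * d)%N%:Z); (- r.+1%:Z, r.+1%:Z)] u ->
  @str K (tau N) 0 r.+1 u = 0 ->
  forall k n (z : N), Topk a rho1 k n z -> z <> 0 -> k = 0 /\ n = 0.
Proof.
move=> HT Hu k n z Hz z0.
have HN := tow_topmod HT; have [n0 nk] := Sk_bound HN Hz.1 z0.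
have Hroot := rho1_root (Topk_root Hz z0).
have Er : a^-1 - rho1 = r.+1%:~R by rewrite /rho1 opprB addrC subrK.
have HN1 : @topmod K a (tau N) r.+1%:~R u by rewrite -Er; exact: topmod_tau anz _ _ _ HN.
have Hz1 : @Topk K a (tau N) r.+1%:~R (- k) (n + k) z.
  by rewrite -Er; apply/(@Topk_tau K a anz N rho1 k n z).
have := integrable_Topk anz HN1 Hu Hz1 z0.
have [N' [w' [HT' H']]] := tow_chain anz HT rho1_nonint.
have [|z' Hz' z'0] := (H' k n).1.1; first by exists z.
rewrite rho1_end in HT' Hz'.
have HN' := tow_topmod HT'; have [n'0 n'k] := Sk_bound HN' Hz'.1 z'0.
have E' : str 0 s.+1 w' = 0.
  have [N0 [w0 [g [y [HT0 hg <- [_ _ Hl] Hk]]]]] := tow_inv HT'.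
  have E0 : (s.+1 * d)%N%:Z - d%:Z * s.+1%:Z = 0 by lia.
  rewrite /= E0 in Hl.
  have [t Et] := Hl _ (str_Topk (tow_topmod HT0)).
  rewrite -(str_hom 0 s.+1 w0 hg) Et linearZ /=.
  by rewrite (_ : g y = 0) ?scaler0 //; apply/Hk; exact: gen_in.
have := integrable_Topk anz HN' E' Hz' z'0.
(* The root equation is (n + k) p = k (r + 1 + k)(d + 1). If k > 0, then r + 1 + k < p gives n < d
   k, against n - d k >= 0; if k < 0, then r + 1 + k > 0 gives n + k < 0, against - k <= n; k = 0
   forces n = 0. *)
move: Hroot n0 nk n'0 n'k; rewrite /p; clear; nia.
Qed.

Lemma tau_str (i : nat) : @str K (tau (tau V)) 0 i w = str 0 i w.
Proof. by elim: i => //= i ->; rewrite tau_tau. Qed.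

Let lev : nat := (s.+1 * d.+1)%N.

Lemma Topk_V_tau (y : V) :
  Topk a rho (- s.+1%:Z) lev y <-> @Topk K a (tau V) rho1 s.+1 (s.+1 * d)%N y.
Proof.
have El : lev%:Z + - s.+1%:Z = (s.+1 * d)%N%:Z by rewrite /lev; lia.
by have := @Topk_tau K a anz V rho (- s.+1%:Z) lev y; rewrite opprK El.
Qed.

Lemma V_line : line (@Topk K a V rho (- s.+1%:Z) lev%:Z).
Proof.
have [z [Hz z0 Hl]] := tauV_line.
have E := Topk_V_tau.
by exists z; split=> //; [exact/E | move=> y /E /Hl].
Qed.

(** The type r + 1 is integral, but the second root r + s + 2 lies above the range from - (s + 1) to
    0, so the string of the [Topk] line still reaches the frame 0 unbroken. *)
Lemma sing_line0 : line (@Sk K a V rho 0 lev%:Z).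
Proof.
have := V_line => -[z [Hz z0 _]].
have [||_ H] := @Topk_stable K a anz V rho (- s.+1%:Z) lev 0 _ w HV (Topk_root Hz z0).
- by move=> i Hi; rewrite eqr_int; lia.
- by [].
by apply/H; exact: V_line.
Qed.

(** u is up to scalar the vector s + 1 steps above z in its string, and each step can be undone. *)
Lemma sing_Topk u : Sk a rho 0 lev u -> u <> 0 ->
  exists z, [/\ spans (@Topk K a V rho (- s.+1%:Z) lev%:Z) z, gen (eq z) u & gen (eq u) z].
Proof.
move=> Hu u0; have [z [Hz z0 Hl]] := V_line; exists z; split=> //.
all: have Hs := Sk_str s.+1 Hz.1; rewrite addNr in Hs.
all: have [v [Hv v0 Hlv]] := sing_line0; have [t1 E1] := Hlv _ Hu; have [t2 E2] := Hlv _ Hs.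
all: have Hgz : gen (eq (str (- s.+1%:Z) s.+1 z)) z.
1,3: apply: (str_gen _ Hz.1) => j Hj; have -> : j = (j + 1) - 1 by lia.
1,2: by apply: (cc_neq0 anz (Topk_root Hz z0)); rewrite ?eqr_int; lia.
- have t20 : t2 != 0.
    apply/eqP => t20; rewrite t20 scale0r in E2; apply: z0.
    by apply: (Hgz _ (@sub_zero K V)) => _ <-.
  rewrite E1 -(scalerK t20 v) -E2 scalerA; apply: (subZ (@gen_sub K V _)).
  exact: gen_str.
- apply: (gen_trans (v := str (- s.+1%:Z) s.+1 z)) => //.
  have t10 : t1 != 0 by apply/eqP => t10; apply: u0; rewrite E1 t10 scale0r.
  rewrite E2 -(scalerK t10 v) -E1 scalerA; apply: (subZ (@gen_sub K V _)).
  exact: gen_in.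
Qed.

Lemma sing_not_top u : Sk a rho 0 lev u -> u <> 0 -> ~ gen (eq u) w.
Proof.
move=> Hu u0; have [z [[Hz _ _] Hzu _]] := sing_Topk Hu u0.
move=> /(gen_trans Hzu) Hg.
have := gen_Topk_bound HV Hz Hg (Sk_wt (topmod_Sk HV)) V_neq0.
by rewrite /lev; nia.
Qed.

(** S has non-zero image in the quotient of [tau V] by z, hence contains a [Topk] vector there; by
    [topsing_trivial] it is a multiple of the generator. *)
Lemma sub_contains_top u (S : V -> Prop) v : Sk a rho 0 lev u -> u <> 0 ->
  is_sub S -> S v -> ~ gen (eq u) v -> S w.
Proof.
move=> Hu u0 HS Sv nv; have [z [Hz Hzu Huz]] := sing_Topk Hu u0.
have Hz' : spans (@Topk K a (tau V) rho1 s.+1 (s.+1 * d)%N) z.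
  have E := Topk_V_tau.
  case: Hz => Hz1 z0 Hl; split=> //; first exact/E.
  by move=> y /E /Hl.
have [N [g [hg Hs Hk _]]] := quotient_lift (@gen_sub K (tau V) (eq z)).
have HT := tow_cons tauV_tow hg Hs Hz' Hk.
have HN := tow_topmod HT.
have Estr : @str K (tau N) 0 r.+1 (g w) = 0.
  by rewrite -(@str_hom K (tau (tau V)) (tau N) g 0 r.+1 w (tau_hom hg)) tau_str Hstr linear0.
have HS2 := hom_img hg (tau_is_sub HS).
have [||k [n [y [Hy [x Sx Ex] y0]]]] := sub_Topk HN HS2 (u := g v).
- by exists v.
- by move/Hk/gen_tau => Hv; apply: nv; exact: gen_trans Huz Hv.
have [k0 n0] := topsing_trivial HT Estr Hy y0; subst k n.
have [t Et] := wt00 HN (Sk_wt Hy.1).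
have t0 : t != 0 by apply/eqP => t0; apply: y0; rewrite Et t0 scale0r.
have Hd : gen (eq z) (w - t^-1 *: x).
  by apply/gen_tau/Hk; rewrite linearB linearZ /= Ex Et scalerK // subrr.
(* So far S contains w only modulo the submodule of z. Projecting x to the weight of w gives a
   multiple t' w in S with (1 - t') w in the submodule of z, and t' is non-zero since w is not
   there. *)
have [Hw Ew Hall] := HV; have [m Em] := mev_gen (hwv_lower Hw) (Hall (t^-1 *: x)).
rewrite Em in Hd; have Ww := hwv_wt Hw.
have {}Hd := wt_proj (@gen_sub K V (eq z)) Ww Ww Hd.
have W0 : wt (hh a rho 0) (qq a rho 0) 0 0 (0 : V) by split; rewrite linear0 scaler0.
have Sm : S (0 - mev w m) by rewrite sub0r -Em; apply: (subN HS); apply: (subZ HS).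
have {}Sm := wt_proj HS Ww W0 Sm.
have [t' Et'] : exists t' : K, mev w (bpart 0 0 m) = t' *: w.
  apply: (wt00 HV); have hM := mev_hom (hwv_lower Hw).
  have [HJ HL] := Mwt_wt (hh a rho 0) (qq a rho 0) (cch a) (@Mwt_bpart K 0 0 m).
  by split; rewrite -hM ?HJ ?HL linearZ.
rewrite Et' in Hd Sm; have t'0 : t' != 0.
  apply/eqP => t'0; apply: (sing_not_top Hu u0); apply: gen_trans Huz _.
  by rewrite t'0 scale0r subr0 in Hd.
rewrite -(scalerK t'0 w); apply: (subZ HS).
by rewrite -[_ *: _]opprK; apply: (subN HS); rewrite -sub0r.
Qed.
End Universal.
End Integral.

(** * Graded modules *)

Section GradedModules.
Variables (K : numFieldType) (M : ns2_module K).
Notation N := (rep_of M).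

Lemma homog_split (u0 u1 v0 v1 : M) : ns2_homog false u0 -> ns2_homog true u1 ->
  ns2_homog false v0 -> ns2_homog true v1 -> u0 + u1 = v0 + v1 -> u0 = v0 /\ u1 = v1.
Proof.
move=> h0 h1 k0 k1 E; have E' : u0 - v0 = v1 - u1.
  have -> : u0 = v0 + v1 - u1 by rewrite -E addrK.
  by rewrite addrAC [v0 + v1]addrC addrK.
have HB b (x y : M) : ns2_homog b x -> ns2_homog b y -> ns2_homog b (x - y).
  by move=> hx hy; rewrite addrC -scaleN1r; apply: ns2_homogZD.
have Z : u0 - v0 = 0 by apply: ns2_homog_cap; [exact: HB | rewrite E'; exact: HB].
by split; apply/eqP; rewrite -subr_eq0 ?Z // -opprB -E' Z oppr0.
Qed.

(** The elements whose two homogeneous parts are both generated by v form a submodule containing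
    v. *)
Lemma gen_submodule b (v : M) : ns2_homog b v -> ns2_submodule (@gen K N (eq v)).
Proof.
move=> hv; have [S0 SZ SA] := @gen_sub K N (eq v).
split=> // u0 u1 h0 h1 Hu.
have [v0 [v1 [g0 g1 k0 k1 E]]] : exists v0 v1, [/\ @gen K N (eq v) v0, @gen K N (eq v) v1,
    ns2_homog false v0, ns2_homog true v1 & u0 + u1 = v0 + v1].
  apply: (Hu (fun u => exists v0 v1, [/\ @gen K N (eq v) v0, @gen K N (eq v) v1,
    ns2_homog false v0, ns2_homog true v1 & u = v0 + v1])); last first.
    move=> _ <-; case: b hv => hv; [exists 0, v | exists v, 0]; split; rewrite ?addr0 ?add0r //;
    by [exact: gen_in | exact: ns2_homog0].
  split.
  - by exists 0, 0; split; rewrite ?addr0 //; exact: ns2_homog0.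
  - move=> k _ _ [x0 [x1 [g0 g1 h2 h3 ->]]] [y0 [y1 [g2 g3 h4 h5 ->]]].
    exists (k *: x0 + y0), (k *: x1 + y1); split; [exact: SZ|exact: SZ|exact: ns2_homogZD|exact: ns2_homogZD|].
    by rewrite scalerDr addrACA.
  - move=> x _ [x0 [x1 [g0 g1 h2 h3 ->]]].
    have := ns2_homog_act x h2; have := ns2_homog_act x h3.
    case: (ns2_parity x) => /= k3 k2.
      exists (ns2_act x x1), (ns2_act x x0); split=> //; try exact: SA.
      by rewrite [LHS]linearD addrC.
    exists (ns2_act x x0), (ns2_act x x1); split=> //; try exact: SA.
    by rewrite [LHS]linearD.
by have [-> ->] := homog_split h0 h1 k0 k1 E.
Qed.

Lemma generated_gen b (v u : M) : ns2_homog b v ->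
  ns2_generated v u <-> @gen K N (eq v) u.
Proof.
move=> hv; split=> H; first by apply: H; [exact: gen_submodule hv | exact: gen_in].
by move=> S [S0 SZ SA _] Sv; apply: H => [|_ <-].
Qed.

Lemma generated_submodule (v : M) : ns2_submodule (ns2_generated v).
Proof.
split=> [S [S0 _ _ _] // | k x y Hx Hy S HS Sv | x y Hy S HS Sv | u0 u1 h0 h1 Hu].
- by have [_ SZ _ _] := HS; apply: SZ; [exact: Hx | exact: Hy].
- by have [_ _ SA _] := HS; apply: SA; exact: Hy.
- by split=> S HS Sv; have [_ _ _ SH] := HS; have [] := SH _ _ h0 h1 (Hu S HS Sv).
Qed.

Lemma wev_homog b (v : M) x : ns2_homog b v ->
  ns2_homog (b (+) odd (absz (wtj x))) (@wev K N v x).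
Proof.
move=> hv; elim: x => [|x w IH]; first by rewrite /wtj big_nil addbF.
have := ns2_homog_act x IH; congr (ns2_homog _ _); rewrite -addbA /wtj big_cons; congr (_ (+) _).
move: (\sum_(y <- w) dj y) => j; case: x {IH} => [n|n||n|n] /=; rewrite ?add0r ?addbF //; lia.
Qed.

Lemma hwv_flow0 (h q c : K) (u : M) : @hwv K N h q c u <-> @hwv K (flow 0 N) h q c u.
Proof.
split=> -[H1 H2 H3 H4]; split=> [x Hx|||]; rewrite ?flow0 //; first exact: H1.
- by rewrite -flow0 H1.
- by rewrite -(@flow0 K N).
- by rewrite -(@flow0 K N).
- by rewrite -(@flow0 K N).
Qed.
End GradedModules.

Section Presented.
Variables (K : numFieldType) (a : K) (r : nat).
Notation rho := ((Posz r.+1)%:~R : K).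

Lemma hh_jm0 : a * jm0 K r.+1 = hh a rho 0.
Proof. by rewrite /jm0 /hh -pmulrn; field. Qed.
Lemma qq_jm0 : 2%:R * a * jm0 K r.+1 = qq a rho 0.
Proof. by rewrite /jm0 /qq -pmulrn; field. Qed.

Lemma Gm_string_str (V : ns2_module K) m (w : V) : Gm_string m w = @str K (rep_of V) 0 m w.
Proof.
elim: m => //= m ->; rewrite /ract /=; congr (ns2_act (Gm _) _); lia.
Qed.

Lemma sc_relE (V : ns2_module K) (w : V) :
  sc_rel a r.+1 w <-> @topvec K a (rep_of V) rho w /\ @str K (rep_of V) 0 r.+1 w = 0.
Proof.
rewrite /sc_rel hh_jm0 qq_jm0 Gm_string_str.
by split=> [[H1 H2 H3 [H4 H5 H6]] | [[[H1 H4 H5 H6] H2] H3]]; split.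
Qed.

Section Doubled.
Variables (N : rep K) (w : N).
Definition emb (b : bool) (u : N) : doubled N := if b then (0, u) else (u, 0).

Lemma emb_act b x (u : N) : ns2_act x (emb b u) = emb (b (+) ns2_parity x) (ract x u).
Proof. by rewrite /= /dact /emb; case: b; case: (ns2_parity x); rewrite /= !linear0. Qed.

Lemma embZ b k (u : N) : emb b (k *: u) = k *: emb b u.
Proof. by case: b; congr pair; rewrite scaler0. Qed.

Lemma emb0 b : emb b 0 = 0.
Proof. by case: b. Qed.

Lemma emb_str i b : @str K (rep_of (doubled N)) 0 i (emb b w) = emb (b (+) odd i) (str 0 i w).
Proof.
elim: i => [|i IH]; first by rewrite addbF.
rewrite -[LHS]/(@ns2_act K (doubled N) (Gm (- (0 + i%:Z + 1)))
  (@str K (rep_of (doubled N)) 0 i (emb b w))) IH emb_act.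
by rewrite [odd _.+1]/= addbT addbN.
Qed.

Lemma emb_topvec rho' : topvec a rho' w -> @topvec K a (rep_of (doubled N)) rho' (emb false w).
Proof.
case=> -[H1 H2 H3 H4] H5; split; last by rewrite -[LHS]/(ns2_act _ _) emb_act H5 emb0.
split=> [x Hx|||]; rewrite -[LHS]/(ns2_act _ _) emb_act.
- by rewrite H1 // emb0.
- by rewrite H2 embZ.
- by rewrite H3 embZ.
- by rewrite H4 embZ.
Qed.

Definition undouble (u : doubled N) : N := u.1 + u.2.
Fact undouble_linear : linear undouble.
Proof. by move=> k u v; rewrite /undouble /= scalerDr addrACA. Qed.
HB.instance Definition _ := GRing.isLinear.Build K (doubled N) N _ undouble undouble_linear.

Lemma undouble_hom : @hom K (rep_of (doubled N)) N undouble.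
Proof.
move=> x u; rewrite /undouble /= /dact; case: (ns2_parity x); rewrite /= linearD //.
by rewrite addrC.
Qed.
End Doubled.

Variables (V : ns2_module K) (w : V).
Hypothesis hV : is_sc_verma a r.+1 w.
Notation W := (rep_of V).

Lemma sc_topmod : @topmod K a W rho w.
Proof.
have [hw /sc_relE [[H1 H2] _] Hg _] := hV; split=> // u.
by apply/(generated_gen u hw).
Qed.

Lemma sc_str : @str K W 0 r.+1 w = 0.
Proof. by have [_ /sc_relE []] := hV. Qed.

(** The universal property of V concerns graded modules; it is applied to the doubled module and
    followed by [undouble]. *)
Lemma sc_universal (N : rep K) (w' : N) : topvec a rho w' -> str 0 r.+1 w' = 0 ->
  exists f : {linear W -> N}, hom f /\ f w = w'.
Proof.
move=> Hw' Es; have [_ _ _ HU] := hV.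
have [||f [[_ hf] Ef]] := HU (doubled N) (emb false w').
- by [].
- by apply/sc_relE; split; [exact: emb_topvec | rewrite emb_str Es emb0].
exists (@undouble N \o f); split=> [x u|].
  by rewrite /= -[ract x u]/(ns2_act x u) hf; exact: undouble_hom.
by rewrite /= Ef /undouble addr0.
Qed.
End Presented.

(** * The graded statement *)

Section Final.
Variables (K : numFieldType) (r s d : nat).
Hypothesis co : coprime (r.+1 + s.+1) d.+1.
Notation a := (d.+1%:R / (r.+1 + s.+1)%:R : K).
Notation rho := ((Posz r.+1)%:~R : K).
Notation lev := ((s.+1 * d.+1)%N).
Variables (h q c : K) (M : ns2_module K) (v : M) (V : ns2_module K) (w : V).
Hypothesis Eh : h = hh a rho 0 + lev%:R.
Hypothesis Eq : q = qq a rho 0.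
Hypothesis Ec : c = cch a.
Hypothesis hM : is_verma h q c v.
Hypothesis hV : is_sc_verma a r.+1 w.
Notation W := (rep_of V).

Lemma hwv_sing u : @hwv K W h q c u <-> @Sk K a W rho 0 lev u.
Proof. by rewrite hwv_flow0 Eh Eq Ec. Qed.

Lemma singular_Sk u : u <> 0 -> ns2_singular h q u <-> @Sk K a W rho 0 lev u.
Proof.
move=> u0; rewrite -hwv_sing; split=> [[_ H1 H2 H3]|[H1 H2 H3 _]]; split=> //.
by rewrite Ec; exact: (@topmod_C K a W rho w (sc_topmod hV)).
Qed.

(** The parity of a word applied to the even vector w is that of its charge, here 0. *)
Lemma Sk_even u : @Sk K a W rho 0 lev u -> ns2_homog false u.
Proof.
move=> Hu; have HV := sc_topmod hV; have [Hw _ Hg] := HV; have Ww := hwv_wt Hw.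
have [m Em] := mev_gen (hwv_lower Hw) (Hg u).
have E0 : (u : W) - mev (w : W) m = 0 by rewrite -Em subrr.
have := wt_proj (@sub_zero K W) Ww (Sk_wt Hu) E0.
rewrite mev_bpart => /eqP; rewrite subr_eq0 => /eqP ->; rewrite big_seq.
elim/big_rec: _ => [|x y]; first exact: ns2_homog0.
rewrite mem_basis => /and3P[_ /eqP Hj _]; apply: ns2_homogZD.
have hw : ns2_homog false w by case: hV.
by have := wev_homog x hw; rewrite Hj.
Qed.

Theorem main_graded :
  ns2_hom_dim M V 1 /\
  exists N : V,
    [/\ ns2_homog false N, ns2_singular h q N,
        (forall N' : V, ns2_homog false N' -> ns2_singular h q N' ->
           exists k : K, k <> 0 /\ N' = k *: N) &
        ns2_maximum_proper_submodule (ns2_generated N)].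
Proof.
have HV := sc_topmod hV; have HS := sc_str hV.
have HU := @sc_universal K a r V w hV.
have [N [HN N0 Hl]] := sing_line0 co HV HS HU.
have hN := Sk_even HN.
have [hv Pv Hgen Hext] := hM; have [hw _ _ _] := hV.
split.
  have [|f [hf Ef]] := Hext V N hN; first by move/hwv_sing: HN.
  exists (fun=> f); split=> [_ //|g [hg1 hg2]].
  (* A morphism is determined by the image of v, which satisfies the singular vector equations and
     so lies on the line spanned by N. *)
  have Hgv : @Sk K a W rho 0 lev (g v).
    apply/hwv_sing; have [H1 H2 H3 H4] := Pv.
    split=> [x Hx|||]; rewrite -[LHS]/(ns2_act _ _) -hg2.
    - by rewrite H1 // linear0.
    - by rewrite H2 linearZ.
    - by rewrite H3 linearZ.
    - by rewrite H4 linearZ.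
  have [t Et] := Hl _ Hgv.
  exists (\row_(i < 1) t); split=> [u|c' Hc']; last first.
    apply/rowP => i; rewrite mxE !ord1; have := Hc' v.
    rewrite big_ord1 Et Ef => /eqP; rewrite -subr_eq0 -scalerBl scaler_eq0.
    by case/orP=> [|/eqP //]; rewrite subr_eq0 => /eqP.
  rewrite big_ord1 mxE; apply: (Hgen u (fun u => g u = t *: f u)); last by rewrite Et Ef.
  have [hf1 hf2] := hf; split.
  - by rewrite (linear0 g) (linear0 f) scaler0.
  - by move=> k x y Ex Ey; rewrite (linearP g) (linearP f) Ex Ey scalerDr !scalerA mulrC.
  - by move=> x y E; rewrite hg2 hf2 E linearZ.
  - move=> u0 u1 h0 h1; rewrite (linearD g) (linearD f).
    have HZ b x : ns2_homog b x -> ns2_homog b (t *: x).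
      by move=> hx; rewrite -[_ *: _]addr0; apply: ns2_homogZD => //; exact: ns2_homog0.
    rewrite scalerDr; apply: homog_split; [exact: hg1|exact: hg1| |].
      by apply: HZ; exact: hf1.
    by apply: HZ; exact: hf1.
exists N; split=> //; first exact/singular_Sk.
  move=> N' _ HN'; have N'0 : N' <> 0 by case: HN'.
  have [t Et] := Hl _ ((singular_Sk N'0).1 HN'); exists t; split=> // t0.
  by apply: N'0; rewrite Et t0 scale0r.
split; first exact: generated_submodule.
  exists w => /(generated_gen w hN).1; exact: (sing_not_top co HV HS HU HN N0).
move=> T [T0 TZ TA TH] [x nTx] u Tu; apply/(generated_gen u hN).
have [//|nu] := pselect (@gen K W (eq N) u).
case: nTx; have HT : @is_sub K W T by [].
have Tw := sub_contains_top co HV HS HU HN N0 HT Tu nu.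
by have [_ _ /(_ x) Hx] := HV; apply: (Hx T HT) => _ <-.
Qed.
End Final.

Theorem theorem1p2 (R : realType) (p p' r : nat)
    (hp : (2 <= p)%N) (hp' : (1 <= p')%N) (hpp' : coprime p p')
    (hr1 : (1 <= r)%N) (hr2 : (r <= p - 1)%N)
    (a : R[i]) (ha : a = p'%:R / p%:R)
    (c : R[i]) (hc : c = 3%:R * (1 - 2%:R * a))
    (h : R[i]) (hh : h = (p%:R - r%:R) * p'%:R + a * jm0 R[i] r)
    (q : R[i]) (hq : q = 2%:R * a * jm0 R[i] r)
    (M : ns2_module R[i]) (v : M) (hM : is_verma h q c v)
    (V : ns2_module R[i]) (w : V) (hV : is_sc_verma a r w) :
  ns2_hom_dim M V 1 /\
  exists N : V,
    [/\ ns2_homog false N,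
        ns2_singular h q N,
        (forall N' : V, ns2_homog false N' -> ns2_singular h q N' ->
           exists k : R[i], k <> 0 /\ N' = k *: N) &
        ns2_maximum_proper_submodule (ns2_generated N)].
Proof.
case: r hr1 hr2 hh hq hV => // r _ hr2 hh hq hV; case: p' hp' hpp' ha hh => // d _ co ha hh.
(* With r and p' replaced by r + 1 and d + 1, the positive number p - r is s + 1, and the level is
   (s + 1)(d + 1). *)
have [s Ep] : exists s, p = (r.+1 + s.+1)%N by exists (p - r.+2)%N; lia.
subst p a; apply: (main_graded co _ _ hc hM hV); last by rewrite hq qq_jm0.
rewrite hh hh_jm0 addrC; congr (_ + _).
by rewrite natrD addrAC subrr add0r -natrM.
Qed.
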